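(* Let $k\in\mathbb N$, $k\ge2$, and let $E$ be a symmetric space with the Fatou property. The following are equivalent. (i) $E$ is locally fully $k$-rotund. (ii) $E$ is $(LFkR)^+$, i.e. for every $x\in S_E$, $|x|$ is a point of local fully $k$-rotundity of $E$. (iii) $E$ is $(LFkR)^*$, i.e. for every $x\in S_E$, $x^*$ is a point of local fully $k$-rotundity of $E$.
   Context: Let $I=[0,\alpha)$, $\alpha=1$ or $\alpha=\infty$, with Lebesgue measure $\mu$, and $L^0$ the set of (classes of) extended real valued measurable functions on $I$. A Banach function space $(E,\|\cdot\|_E)$ is a Banach lattice that is a sublattice of $L^0$ such that (1) if $x\in L^0$, $y\in E$, $|x|\le|y|$ a.e., then $x\in E$ and $\|x\|_E\le\|y\|_E$; (2) there is a strictly positive $x\in E$. $E^+=\{x\in E:x\ge0\}$; $S_E$ is the unit sphere. Fatou property: if $(x_n)\subset E^+$, $\sup_n\|x_n\|_E<\infty$ and $x_n\uparrow x\in L^0$, then $x\in E$ and $\|x_n\|_E\uparrow\|x\|_E$. For $x\in L^0$: $d_x(\lambda)=\mu\{s\in I:|x(s)|>\lambda\}$ and $x^*(t)=\inf\{\lambda>0:d_x(\lambda)\le t\}$. A symmetric space is a Banach function space $E$ such that $x\in L^0$, $y\in E$, $d_x=d_y$ imply $x\in E$ and $\|x\|_E=\|y\|_E$. A point $x\in S_E$ is a point of local fully $k$-rotundity if for every sequence $(x_n)\subset S_E$ such that $\|x+\sum_{i=1}^k x_{n,i}\|_E\to k+1$ as $n\to\infty$ for any $k$ subsequences $(x_{n,1})_n,\dots,(x_{n,k})_n$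 of $(x_n)$, one has $\|x_n-x\|_E\to0$. $E$ is locally fully $k$-rotund if every $x\in S_E$ is such a point. *)

(* Defs.v *)
From mathcomp Require Import all_boot all_order all_algebra.
From mathcomp Require Import all_classical all_reals all_analysis.
From mathcomp Require Import measurable_realfun.

Set Implicit Arguments.
Unset Strict Implicit.
Unset Printing Implicit Defensive.

Import Order.TTheory GRing.Theory Num.Theory.
Import numFieldNormedType.Exports.

Local Open Scope classical_set_scope.
Local Open Scope ring_scope.

Definition dom (R : realType) (alpha : \bar R) : set R :=
  [set s | 0 <= s /\ (s%:E < alpha)%E].

(* The elements of L^0 are represented by functions R -> \bar R, of which only
   the values on [dom alpha] matter; equality of classes is equality almost
   everywhere on [dom alpha].  Measurability is with respect to the Borel sets;
   this gives the same classes as Lebesgue measurability, since every Lebesgue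
   measurable function is almost everywhere equal to a Borel one. *)
Definition L0 (R : realType) (alpha : \bar R) : set (R -> \bar R) :=
  [set x : R -> \bar R | measurable_fun (dom alpha) x].

Definition ae_on (R : realType) (alpha : \bar R) (P : R -> Prop) : Prop :=
  {ae @lebesgue_measure R, forall s, dom alpha s -> P s}.

(* [bfs_ideal] implies that membership and norm depend only on the class of a
   function.  The elements of a vector subspace of L^0 are finite almost
   everywhere ([bfs_fin]), so the value given to oo - oo in \bar R and the
   arbitrary values of [bfs_norm] outside the space play no role. *)
Record BFS (R : realType) (alpha : \bar R) := {
  bfs_mem : set (R -> \bar R);
  bfs_norm : (R -> \bar R) -> R;
  bfs_L0 : bfs_mem `<=` L0 alpha;
  bfs_fin : forall x, bfs_mem x -> ae_on alpha (fun s => x s \is a fin_num);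
  bfs_add : forall x y, bfs_mem x -> bfs_mem y ->
    bfs_mem (fun s => (x s + y s)%E);
  bfs_scale : forall (a : R) x, bfs_mem x -> bfs_mem (fun s => (a%:E * x s)%E);
  bfs_sup : forall x y, bfs_mem x -> bfs_mem y ->
    bfs_mem (fun s => maxe (x s) (y s));
  bfs_inf : forall x y, bfs_mem x -> bfs_mem y ->
    bfs_mem (fun s => mine (x s) (y s));
  bfs_norm_ge0 : forall x, bfs_mem x -> 0 <= bfs_norm x;
  bfs_norm_eq0 : forall x, bfs_mem x -> bfs_norm x = 0 ->
    ae_on alpha (fun s => x s = 0%E);
  bfs_normD : forall x y, bfs_mem x -> bfs_mem y ->
    bfs_norm (fun s => (x s + y s)%E) <= bfs_norm x + bfs_norm y;
  bfs_normZ : forall (a : R) x, bfs_mem x ->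
    bfs_norm (fun s => (a%:E * x s)%E) = `|a| * bfs_norm x;
  bfs_complete : forall u : nat -> R -> \bar R,
    (forall n, bfs_mem (u n)) ->
    (forall e : R, 0 < e -> exists m, forall p q, (m <= p)%N -> (m <= q)%N ->
       bfs_norm (fun s => (u p s - u q s)%E) < e) ->
    exists2 x, bfs_mem x &
      (fun n => bfs_norm (fun s => (u n s - x s)%E)) @ \oo --> (0 : R);
  bfs_ideal : forall x y, L0 alpha x -> bfs_mem y ->
    ae_on alpha (fun s => (`|x s| <= `|y s|)%E) ->
    bfs_mem x /\ bfs_norm x <= bfs_norm y;
  bfs_pos : exists2 x, bfs_mem x & ae_on alpha (fun s => (0 < x s)%E)
}.

Section BanachFunctionSpace.
Variables (R : realType) (alpha : \bar R).
Implicit Types (x : R -> \bar R) (E : BFS alpha).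

Definition distrf x (l : R) : \bar R :=
  @lebesgue_measure R [set s | dom alpha s /\ (l%:E < `|x s|)%E].

(* The infimum of the empty set is +oo. *)
Definition rearr x (t : R) : \bar R :=
  ereal_inf [set l%:E | l in [set l : R | 0 < l /\ (distrf x l <= t%:E)%E]].

Definition symmetric_space E : Prop :=
  forall x y, L0 alpha x -> bfs_mem E y ->
    (forall l, 0 <= l -> distrf x l = distrf y l) ->
    bfs_mem E x /\ bfs_norm E x = bfs_norm E y.

Definition positive_cone E : set (R -> \bar R) :=
  [set x | bfs_mem E x /\ ae_on alpha (fun s => (0 <= x s)%E)].

Definition unit_sphere E : set (R -> \bar R) :=
  [set x | bfs_mem E x /\ bfs_norm E x = 1].

Definition Fatou_property E : Prop :=
  forall (u : nat -> R -> \bar R) x,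
    (forall n, positive_cone E (u n)) ->
    (exists M : R, forall n, bfs_norm E (u n) <= M) ->
    L0 alpha x ->
    ae_on alpha (fun s => nondecreasing_seq (fun n => u n s) /\
                          (fun n => u n s) @ \oo --> x s) ->
    [/\ bfs_mem E x,
        nondecreasing_seq (fun n => bfs_norm E (u n)) &
        (fun n => bfs_norm E (u n)) @ \oo --> bfs_norm E x].

Definition LFkR_point (k : nat) E x : Prop :=
  unit_sphere E x /\
  forall u : nat -> R -> \bar R,
    (forall n, unit_sphere E (u n)) ->
    (forall phi : 'I_k -> nat -> nat,
       (forall i, {homo phi i : m n / (m < n)%N}) ->
       (fun n => bfs_norm E
          (fun s => (x s + \sum_(i < k) u (phi i n) s)%E)) @ \oo -->
         (k.+1%:R : R)) ->
    (fun n => bfs_norm E (fun s => (u n s - x s)%E)) @ \oo --> (0 : R).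

Definition LFkR (k : nat) E : Prop :=
  forall x, unit_sphere E x -> LFkR_point k E x.

Definition LFkR_plus (k : nat) E : Prop :=
  forall x, unit_sphere E x -> LFkR_point k E (fun s => `|x s|%E).

Definition LFkR_star (k : nat) E : Prop :=
  forall x, unit_sphere E x -> LFkR_point k E (rearr x).

End BanachFunctionSpace.

(* Main.v *)
From mathcomp Require Import finmap.
Require Import Defs.
From mathcomp Require Import all_boot all_order all_algebra.
From mathcomp Require Import all_classical all_reals all_analysis.
From mathcomp Require Import measurable_realfun.
From mathcomp Require Import ring lra.

(** Testing the defining condition on |u_n| and on |x + u_n|/2 shows that a unit
    vector x is a point of local full k-rotundity as soon as |x| satisfies the
    condition for nonnegative sequences; this gives (ii) => (i).

    For (iii) => (i) let x, u_n >= 0.  By the Fatou property, truncations of a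
    point of local full k-rotundity are maximizing sequences for it, so (iii)
    makes all elements of E order continuous.  Then every finite sum is
    approximated in norm by step functions on dyadic cells, for which sorting by
    compare-exchange steps yields ||x + sum u_i|| <= ||x* + sum u_i*||.  Hence
    u_n* -> x* and, likewise, ((x + u_n)/2)* -> x* in E.  Averaging over cyclic
    shifts of the cells bounds integrals over [0, T) by the norm, so the integrals
    of (x - c)_+, (u_n - c)_+ and ((x + u_n)/2 - c)_+, which depend only on the
    rearrangements, become equal in the limit.  The convexity gap of (. - c)_+
    forces u_n -> x in measure, and order continuity of x* upgrades this to norm
    convergence. *)

Set Implicit Arguments.
Unset Strict Implicit.
Unset Printing Implicit Defensive.

Import Order.TTheory GRing.Theory Num.Theory.
Import numFieldNormedType.Exports.

(** * Finite Borel representatives of the elements of E *)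

Section Layer.
Local Open Scope classical_set_scope.
Local Open Scope ring_scope.
Variables (R : realType) (alpha : \bar R).
Hypothesis halpha : alpha = 1%E \/ alpha = +oo%E.
Variable E : BFS alpha.
Notation mu := (@lebesgue_measure R).
Notation D := (dom alpha).
Implicit Types f g h : R -> R.

(** Convergence of u_n* to x* forgets where the values of u_n sit. The midpoints (x + u_n)/2 recover
    this: two functions lying on opposite sides of a level c average to one whose (. - c)_+ is
    strictly below the mean of theirs. Midpoints are not unit vectors, and truncations are not
    either, which is why the defining condition is extended to test sequences whose norms merely
    tend to 1, and is phrased through lower bounds alone.

    On [0, oo) elements of E need not be integrable. Cutting at a height c > 0 cures this: order
    continuity forces x* to vanish at infinity, so beyond some T neither x* nor, for large n, u_n*
    exceeds c, and only integrals over [0, T) matter. For the same reason discretization errors are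
    bounded by min(f, eta), or by eta on a level set of f, never by the constant eta: under (iii)
    nonzero constants lie outside E when alpha = oo. *)

Lemma measurable_dom : measurable D.
Proof.
case: halpha => ->.
- rewrite (_ : dom _ = `[0, 1[%classic); first exact: measurable_itv.
  by apply/seteqP; split=> s /=; rewrite /dom /= in_itv/= lte_fin; [case=> -> ->|case/andP].
- rewrite (_ : dom _ = `[0, +oo[%classic); first exact: measurable_itv.
  by apply/seteqP; split=> s /=; rewrite /dom /= in_itv/= ltry andbT; [case|].
Qed.

(** The point 0 is singled out because a decreasing rearrangement may be infinite there; pointwise
    statements about x* are made for s > 0 only. *)
Lemma ae_on_pos (P : R -> Prop) :
  (forall s, D s -> 0 < s -> P s) -> ae_on alpha P.
Proof.
move=> H; exists [set 0]; split=> //; first by rewrite lebesgue_measure_set1.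
move=> s /= /not_implyP[Ds nPs]; apply: contrapT => s0; apply: nPs; apply: H => //.
by case: Ds => s_ge0 _; rewrite lt_neqAle eq_sym s_ge0 andbT; apply/eqP.
Qed.

Lemma ae_onS (P Q : R -> Prop) :
  (forall s, D s -> P s -> Q s) -> ae_on alpha P -> ae_on alpha Q.
Proof.
rewrite /ae_on => PQ; apply: (@filterS _ _ (ae_filter_ringOfSetsType mu)) => s Ps Ds.
exact: PQ Ds (Ps Ds).
Qed.

(* Every class in E has a representative that is finite and Borel on the whole
   line; [Emem] and [nrm] are E and its norm on such representatives. *)
Definition Emem f := measurable_fun [set: R] f /\ bfs_mem E (EFin \o f).
Definition nrm f := bfs_norm E (EFin \o f).

Lemma mem_measurable f : Emem f -> measurable_fun [set: R] f. Proof. by case. Qed.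

Lemma L0_EFin f : measurable_fun [set: R] f -> L0 alpha (EFin \o f).
Proof.
move=> mf; rewrite /L0 /=; apply/measurable_EFinP.
by apply: measurable_funS mf.
Qed.

Lemma bfs_ae_eq (x y : R -> \bar R) : L0 alpha x -> bfs_mem E y ->
  ae_on alpha (fun s => x s = y s) -> bfs_mem E x /\ bfs_norm E x = bfs_norm E y.
Proof.
move=> Lx Ey xy.
have [Ex le1] : bfs_mem E x /\ bfs_norm E x <= bfs_norm E y.
  apply: bfs_ideal => //; by apply: ae_onS xy => s _ ->.
have [_ le2] : bfs_mem E y /\ bfs_norm E y <= bfs_norm E x.
  apply: bfs_ideal => //; first exact: (bfs_L0 Ey).
  by apply: ae_onS xy => s _ ->.
by split=> //; apply/le_anti/andP.
Qed.

Lemma nrm_le f g : measurable_fun [set: R] f -> Emem g ->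
  (forall s, D s -> 0 < s -> `|f s| <= `|g s|) -> Emem f /\ nrm f <= nrm g.
Proof.
move=> mf [mg Eg] fg.
have [|Ef le1] := bfs_ideal (L0_EFin mf) Eg _.
  by apply: ae_on_pos => s Ds s0; rewrite /= lee_fin fg.
by [].
Qed.

Lemma mem_le f g : measurable_fun [set: R] f -> Emem g ->
  (forall s, D s -> 0 < s -> `|f s| <= `|g s|) -> Emem f.
Proof. by move=> mf Mg fg; have [] := nrm_le mf Mg fg. Qed.

Lemma ler_nrm f g : measurable_fun [set: R] f -> Emem g ->
  (forall s, D s -> 0 < s -> `|f s| <= `|g s|) -> nrm f <= nrm g.
Proof. by move=> mf Mg fg; have [] := nrm_le mf Mg fg. Qed.

Lemma eq_nrm f g : Emem f -> Emem g ->
  (forall s, D s -> 0 < s -> `|f s| = `|g s|) -> nrm f = nrm g.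
Proof.
move=> Mf Mg fg; apply/le_anti; rewrite !ler_nrm//.
- exact: mem_measurable.
- by move=> s ? ?; rewrite fg.
- exact: mem_measurable.
- by move=> s ? ?; rewrite fg.
Qed.

Lemma nrm_ge0 f : Emem f -> 0 <= nrm f.
Proof. by case=> _; apply: bfs_norm_ge0. Qed.

Lemma memD f g : Emem f -> Emem g -> Emem (fun s => f s + g s).
Proof.
move=> [mf Ef] [mg Eg]; split; first exact: measurable_funD.
by have := bfs_add Ef Eg.
Qed.

Lemma memZ (a : R) f : Emem f -> Emem (fun s => a * f s).
Proof.
move=> [mf Ef]; split; first exact: measurable_funM.
by have := bfs_scale a Ef.
Qed.

Lemma nrmD f g : Emem f -> Emem g -> nrm (fun s => f s + g s) <= nrm f + nrm g.
Proof. by move=> [mf Ef] [mg Eg]; have := bfs_normD Ef Eg. Qed.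

Lemma nrmZ (a : R) f : Emem f -> nrm (fun s => a * f s) = `|a| * nrm f.
Proof. by move=> [mf Ef]; have := bfs_normZ a Ef. Qed.

Lemma mem_norm f : Emem f -> Emem (fun s => `|f s|).
Proof.
move=> Mf; apply: (mem_le _ Mf); last by move=> s _ _; rewrite normr_id.
by apply: measurableT_comp => //; exact: mem_measurable.
Qed.

Lemma nrm_norm f : Emem f -> nrm (fun s => `|f s|) = nrm f.
Proof. by move=> Mf; apply: eq_nrm => // [|s _ _]; [exact: mem_norm|rewrite normr_id]. Qed.

Lemma mem0 : Emem (fun=> 0).
Proof.
have [x Ex _] := bfs_pos E.
split; first exact: measurable_cst.
have := bfs_scale 0 Ex; congr bfs_mem.
by apply/funext => s; rewrite mul0e.
Qed.

Lemma nrm0 : nrm (fun=> 0) = 0.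
Proof.
transitivity (nrm (fun s => 0 * (fun=> 0) s)).
  by congr nrm; apply/funext => s; rewrite mul0r.
by rewrite (nrmZ 0 mem0) normr0 mul0r.
Qed.

Lemma memN f : Emem f -> Emem (fun s => - f s).
Proof. by move=> /(memZ (-1)); congr Emem; apply/funext => s; rewrite mulN1r. Qed.

Lemma memB f g : Emem f -> Emem g -> Emem (fun s => f s - g s).
Proof. by move=> Mf /memN; exact: memD. Qed.

Lemma nrmN f : Emem f -> nrm (fun s => - f s) = nrm f.
Proof. by move=> Mf; apply: eq_nrm => // [|s _ _]; [exact: memN|rewrite normrN]. Qed.

Lemma nrm_sub f g : Emem f -> Emem g -> nrm (fun s => f s - g s) <= nrm f + nrm g.
Proof. by move=> Mf Mg; rewrite -(nrmN Mg); apply: nrmD => //; exact: memN. Qed.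

Lemma nrm_distC f g : Emem f -> Emem g ->
  nrm (fun s => f s - g s) = nrm (fun s => g s - f s).
Proof. by move=> Mf Mg; apply: eq_nrm; [exact: memB|exact: memB|move=> s _ _; exact: distrC]. Qed.

Lemma nrm_lerD f g : Emem f -> Emem g ->
  nrm f <= nrm g + nrm (fun s => f s - g s).
Proof.
move=> Mf Mg; apply: le_trans (nrmD Mg (memB Mf Mg)).
apply: ler_nrm; [exact: mem_measurable|exact: memD (memB _ _)|].
by move=> s _ _; rewrite addrC subrK.
Qed.

Lemma mem_sum (I : Type) (r : seq I) (F : I -> R -> R) :
  (forall i, Emem (F i)) -> Emem (fun s => \sum_(i <- r) F i s).
Proof.
move=> MF; elim: r => [|i r IH].
  by under eq_fun do rewrite big_nil; exact: mem0.
by under eq_fun do rewrite big_cons; exact: memD.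
Qed.

Lemma nrm_sum (I : Type) (r : seq I) (F : I -> R -> R) :
  (forall i, Emem (F i)) ->
  nrm (fun s => \sum_(i <- r) F i s) <= \sum_(i <- r) nrm (F i).
Proof.
move=> MF; elim: r => [|i r IH].
  by under eq_fun do rewrite big_nil; rewrite nrm0 big_nil.
under eq_fun do rewrite big_cons; rewrite big_cons.
apply: le_trans (nrmD (MF i) (mem_sum r MF)) _.
by rewrite lerD2l.
Qed.

Definition real_rep (x : R -> \bar R) (s : R) : R :=
  if `[< D s >] then fine (x s) else 0.

Lemma measurable_real_rep x : L0 alpha x -> measurable_fun [set: R] (real_rep x).
Proof.
move=> Lx.
have -> : real_rep x = (fine \o x) \_ D.
  apply/funext => s; rewrite /real_rep patchE.
  by case: asboolP => Ds; [rewrite mem_set|rewrite memNset].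
apply/(measurable_restrictT _ measurable_dom).
exact: (measurableT_comp (fine_measurable measurableT)).
Qed.

Lemma real_rep_ae x : bfs_mem E x -> ae_on alpha (fun s => (real_rep x s)%:E = x s).
Proof.
move=> Ex; apply: ae_onS (bfs_fin Ex) => s Ds fx.
by rewrite /real_rep asboolT// fineK.
Qed.

Lemma real_repE x s : D s -> real_rep x s = fine (x s).
Proof. by move=> Ds; rewrite /real_rep asboolT. Qed.

Lemma mem_real_rep x : bfs_mem E x -> Emem (real_rep x).
Proof.
move=> Ex; have mx := measurable_real_rep (bfs_L0 Ex); split=> //.
by have [] := bfs_ae_eq (L0_EFin mx) Ex (real_rep_ae Ex).
Qed.

Lemma nrm_real_rep x : bfs_mem E x -> nrm (real_rep x) = bfs_norm E x.
Proof.
move=> Ex; have mx := measurable_real_rep (bfs_L0 Ex).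
by have [] := bfs_ae_eq (L0_EFin mx) Ex (real_rep_ae Ex).
Qed.

End Layer.

(** * Limits of real sequences *)

Section RealSeq.
Local Open Scope classical_set_scope.
Local Open Scope ring_scope.
Context {R : realType}.
Implicit Types (u v : nat -> R) (l : R).

Lemma cvg_epsP u l : u @ \oo --> l <->
  forall e : R, 0 < e -> exists N, forall n, (N <= n)%N -> `|u n - l| <= e.
Proof.
split.
- move/cvgrPdist_le => H e e0; have [N _ HN] := H e e0.
  by exists N => n Nn; rewrite distrC; apply: HN.
- move=> H; apply/cvgrPdist_le => e e0; have [N HN] := H e e0.
  by exists N => // n /= Nn; rewrite distrC; apply: HN.
Qed.

Lemma cvg_sub1 u (phi : nat -> nat) l :
  {homo phi : m n / (m < n)%N} -> u @ \oo --> l ->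
  (fun n => u (phi n)) @ \oo --> l.
Proof.
move=> hphi /cvg_epsP H; apply/cvg_epsP => e /H[N HN].
exists N => n Nn; apply: HN; apply: leq_trans Nn _.
elim: n => // n IH; exact: leq_ltn_trans IH (hphi _ _ (ltnSn n)).
Qed.

Lemma cvg_big_sum (I : Type) (r : seq I) (u : I -> nat -> R) (l : I -> R) :
  (forall i, u i @ \oo --> l i) ->
  (fun n => \sum_(i <- r) u i n) @ \oo --> \sum_(i <- r) l i.
Proof.
move=> H; elim: r => [|i r IH].
  by under eq_fun do rewrite big_nil; rewrite big_nil; exact: cvg_cst.
under eq_fun do rewrite big_cons; rewrite big_cons.
by apply: cvgD.
Qed.

Lemma squeeze_seq u v w l : (forall n, u n <= v n) -> (forall n, v n <= w n) ->
  u @ \oo --> l -> w @ \oo --> l -> v @ \oo --> l.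
Proof.
move=> uv vw; apply: squeeze_cvgr; near=> n; by rewrite uv vw.
Unshelve. all: end_near. Qed.

Lemma squeeze0 u v : (forall n, 0 <= u n) -> (forall n, u n <= v n) ->
  v @ \oo --> (0 : R) -> u @ \oo --> (0 : R).
Proof. by move=> u0 uv; apply: (squeeze_seq u0 uv); exact: cvg_cst. Qed.

Lemma cvg_mull (a : R) u l : u @ \oo --> l -> (fun n => a * u n) @ \oo --> a * l.
Proof. by move=> H; apply: cvgM => //; exact: cvg_cst. Qed.

End RealSeq.

(** * Rotundity points in terms of real-valued representatives *)

Section Points.
Local Open Scope classical_set_scope.
Local Open Scope ring_scope.
Variables (R : realType) (alpha : \bar R).
Hypothesis halpha : alpha = 1%E \/ alpha = +oo%E.
Variables (E : BFS alpha) (k : nat).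
Notation D := (dom alpha).
Notation Emem := (@Emem R alpha E).
Notation nrm := (@nrm R alpha E).
Implicit Types (f : R -> R) (g : nat -> R -> R).

Definition sums_max f g := forall phi : 'I_k -> nat -> nat,
  (forall i, {homo phi i : m n / (m < n)%N}) ->
  (fun n => nrm (fun s => f s + \sum_(i < k) g (phi i n) s)) @ \oo -->
    (k.+1%:R : R).

Definition real_point f := [/\ Emem f, nrm f = 1 &
  forall g, (forall n, Emem (g n)) -> (forall n, nrm (g n) = 1) ->
    sums_max f g -> (fun n => nrm (fun s => g n s - f s)) @ \oo --> (0 : R)].

Lemma bfs_sum (x : R -> \bar R) (u : 'I_k -> R -> \bar R) :
  bfs_mem E x -> (forall i, bfs_mem E (u i)) ->
  bfs_mem E (fun s => x s + \sum_(i < k) u i s)%E.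
Proof.
move=> Ex Eu.
have E0 : bfs_mem E (fun=> 0%E) by have [_] := mem0 E.
have Er (r : seq 'I_k) : bfs_mem E (fun s => \sum_(i <- r) u i s)%E.
  elim: r => [|i r IH]; first by under eq_fun do rewrite big_nil.
  by under eq_fun do rewrite big_cons; exact: bfs_add.
exact: bfs_add.
Qed.

Lemma ae_on_all (P : nat -> R -> Prop) :
  (forall n, ae_on alpha (P n)) -> ae_on alpha (fun s => forall n, P n s).
Proof.
move=> H; rewrite /ae_on.
have : {ae (@lebesgue_measure R), forall s, forall n, D s -> P n s}.
  by apply: ae_foralln => n; exact: H.
apply: (@filterS _ _ (ae_filter_ringOfSetsType _)) => s Hs Ds n.
exact: Hs.
Qed.

Lemma nrm_ae_eq (f : R -> R) (y : R -> \bar R) : Emem f -> bfs_mem E y ->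
  ae_on alpha (fun s => (f s)%:E = y s) -> bfs_norm E y = nrm f.
Proof. by move=> [mf _] Ey fy; have [] := bfs_ae_eq (L0_EFin mf) Ey fy. Qed.

Lemma nrm_rep_sum (x : R -> \bar R) (u : nat -> R -> \bar R) (m : 'I_k -> nat) :
  bfs_mem E x -> (forall n, bfs_mem E (u n)) ->
  nrm (fun s => real_rep alpha x s + \sum_(i < k) real_rep alpha (u (m i)) s) =
  bfs_norm E (fun s => x s + \sum_(i < k) u (m i) s)%E.
Proof.
move=> Ex Eu.
have Mx := mem_real_rep halpha Ex.
have Mu n := mem_real_rep halpha (Eu n).
apply/esym/nrm_ae_eq.
- by apply: memD => //; exact: mem_sum.
- by apply: (bfs_sum (u := fun i => u (m i))).
(* Listing x and all u_n in one sequence gives a single null set off which every representative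
   agrees with its function. *)
pose z n := if n is n'.+1 then u n' else x.
have Ez n : bfs_mem E (z n) by case: n => [|n] //=.
apply: ae_onS (ae_on_all (fun n => real_rep_ae (Ez n))) => s Ds Hz.
rewrite /= EFinD (Hz 0); congr (_ + _)%E.
by rewrite -sumEFin; apply: eq_bigr => i _; have := Hz (m i).+1.
Qed.

Lemma LFkR_pointP (x : R -> \bar R) : bfs_mem E x ->
  LFkR_point k E x <-> real_point (real_rep alpha x).
Proof.
move=> Ex.
have Mx := mem_real_rep halpha Ex.
split=> [[[_ Nx] H]|[_ Nx H]].
- split=> [//||g Mg Ng Sg]; first by rewrite nrm_real_rep.
  have Eg n : bfs_mem E (EFin \o g n) by have [] := Mg n.
  have dE n : bfs_norm E (fun s => ((EFin \o g n) s - x s)%E) =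
      nrm (fun s => g n s - real_rep alpha x s).
    apply: nrm_ae_eq; first exact: memB.
    + have := bfs_add (Eg n) (bfs_scale (-1) Ex); congr bfs_mem.
      by apply/funext => s; rewrite EFinN mulN1e.
    + by apply: ae_onS (real_rep_ae Ex) => s Ds xs; rewrite /= EFinB xs.
  under eq_fun do rewrite -dE.
  apply: (H (fun n => EFin \o g n)) => [n|phi hphi].
    by split; [exact: Eg|exact: Ng].
  rewrite [X in X @ _ --> _](_ : _ = fun n => nrm (fun s =>
    real_rep alpha x s + \sum_(i < k) g (phi i n) s)); first exact: Sg.
  apply/funext => n.
  apply: nrm_ae_eq.
  + by apply: memD => //; apply: mem_sum.
  + by apply: (bfs_sum (u := fun i => EFin \o g (phi i n))).
  + apply: ae_onS (real_rep_ae Ex) => s Ds xs.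
    by rewrite /= EFinD xs -sumEFin.
- split; first by split=> //; rewrite -nrm_real_rep.
  move=> u Su Hu.
  have Eu n : bfs_mem E (u n) by have [] := Su n.
  have Mu n := mem_real_rep halpha (Eu n).
  have dE n : bfs_norm E (fun s => (u n s - x s)%E) =
      nrm (fun s => real_rep alpha (u n) s - real_rep alpha x s).
    apply: nrm_ae_eq; first exact: memB.
    + have := bfs_add (Eu n) (bfs_scale (-1) Ex); congr bfs_mem.
      by apply/funext => s; rewrite EFinN mulN1e.
    + pose z i := if i is i'.+1 then u i' else x.
      have Ez i : bfs_mem E (z i) by case: i => [|i] //=.
      apply: ae_onS (ae_on_all (fun n => real_rep_ae (Ez n))) => s Ds Hz.
      by rewrite /= EFinB (Hz 0) (Hz n.+1).
  under eq_fun do rewrite dE.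
  apply: H => // [n|phi hphi].
  + by rewrite nrm_real_rep//; have [] := Su n.
  + under eq_fun do rewrite (nrm_rep_sum (fun i => phi i _) Ex Eu).
    exact: Hu.
Qed.

End Points.

(** * Relaxed test sequences, midpoints and absolute values *)

Section Points2.
Local Open Scope classical_set_scope.
Local Open Scope ring_scope.
Variables (R : realType) (alpha : \bar R).
Variables (E : BFS alpha) (k : nat).
Notation D := (dom alpha).
Notation Emem := (@Emem R alpha E).
Notation nrm := (@nrm R alpha E).
Notation sums_max := (@sums_max R alpha E k).
Notation real_point := (@real_point R alpha E k).
Implicit Types (f : R -> R) (g u : nat -> R -> R).

(** Only a lower bound is required, since the triangle inequality supplies the upper bound k + 1. In
    this form the condition passes to anything with larger sums, such as absolute values or
    rearrangements. *)
Definition lower_sums f g := forall phi : 'I_k -> nat -> nat,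
  (forall i, {homo phi i : m n / (m < n)%N}) ->
  exists2 a : nat -> R, a @ \oo --> (k.+1%:R : R) &
    forall n, a n <= nrm (fun s => f s + \sum_(i < k) g (phi i n) s).

Lemma sum_max_mem f g (phi : 'I_k -> nat -> nat) n :
  Emem f -> (forall n, Emem (g n)) ->
  Emem (fun s => f s + \sum_(i < k) g (phi i n) s).
Proof. by move=> Mf Mg; apply: memD => //; apply: mem_sum. Qed.

Lemma sums_maxW f g : sums_max f g -> lower_sums f g.
Proof.
by move=> H phi hphi; eexists; first exact: H; move=> n /=.
Qed.

Lemma sum_const1 : (\sum_(i < k) (1 : R)) = k%:R.
Proof. by rewrite sumr_const card_ord. Qed.

Lemma lower_sums_max f g : Emem f -> nrm f = 1 -> (forall n, Emem (g n)) ->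
  (fun n => nrm (g n)) @ \oo --> (1 : R) -> lower_sums f g -> sums_max f g.
Proof.
move=> Mf Nf Mg Ng H phi hphi; have [a ak ale] := H phi hphi.
apply: (@squeeze_seq _ a _ (fun n => 1 + \sum_(i < k) nrm (g (phi i n)))) => //.
- move=> n; apply: le_trans (nrmD Mf _) _; first exact: mem_sum.
  by rewrite Nf lerD2l; apply: nrm_sum.
- rewrite -addn1 natrD addrC -sum_const1.
  apply: cvgD; first exact: cvg_cst.
  apply: (cvg_big_sum (u := fun i n => nrm (g (phi i n)))) => i.
  exact: (cvg_sub1 (u := fun n => nrm (g n))).
Qed.

(** Normalizing g_n moves it by | ||g_n|| - 1 |, which tends to 0, so sums of k terms keep their
    asymptotic lower bound and the condition on the unit sphere applies. *)
Lemma real_point_ext f g : real_point f -> (forall n, Emem (g n)) ->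
  (fun n => nrm (g n)) @ \oo --> (1 : R) -> lower_sums f g ->
  (fun n => nrm (fun s => g n s - f s)) @ \oo --> (0 : R).
Proof.
move=> [Mf Nf H] Mg Ng Sg.
(* The value f is a filler that keeps [v n] on the unit sphere; it occurs for finitely many n
   only. *)
pose v n := if nrm (g n) == 0 then f else fun s => (nrm (g n))^-1 * g n s.
have Mv n : Emem (v n) by rewrite /v; case: ifP => // _; exact: memZ.
have Nv n : nrm (v n) = 1.
  rewrite /v; case: ifPn => // g0; rewrite nrmZ// ger0_norm ?mulVf//.
  by rewrite invr_ge0; exact: nrm_ge0.
have vg0 : (fun n => nrm (fun s => g n s - v n s)) @ \oo --> (0 : R).
  apply/cvg_epsP => e e0; move/cvg_epsP: Ng.
  (* The bound 1/2 ensures that [nrm (g n)] is positive from there on. *)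
  have e20 : 0 < Num.min e (2^-1) by rewrite lt_min e0 invr_gt0 ltr0n.
  move=> /(_ _ e20)[N HN]; exists N => n /HN; rewrite le_min => /andP[ne n2].
  have g0 : 0 < nrm (g n) by move: n2; rewrite ler_norml => /andP[]; lra.
  rewrite subr0 ger0_norm; last by apply: nrm_ge0; exact: memB.
  have -> : (fun s => g n s - v n s) = (fun s => (1 - (nrm (g n))^-1) * g n s).
    by apply/funext => s; rewrite /v gt_eqF// mulrBl mul1r.
  rewrite nrmZ// -[X in _ * X]gtr0_norm// -normrM mulrBl mul1r mulVf ?gt_eqF//.
have : (fun n => nrm (fun s => v n s - f s)) @ \oo --> (0 : R).
  apply: H => //; apply: lower_sums_max => //.
    rewrite [X in X @ _ --> _](_ : _ = fun=> 1); first exact: cvg_cst.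
    by apply/funext.
  move=> phi hphi; have [a ak ale] := Sg phi hphi.
  exists (fun n => a n - \sum_(i < k) nrm (fun s => g (phi i n) s - v (phi i n) s)).
    rewrite -[X in _ --> X]subr0; apply: cvgB => //.
    rewrite [X in _ --> X](_ : _ = \sum_(i < k) (0 : R)); last by rewrite big1.
    apply: (cvg_big_sum
      (u := fun i n => nrm (fun s => g (phi i n) s - v (phi i n) s))) => i.
    exact: (cvg_sub1 (u := fun n => nrm (fun s => g n s - v n s))).
  move=> n; rewrite lerBlDr; apply: le_trans (ale n) _.
  have Mgv i : Emem (fun s => g (phi i n) s - v (phi i n) s) by exact: memB.
  apply: le_trans (nrm_lerD (sum_max_mem phi n Mf Mg) (sum_max_mem phi n Mf Mv)) _.
  rewrite lerD2l.
  apply: le_trans (nrm_sum (index_enum 'I_k) Mgv).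
  rewrite le_eqVlt; apply/orP; left; apply/eqP; congr nrm; apply/funext => s.
  by rewrite opprD addrACA subrr add0r sumrB.
move=> vf0.
apply: (@squeeze0 _ _ (fun n => nrm (fun s => g n s - v n s) +
                                nrm (fun s => v n s - f s))).
- by move=> n; apply: nrm_ge0; exact: memB.
- move=> n; have Mgv : Emem (fun s => g n s - v n s) by exact: memB.
  apply: le_trans (nrmD Mgv (memB (Mv n) Mf)).
  rewrite le_eqVlt; apply/orP; left; apply/eqP; congr nrm; apply/funext => s.
  by rewrite addrA subrK.
- by rewrite -[X in _ --> X]addr0; apply: cvgD.
Qed.

Definition half_sum f u n : R -> R := fun s => 2^-1 * (f s + u n s).

Lemma mem_half_sum f u n : Emem f -> (forall n, Emem (u n)) -> Emem (half_sum f u n).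
Proof. by move=> Mf Mu; apply: memZ; exact: memD. Qed.

Lemma half_sum_nrm f u : Emem f -> nrm f = 1 -> (forall n, Emem (u n)) ->
  (fun n => nrm (u n)) @ \oo --> (1 : R) -> lower_sums f u -> (0 < k)%N ->
  (fun n => nrm (half_sum f u n)) @ \oo --> (1 : R).
Proof.
move=> Mf Nf Mu Nu Su k0.
(* With all k subsequences equal to the whole sequence, ||f + k u_n|| <= ||f + u_n|| + (k - 1)
   ||u_n||, so the lower limit of ||f + u_n|| is at least (k + 1) - (k - 1) = 2. *)
have [a ak ale] := Su (fun=> id) (fun i m n mn => mn).
apply: (@squeeze_seq _ (fun n => 2^-1 * (a n - k.-1%:R * nrm (u n))) _
          (fun n => 2^-1 * (1 + nrm (u n)))).
- move=> n; rewrite nrmZ; last exact: memD.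
  rewrite ger0_norm ?invr_ge0 ?ler0n// ler_pM2l ?invr_gt0 ?ltr0n//.
  rewrite lerBlDr; apply: le_trans (ale n) _.
  rewrite -[X in _ + X * _]ger0_norm ?ler0n// -nrmZ//.
  apply: le_trans (nrmD (memD Mf (Mu n)) (memZ _ (Mu n))).
  rewrite le_eqVlt; apply/orP; left; apply/eqP; congr nrm; apply/funext => s.
  rewrite sumr_const card_ord -[u n s *+ k]mulr_natl -addrA; congr (_ + _).
  have -> : (k%:R : R) = 1 + k.-1%:R by rewrite nat1r prednK.
  by rewrite mulrDl mul1r.
- move=> n; rewrite nrmZ; last exact: memD.
  rewrite ger0_norm ?invr_ge0 ?ler0n// ler_pM2l ?invr_gt0 ?ltr0n//.
  by rewrite -Nf; exact: nrmD.
- rewrite [X in _ --> X](_ : _ = 2^-1 * (k.+1%:R - k.-1%:R * 1) :> R).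
    by apply: cvg_mull; apply: cvgB => //; exact: cvg_mull.
  have -> : (k.+1%:R : R) = 2 + k.-1%:R.
    by have := natrD R 2 k.-1; rewrite add2n prednK.
  by rewrite mulr1 addrK mulVf.
- rewrite [X in _ --> X](_ : _ = 2^-1 * (1 + 1) :> R).
    by apply: cvg_mull; apply: cvgD => //; exact: cvg_cst.
  by rewrite -[X in _ * X]/(2%:R) mulVf.
Qed.

(** Rests on the identity (k+2)(f + sum u_i) = 2(f + sum (f + u_i)/2) + (k+1) sum u_i. Taking norms,
    the sums of midpoints are asymptotically at least ((k+2)(k+1) - (k+1)k)/2 = k + 1. *)
Lemma half_sum_lower f u : Emem f -> nrm f = 1 -> (forall n, Emem (u n)) ->
  (fun n => nrm (u n)) @ \oo --> (1 : R) -> lower_sums f u ->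
  lower_sums f (half_sum f u).
Proof.
move=> Mf Nf Mu Nu Su phi hphi.
have [a ak ale] := Su phi hphi.
exists (fun n => 2^-1 * (k.+2%:R * a n - k.+1%:R * \sum_(i < k) nrm (u (phi i n)))).
  rewrite [X in _ --> X](_ : _ = 2^-1 * (k.+2%:R * k.+1%:R - k.+1%:R *
     \sum_(i < k) 1)).
    apply: cvg_mull; apply: cvgB; apply: cvg_mull => //.
    apply: (cvg_big_sum (u := fun i n => nrm (u (phi i n)))) => i.
    exact: (cvg_sub1 (u := fun n => nrm (u n))).
  by rewrite sum_const1 -(addn2 k) -(addn1 k) !natrD; field.
move=> n.
rewrite -(ler_pM2l (ltr0n R 2)) mulrA mulfV// mul1r lerBlDr.
have Mh n := mem_half_sum n Mf Mu.
have Msu := mem_sum (index_enum 'I_k) (fun i => Mu (phi i n)).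
have MU := sum_max_mem phi n Mf Mu.
have MH := sum_max_mem phi n Mf Mh.
apply: (@le_trans _ _ (nrm (fun s => k.+2%:R * (f s + \sum_(i < k) u (phi i n) s)))).
  by rewrite nrmZ// ger0_norm ?ler0n// ler_pM2l ?ltr0n.
apply: (@le_trans _ _ (nrm (fun s => 2 * (f s + \sum_(i < k) half_sum f u (phi i n) s))
   + nrm (fun s => k.+1%:R * \sum_(i < k) u (phi i n) s))).
  apply: le_trans (nrmD (memZ _ MH) (memZ _ Msu)).
  rewrite le_eqVlt; apply/orP; left; apply/eqP; congr nrm; apply/funext => s.
  rewrite /half_sum -mulr_sumr big_split/= sumr_const card_ord -[f s *+ k]mulr_natl.
  by rewrite -(addn2 k) -(addn1 k) !natrD; field.
by rewrite !nrmZ// !ger0_norm ?ler0n// lerD2l ler_pM2l ?ltr0n// nrm_sum.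
Qed.

(** Norms tending to 1 are allowed because the condition is also applied to midpoints. *)
Definition pos_point f := [/\ Emem f, nrm f = 1 &
  forall g, (forall n, Emem (g n)) -> (forall n s, 0 <= g n s) ->
    (fun n => nrm (g n)) @ \oo --> (1 : R) -> lower_sums f g ->
    (fun n => nrm (fun s => g n s - f s)) @ \oo --> (0 : R)].

Lemma real_point_pos f : real_point f -> pos_point f.
Proof.
move=> pf; have [Mf Nf _] := pf; split=> // g Mg _ Ng Sg.
exact: real_point_ext.
Qed.

Lemma lower_sums_norm f u : Emem f -> (forall n, Emem (u n)) -> lower_sums f u ->
  lower_sums (fun s => `|f s|) (fun n s => `|u n s|).
Proof.
move=> Mf Mu Su phi hphi; have [a ak ale] := Su phi hphi; exists a => // n.
apply: le_trans (ale n) _; apply: ler_nrm.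
- by apply: (@mem_measurable _ _ E); exact: (sum_max_mem phi n Mf Mu).
- apply: (sum_max_mem (f := fun s => `|f s|) phi n (g := fun n s => `|u n s|)).
    exact: mem_norm.
  by move=> m; exact: mem_norm.
- move=> s _ _; rewrite [leRHS]ger0_norm; last by rewrite addr_ge0// sumr_ge0.
  by apply: le_trans (ler_normD _ _) _; rewrite lerD2l ler_norm_sum.
Qed.

(** For equal signs the second term suffices. For opposite signs |a + b| = ||a| - |b||, so the first
    term is at least 2|a| - ||a| - |b||, and the total is at least |a| + |b|. *)
Lemma dist_le_abs (a b : R) :
  `|b - a| <= 2 * `| `|2^-1 * (a + b)| - `|a| | + 2 * `| `|b| - `|a| |.
Proof.
case: (ger0P a) => a0; case: (ger0P b) => b0;
  case: (ger0P (2^-1 * (a + b))) => ab0; do ![case: ger0P => ?]; lra.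
Qed.

(* Both |u_n| and |f + u_n|/2 converge to |f|, which controls the signs. *)
Lemma real_point_of_abs f : (0 < k)%N -> Emem f -> pos_point (fun s => `|f s|) ->
  real_point f.
Proof.
move=> k0 Mf [_ Naf H]; rewrite nrm_norm// in Naf; split=> // u Mu Nu Su.
have Nu1 : (fun n => nrm (u n)) @ \oo --> (1 : R).
  rewrite [X in X @ _ --> _](_ : _ = fun=> 1); first exact: cvg_cst.
  by apply/funext.
have Lu := sums_maxW Su.
have Mh n := mem_half_sum n Mf Mu.
have H1 : (fun n => nrm (fun s => `|u n s| - `|f s|)) @ \oo --> (0 : R).
  apply: H => //; first by move=> n; exact: mem_norm.
    by under eq_fun do rewrite nrm_norm//.
  exact: lower_sums_norm.
have H2 : (fun n => nrm (fun s => `|half_sum f u n s| - `|f s|)) @ \oo --> (0 : R).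
  apply: (H (fun n s => `|half_sum f u n s|)) => //; first by move=> n; exact: mem_norm.
    by under eq_fun do rewrite nrm_norm//; exact: half_sum_nrm.
  by apply: lower_sums_norm => //; exact: half_sum_lower.
apply: (@squeeze0 _ _ (fun n => 2 * nrm (fun s => `|half_sum f u n s| - `|f s|)
   + 2 * nrm (fun s => `|u n s| - `|f s|))).
- by move=> n; apply: nrm_ge0; exact: memB.
- move=> n.
  have M1 : Emem (fun s => `|u n s| - `|f s|) by apply: memB; exact: mem_norm.
  have M2 : Emem (fun s => `|half_sum f u n s| - `|f s|) by apply: memB; exact: mem_norm.
  have M1' := memZ 2 (mem_norm M1); have M2' := memZ 2 (mem_norm M2).
  rewrite -(nrm_norm M1) -(nrm_norm M2).
  rewrite -[X in X * _ + _]ger0_norm ?ler0n// -[X in _ + X * _]ger0_norm ?ler0n//.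
  rewrite -(nrmZ _ (mem_norm M1)) -(nrmZ _ (mem_norm M2)).
  apply: le_trans (nrmD M2' M1'); apply: ler_nrm.
  + by apply: (@mem_measurable _ _ E); exact: memB.
  + exact: memD.
  + move=> s _ _; rewrite [leRHS]ger0_norm ?addr_ge0 ?mulr_ge0//.
    exact: dist_le_abs.
- rewrite [X in _ --> X](_ : _ = 2 * 0 + 2 * 0 :> R); last by rewrite mulr0 addr0.
  by apply: cvgD; apply: cvg_mull.
Qed.

End Points2.

(** * Distribution functions and decreasing rearrangements *)

Section Rearrangement.
Local Open Scope classical_set_scope.
Local Open Scope ring_scope.
Variables (R : realType) (alpha : \bar R).
Hypothesis halpha : alpha = 1%E \/ alpha = +oo%E.
Notation mu := (@lebesgue_measure R).
Notation D := (dom alpha).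
Implicit Types x : R -> \bar R.

Definition super x (l : R) := [set s | D s /\ (l%:E < `|x s|)%E].

Lemma measurable_super x l : L0 alpha x -> measurable (super x l).
Proof.
move=> Lx; have mD := measurable_dom halpha.
apply: (emeasurable_fun_o_infty mD (f := fun s => `|x s|%E)).
exact: (measurableT_comp (@abse_measurable R setT)).
Qed.

Lemma mu_dom : mu D = alpha.
Proof.
case: halpha => ->.
- rewrite (_ : dom _ = `[0, 1[%classic).
    by rewrite lebesgue_measure_itv/= lte_fin ltr01 sube0.
  by apply/seteqP; split=> s /=; rewrite /dom /= in_itv/= lte_fin; [case=> -> ->|case/andP].
- rewrite (_ : dom _ = `[0, +oo[%classic); first by rewrite lebesgue_measure_itv/= ltry.
  by apply/seteqP; split=> s /=; rewrite /dom /= in_itv/= ltry andbT; [case|].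
Qed.

Lemma distrf_le_alpha x l : L0 alpha x -> (distrf alpha x l <= alpha)%E.
Proof.
move=> Lx; rewrite -{2}mu_dom; apply: le_measure; rewrite ?inE//.
- exact: measurable_super.
- exact: measurable_dom.
- by move=> s [].
Qed.

Lemma le_distrf x l l' : L0 alpha x -> l <= l' ->
  (distrf alpha x l' <= distrf alpha x l)%E.
Proof.
move=> Lx ll'; apply: le_measure; rewrite ?inE.
- exact: measurable_super.
- exact: measurable_super.
- by move=> s [Ds xl]; split=> //; apply: le_lt_trans xl; rewrite lee_fin.
Qed.

(** Right continuity of the distribution function, from continuity of the measure along the
    increasing sets {|x| > l + 1/(n+1)}. *)
Lemma distrf_right x l (t : \bar R) : L0 alpha x -> (t < distrf alpha x l)%E ->
  exists2 l', l < l' & (t < distrf alpha x l')%E.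
Proof.
move=> Lx tl; apply: contrapT => H.
have Hn n : (distrf alpha x (l + n.+1%:R^-1) <= t)%E.
  rewrite leNgt; apply/negP => tn; apply: H; exists (l + n.+1%:R^-1) => //.
  by rewrite ltrDl invr_gt0 ltr0n.
pose A n := super x (l + n.+1%:R^-1).
have mA n : measurable (A n) by exact: measurable_super.
have ndA : nondecreasing_seq A.
  move=> m n mn; apply/subsetPset => s [Ds xs]; split=> //.
  apply: le_lt_trans xs; rewrite lee_fin lerD2l lef_pV2 ?posrE ?ltr0n//.
  by rewrite ler_nat.
have UA : \bigcup_n A n = super x l.
  apply/seteqP; split=> s.
    case=> n _ [Ds xs]; split=> //; apply: lt_trans xs.
    by rewrite lte_fin ltrDl invr_gt0 ltr0n.
  move=> [Ds xs]; suff [n hn] : exists n, ((l + n.+1%:R^-1)%:E < `|x s|)%E by exists n.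
  move: xs; case: (`|x s|%E) => [r| |] // xs; last by exists 0%N; rewrite ltry.
  move: xs; rewrite lte_fin => xs.
  have d0 : 0 < r - l by rewrite subr_gt0.
  exists (Num.truncn (r - l)^-1); rewrite lte_fin -ltrBrDl.
  rewrite invf_plt ?posrE ?ltr0n//; exact: truncnS_gt.
have := nondecreasing_cvg_mu (mu := mu) mA (bigcupT_measurable _ mA) ndA.
rewrite UA => cA; move: tl; rewrite ltNge => /negP; apply.
by apply: (cvge_to_le cA); near=> n; exact: Hn.
Unshelve. all: end_near. Qed.

(** The Galois connection between x* and d_x, in strict form. It makes the level sets of x* initial
    intervals of length d_x(l), from which measurability and equimeasurability follow. *)
Lemma lt_rearr x (t l : R) : L0 alpha x -> 0 <= l ->
  (l%:E < rearr alpha x t)%E <-> (t%:E < distrf alpha x l)%E.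
Proof.
move=> Lx l0; split.
- move=> H; rewrite ltNge; apply/negP => dt; move: H; rewrite ltNge => /negP; apply.
  apply/lee_addgt0Pr => e e0; apply: ereal_inf_lbound; exists (l + e) => //.
  split; first by rewrite ltr_wpDl.
  by apply: le_trans dt; apply: le_distrf => //; rewrite lerDl ltW.
- move=> /(distrf_right Lx)[l' ll' tl']; apply: (@lt_le_trans _ _ l'%:E).
    by rewrite lte_fin.
  apply: le_ereal_inf_tmp => _ [m [m0 dm] <-]; rewrite lee_fin leNgt; apply/negP => ml'.
  move: tl'; rewrite ltNge => /negP; apply; apply: le_trans dm.
  by apply: le_distrf => //; exact: ltW.
Qed.

Lemma rearr_ge0 x t : (0 <= rearr alpha x t)%E.
Proof. by apply: le_ereal_inf_tmp => _ [m [m0 _] <-]; rewrite lee_fin ltW. Qed.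

Lemma measurable_initial (d : \bar R) : measurable (D `&` [set t : R | (t%:E < d)%E]).
Proof.
apply: measurableI; first exact: measurable_dom.
case: d => [r| |].
- rewrite (_ : [set _ | _] = `]-oo, r[%classic); first exact: measurable_itv.
  by apply/seteqP; split=> s /=; rewrite in_itv/= lte_fin.
- rewrite (_ : [set _ | _] = setT); first exact: measurableT.
  by apply/seteqP; split=> s //= _; rewrite ltry.
- rewrite (_ : [set _ | _] = set0); first exact: measurable0.
  by apply/seteqP; split=> s //=.
Qed.

Lemma mu_initial (d : \bar R) : (0 <= d)%E -> (d <= alpha)%E ->
  mu (D `&` [set t : R | (t%:E < d)%E]) = d.
Proof.
case: d => [r| |] //; last first.
  move=> _; rewrite leye_eq => /eqP ay.
  rewrite -[RHS]ay -[RHS]mu_dom; congr (mu _); apply/seteqP; split=> s.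
    by case.
  by move=> Ds; split=> //=; rewrite ltry.
rewrite lee_fin => r0 ra.
rewrite (_ : _ `&` _ = `[0, r[%classic).
  rewrite lebesgue_measure_itv/= lte_fin; case: ltP => // [_|r0']; first by rewrite sube0.
  by congr EFin; apply/le_anti; rewrite r0 r0'.
apply/seteqP; split=> s /=; rewrite in_itv/= /dom/=; first by case=> -[-> _]; rewrite lte_fin.
by case/andP=> s0 sr; split; rewrite ?lte_fin//; split=> //; apply: lt_le_trans ra; rewrite lte_fin.
Qed.

Lemma L0_rearr x : L0 alpha x -> L0 alpha (rearr alpha x).
Proof.
move=> Lx; rewrite /L0 /=.
apply: (measurability (@ErealGenOInfty.G R)).
  exact: ErealGenOInfty.measurableE.
move=> _ [_ [r ->] <-].
have [r0|r0] := leP 0 r.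
- rewrite (_ : _ `&` _ = D `&` [set t : R | (t%:E < distrf alpha x r)%E]).
    exact: measurable_initial.
  apply/seteqP; split=> t /= [Dt]; rewrite in_itv/= andbT => H; split=> //.
    exact/lt_rearr.
  exact/lt_rearr.
- rewrite (_ : _ `&` _ = D); first exact: measurable_dom.
  apply/seteqP; split=> t /=; first by case.
  move=> Dt; split=> //; rewrite in_itv/= andbT.
  by apply: lt_le_trans (rearr_ge0 x t); rewrite lte_fin.
Qed.

Lemma distrf_rearr x l : L0 alpha x -> 0 <= l ->
  distrf alpha (rearr alpha x) l = distrf alpha x l.
Proof.
move=> Lx l0; rewrite -[RHS](@mu_initial (distrf alpha x l)).
- congr (mu _); apply/seteqP; split=> t /= [Dt H]; split=> //.
    by apply/(lt_rearr _ Lx l0); rewrite -(gee0_abs (rearr_ge0 x t)).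
  by rewrite gee0_abs ?rearr_ge0//; apply/lt_rearr.
- exact: measure_ge0.
- exact: distrf_le_alpha.
Qed.

End Rearrangement.

(** * Rearrangement inside a symmetric space *)

Section Star.
Local Open Scope classical_set_scope.
Local Open Scope ring_scope.
Variables (R : realType) (alpha : \bar R).
Hypothesis halpha : alpha = 1%E \/ alpha = +oo%E.
Variable E : BFS alpha.
Hypothesis symE : symmetric_space E.
Notation mu := (@lebesgue_measure R).
Notation D := (dom alpha).
Notation Emem := (@Emem R alpha E).
Notation nrm := (@nrm R alpha E).
Implicit Types f g : R -> R.

Definition dist f (l : R) : \bar R := mu [set s | D s /\ l < `|f s|].

Lemma distE f l : distrf alpha (EFin \o f) l = dist f l.
Proof. by rewrite /distrf /dist; congr (mu _); apply/seteqP; split=> s /=; rewrite lte_fin. Qed.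

Lemma measurable_dist f l : measurable_fun [set: R] f ->
  measurable [set s | D s /\ l < `|f s|].
Proof.
move=> mf; have := measurable_super halpha l (L0_EFin mf).
by congr measurable; apply/seteqP; split=> s; rewrite /super /= lte_fin.
Qed.

Lemma equimeasurable f g : measurable_fun [set: R] g -> Emem f ->
  (forall l, 0 <= l -> dist g l = dist f l) -> Emem g /\ nrm g = nrm f.
Proof.
move=> mg [mf Ef] gf.
have [|Eg Ng] := symE (L0_EFin mg) Ef.
  by move=> l l0; rewrite !distE gf.
by [].
Qed.

Lemma mem_rearr (x : R -> \bar R) : bfs_mem E x ->
  bfs_mem E (rearr alpha x) /\ bfs_norm E (rearr alpha x) = bfs_norm E x.
Proof.
move=> Ex; have Lx := bfs_L0 Ex.
apply: symE => //; first exact: L0_rearr.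
by move=> l l0; rewrite distrf_rearr.
Qed.

Definition star f := real_rep alpha (rearr alpha (EFin \o f)).

Lemma mem_star f : Emem f -> Emem (star f).
Proof. by move=> [_ /mem_rearr[H _]]; exact: mem_real_rep. Qed.

Lemma nrm_star f : Emem f -> nrm (star f) = nrm f.
Proof.
move=> [_ /mem_rearr[H e]]; rewrite [RHS](esym e); exact: nrm_real_rep.
Qed.

Lemma star_ge0 f t : 0 <= star f t.
Proof. by rewrite /star /real_rep; case: ifP => // _; rewrite fine_ge0// rearr_ge0. Qed.

Lemma dom_lt s t : 0 <= s -> s <= t -> D t -> D s.
Proof. by move=> s0 st [_ ta]; split=> //; apply: le_lt_trans ta; rewrite lee_fin. Qed.

(** An infinite value at t would propagate to all of [0, t], contradicting finiteness almost
    everywhere of elements of E. *)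
Lemma rearr_fin f t : Emem f -> D t -> 0 < t ->
  rearr alpha (EFin \o f) t \is a fin_num.
Proof.
move=> [mf Ef] Dt t0; have [Er _] := mem_rearr Ef.
have Lf : L0 alpha (EFin \o f) := L0_EFin mf.
rewrite ge0_fin_numE ?rearr_ge0// ltey; apply/eqP => ry.
have := bfs_fin Er; rewrite /ae_on => -[B [mB B0 HB]].
have : (mu `[0%R, t]%classic <= mu B)%E.
  apply: le_measure; rewrite ?inE//.
  move=> s /=; rewrite in_itv/= => /andP[s0 st]; apply: HB => /=.
  move/(_ (dom_lt s0 st Dt)); suff -> : rearr alpha (EFin \o f) s = +oo%E by [].
  apply/eqyP => A A0; apply: ltW; apply/(lt_rearr halpha s Lf (ltW A0)).
  apply: (@le_lt_trans _ _ t%:E); first by rewrite lee_fin.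
  by apply/(lt_rearr halpha t Lf (ltW A0)); rewrite ry ltry.
by rewrite B0 lebesgue_measure_itv/= lte_fin t0 sube0 lee_fin leNgt t0.
Qed.

Lemma lt_star f t l : Emem f -> D t -> 0 < t -> 0 <= l ->
  l < star f t <-> (t%:E < dist f l)%E.
Proof.
move=> Mf Dt t0 l0; rewrite -distE.
rewrite -(lt_rearr halpha t (L0_EFin (mem_measurable Mf)) l0).
rewrite /star real_repE// -[in X in _ <-> X](fineK (rearr_fin Mf Dt t0)).
by rewrite lte_fin.
Qed.

Lemma eq_lower_sets (a b : R) : 0 <= a -> 0 <= b ->
  (forall l, 0 <= l -> l < a <-> l < b) -> a = b.
Proof.
move=> a0 b0 H; apply/le_anti/andP; split; rewrite leNgt; apply/negP => ab.
  by move: (ab); rewrite H// ltxx.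
by move: (ab); rewrite -H// ltxx.
Qed.

Lemma starZ f (c t : R) : Emem f -> 0 < c -> D t -> 0 < t ->
  star (fun s => c * f s) t = c * star f t.
Proof.
move=> Mf c0 Dt t0; apply: eq_lower_sets.
- exact: star_ge0.
- by rewrite mulr_ge0 ?star_ge0// ltW.
- move=> l l0; rewrite lt_star//; last exact: memZ.
  rewrite -ltr_pdivrMl// lt_star//; last by rewrite mulr_ge0// invr_ge0 ltW.
  suff -> : dist (fun s => c * f s) l = dist f (c^-1 * l) by [].
  rewrite /dist; congr (mu _); apply/seteqP; split=> s /=;
    by rewrite normrM (gtr0_norm c0) ltr_pdivrMl.
Qed.

Lemma dist_star f l : Emem f -> 0 <= l -> dist (star f) l = dist f l.
Proof.
move=> Mf l0; have Lf : L0 alpha (EFin \o f) := L0_EFin (mem_measurable Mf).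
rewrite -[RHS]distE -(distrf_rearr halpha Lf l0) /dist /distrf.
have Er := (mem_rearr Mf.2).1.
set A := [set s | _]; set B := [set s | _].
have mA : measurable A by apply: measurable_dist; exact: (mem_measurable (mem_star Mf)).
have mB : measurable B by apply: measurable_super => //; exact: L0_rearr.
(* At 0 the rearrangement may be infinite, and [fine] then gives 0; the two level sets are compared
   after adding the null set {0} to both. *)
have AB s : 0 < s -> D s -> A s <-> B s.
  move=> s0 Ds; rewrite /A /B /= (gee0_abs (rearr_ge0 _ _ _)) ger0_norm ?star_ge0//.
  by rewrite /star real_repE// -[in X in _ <-> X](fineK (rearr_fin Mf Ds s0)) lte_fin.
have m1 : measurable [set (0 : R)] by exact: measurable_set1.
have E0 (C : set R) : measurable C -> mu (C `|` [set (0 : R)]) = mu C.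
  by move=> mC; exact: (@measureU0 _ _ _ mu C [set (0 : R)] mC m1 (lebesgue_measure_set1 0)).
rewrite -(E0 A)// -(E0 B)//; congr (mu _).
apply/seteqP; split=> s [|->]; try by right.
- move=> As; have [s0|s0] := eqVneq s 0; first by right.
  left; apply/AB => //; last by case: As.
  by case: As => -[s0' _] _; rewrite lt_neqAle eq_sym s0.
- move=> As; have [s0|s0] := eqVneq s 0; first by right.
  left; apply/AB => //; last by case: As.
  by case: As => -[s0' _] _; rewrite lt_neqAle eq_sym s0.
Qed.

Lemma dist_min f (c l : R) : (forall s, 0 <= f s) -> 0 <= c ->
  dist (fun s => Num.min (f s) c) l = if l < c then dist f l else 0%E.
Proof.
move=> f0 c0; rewrite /dist; case: ltP => lc.
  congr (mu _); apply/seteqP; split=> s /= [Ds]; rewrite !ger0_norm ?le_min ?f0//.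
    by rewrite lt_min => /andP[].
  by rewrite lt_min lc andbT.
rewrite [X in mu X](_ : _ = set0) ?measure0//; apply/seteqP; split=> s //= [Ds].
by rewrite ger0_norm ?le_min ?f0// lt_min => /andP[_]; rewrite ltNge lc.
Qed.

Lemma dist_excess f (c l : R) : (forall s, 0 <= f s) -> 0 <= c -> 0 <= l ->
  dist (fun s => f s - Num.min (f s) c) l = dist f (l + c).
Proof.
move=> f0 c0 l0; rewrite /dist.
congr (mu _); apply/seteqP; split=> s /= [Ds].
  rewrite !ger0_norm ?subr_ge0 ?ge_min ?lexx//.
  by case: (leP (f s) c) => fc; rewrite ?subrr; [move=> ?; exfalso; lra|rewrite ltrBrDr].
rewrite !ger0_norm ?subr_ge0 ?ge_min ?lexx// => H; split=> //.
by case: (leP (f s) c) => fc; lra.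
Qed.

Lemma mem_min f (c : R) : (forall s, 0 <= f s) -> 0 <= c -> Emem f ->
  Emem (fun s => Num.min (f s) c).
Proof.
move=> f0 c0 Mf; apply: (mem_le _ Mf).
  apply: measurable_minr => //; exact: (mem_measurable Mf).
by move=> s _ _; rewrite !ger0_norm ?le_min ?f0// ge_min lexx.
Qed.

(** Truncation acts on the distribution function alone, hence commutes with rearrangement up to
    equimeasurability. This carries smallness of the low part from f* to f; the next lemma does so
    for the high part. *)
Lemma nrm_min_star f (c : R) : (forall s, 0 <= f s) -> 0 <= c -> Emem f ->
  nrm (fun s => Num.min (star f s) c) = nrm (fun s => Num.min (f s) c).
Proof.
move=> f0 c0 Mf.
have Ms := mem_min (star_ge0 f) c0 (mem_star Mf).
have [|_ ->//] := equimeasurable (mem_measurable Ms) (mem_min f0 c0 Mf).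
move=> l l0; rewrite !dist_min//; first by rewrite dist_star.
exact: star_ge0.
Qed.

Lemma nrm_excess_star f (c : R) : (forall s, 0 <= f s) -> 0 <= c -> Emem f ->
  nrm (fun s => star f s - Num.min (star f s) c) =
  nrm (fun s => f s - Num.min (f s) c).
Proof.
move=> f0 c0 Mf.
have Ms := memB (mem_star Mf) (mem_min (star_ge0 f) c0 (mem_star Mf)).
have [|_ ->//] := equimeasurable (mem_measurable Ms) (memB Mf (mem_min f0 c0 Mf)).
move=> l l0; rewrite !dist_excess//; first by rewrite dist_star// addr_ge0.
exact: star_ge0.
Qed.

End Star.

(** * Order continuity *)

Section OrderContinuity.
Local Open Scope classical_set_scope.
Local Open Scope ring_scope.
Variables (R : realType) (alpha : \bar R).
Hypothesis halpha : alpha = 1%E \/ alpha = +oo%E.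
Variable E : BFS alpha.
Hypothesis symE : symmetric_space E.
Hypothesis fatouE : Fatou_property E.
Variable k : nat.
Notation mu := (@lebesgue_measure R).
Notation D := (dom alpha).
Notation Emem := (@Emem R alpha E).
Notation nrm := (@nrm R alpha E).
Notation star := (@star R alpha).
Implicit Types f g : R -> R.

Definition increases_to (h : nat -> R -> R) f :=
  [/\ forall n, measurable_fun [set: R] (h n),
      forall n s, D s -> 0 < s -> 0 <= h n s <= f s,
      forall s m n, D s -> 0 < s -> (m <= n)%N -> h m s <= h n s &
      forall s, D s -> 0 < s -> (fun n => h n s) @ \oo --> f s].

(* The truncations h_n themselves form a maximizing sequence for f. *)
Lemma order_continuous_point f h : real_point E k f -> increases_to h f ->
  (fun n => nrm (fun s => f s - h n s)) @ \oo --> (0 : R).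
Proof.
move=> pf [mh h0f hmono hf]; have [Mf Nf _] := pf.
have h0 n s : D s -> 0 < s -> 0 <= h n s by move=> Ds s0; have /andP[] := h0f n s Ds s0.
have hle n s : D s -> 0 < s -> h n s <= f s by move=> Ds s0; have /andP[] := h0f n s Ds s0.
have f0 s : D s -> 0 < s -> 0 <= f s.
  by move=> Ds s0; apply: le_trans (hle 0%N s Ds s0); exact: h0.
have Mh n : Emem (h n).
  apply: (mem_le _ Mf) => // s Ds s0.
  by rewrite (ger0_norm (h0 n s Ds s0)) (ger0_norm (f0 s Ds s0)) hle.
have H1 n : positive_cone E (EFin \o h n).
  split; first by case: (Mh n).
  by apply: ae_on_pos => s Ds s0; rewrite /= lee_fin h0.
have H2 : exists M : R, forall n, bfs_norm E (EFin \o h n) <= M.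
  exists 1 => n; rewrite -Nf; apply: ler_nrm => // s Ds s0.
  by rewrite (ger0_norm (h0 n s Ds s0)) (ger0_norm (f0 s Ds s0)) hle.
have H4 : ae_on alpha (fun s => nondecreasing_seq (fun n => (EFin \o h n) s) /\
    (fun n => (EFin \o h n) s) @ \oo --> (EFin \o f) s).
  apply: ae_on_pos => s Ds s0; split.
    by move=> m n mn; rewrite /= lee_fin; exact: hmono.
  by apply: cvg_EFin; [near=> n|exact: hf].
have [_ _ Nh] := fatouE H1 H2 (L0_EFin (mem_measurable Mf)) H4.
have {}Nh : (fun n => nrm (h n)) @ \oo --> (1 : R) by rewrite -Nf.
under eq_fun do rewrite nrm_distC//.
apply: (real_point_ext pf) => // phi hphi.
(* Since phi_i(n) >= n and h increases to f, the sum f + sum h_{phi_i(n)} dominates (k + 1) h_n. *)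
exists (fun n => k.+1%:R * nrm (h n)).
  by rewrite -[X in _ --> X]mulr1; exact: cvg_mull.
move=> n; rewrite -[X in X * _]ger0_norm ?ler0n// -nrmZ//.
have phin i : (n <= phi i n)%N.
  elim: n => // n IH; exact: leq_ltn_trans IH (hphi i _ _ (ltnSn n)).
apply: ler_nrm.
- by apply: (@mem_measurable _ _ E); exact: memZ.
- exact: (sum_max_mem phi n Mf Mh).
- move=> s Ds s0; rewrite !ger0_norm; first last.
  + by rewrite mulr_ge0 ?h0.
  + by rewrite addr_ge0 ?f0// sumr_ge0// => i _; exact: h0.
  rewrite -addn1 natrD addrC mulrDl mul1r lerD ?hle//.
  rewrite mulr_natl -[k in _ *+ k]card_ord -sumr_const ler_sum// => i _.
  exact: hmono.
Unshelve. all: end_near. Qed.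

Hypothesis star_points : forall f, Emem f -> nrm f = 1 -> real_point E k (star f).

(** Homogeneity reduces to unit norm, where f* is a rotundity point. *)
Lemma order_continuous_star f h : Emem f -> increases_to h (star f) ->
  (fun n => nrm (fun s => star f s - h n s)) @ \oo --> (0 : R).
Proof.
move=> Mf [mh h0f hmono hf].
have Msf := mem_star halpha symE Mf.
have Mh n : Emem (h n).
  apply: (mem_le _ Msf) => // s Ds s0; have /andP[h0 hle] := h0f n s Ds s0.
  by rewrite (ger0_norm h0) (ger0_norm (star_ge0 _ _ _)).
have [Nf0|Nf0] := eqVneq (nrm f) 0.
  apply: (@squeeze0 _ _ (fun=> 0)); last exact: cvg_cst.
    by move=> n; apply: nrm_ge0; exact: memB.
  move=> n; rewrite -Nf0 -(nrm_star halpha symE Mf); apply: ler_nrm => //.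
    by apply: (@mem_measurable _ _ E); exact: memB.
  move=> s Ds s0; have /andP[h0 hle] := h0f n s Ds s0.
  by rewrite (ger0_norm (star_ge0 _ _ _)) ger0_norm ?subr_ge0// gerBl.
have c0 : 0 < nrm f by rewrite lt_neqAle eq_sym Nf0 nrm_ge0.
have ci0 : 0 < (nrm f)^-1 by rewrite invr_gt0.
pose f1 s := (nrm f)^-1 * f s.
have Mf1 : Emem f1 by exact: memZ.
have Nf1 : nrm f1 = 1 by rewrite nrmZ// gtr0_norm// mulVf.
have : (fun n => nrm (fun s => star f1 s - (nrm f)^-1 * h n s)) @ \oo --> (0 : R).
  apply: (order_continuous_point (h := fun n s => (nrm f)^-1 * h n s)).
    exact: star_points.
  split=> [n|n s Ds s0|s m n Ds s0 mn|s Ds s0].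
  - by apply: (@mem_measurable _ _ E); exact: memZ.
  - have /andP[h0 hle] := h0f n s Ds s0.
    by rewrite (starZ halpha symE)// ler_pM2l// hle mulr_ge0// ltW.
  - by rewrite ler_pM2l// hmono.
  - by rewrite (starZ halpha symE)//; apply: cvg_mull; exact: hf.
move=> /(cvg_mull (a := nrm f)); rewrite mulr0 => H.
rewrite (_ : (fun n => _) = fun n => nrm f *
  nrm (fun s => star f1 s - (nrm f)^-1 * h n s))//; apply/funext => n.
have M1 : Emem (fun s => star f1 s - (nrm f)^-1 * h n s).
  by apply: memB; [exact: mem_star|exact: memZ].
rewrite -[X in X * _](gtr0_norm c0) -nrmZ//; apply: eq_nrm;
  [exact: memB|exact: memZ|].
by move=> s Ds s0; rewrite (starZ halpha symE)// -mulrBr mulrA divff// mul1r.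
Qed.

(** Order continuity is available for rearrangements, so the argument runs on f*, where f* - min(f*,
    1/(n+1)) increases to f*, and returns to f by equimeasurability. On [0, oo) this controls the
    long flat tail of f; [small_excess] treats the peaks in the same way. *)
Lemma small_min f : (forall s, 0 <= f s) -> Emem f -> forall e, 0 < e ->
  exists2 c0 : R, 0 < c0 & forall c, 0 <= c <= c0 ->
    nrm (fun s => Num.min (f s) c) <= e.
Proof.
move=> f0 Mf e e0.
have Msf := mem_star halpha symE Mf.
have sf0 := star_ge0 alpha f.
pose c n : R := n.+1%:R^-1.
have cge0 n : 0 <= c n by rewrite invr_ge0 ler0n.
have : increases_to (fun n s => star f s - Num.min (star f s) (c n)) (star f).
  split=> [n|n s _ _|s m n _ _ mn|s _ _].
  - by apply: (@mem_measurable _ _ E); apply: memB => //; exact: mem_min.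
  - by rewrite subr_ge0 ge_min lexx/= gerBl le_min sf0 cge0.
  - rewrite lerD2l lerN2 le_min2// lef_pV2 ?posrE ?ltr0n//.
    by rewrite ler_nat.
  - rewrite -[X in _ --> X]subr0; apply: cvgB; first exact: cvg_cst.
    apply: (@squeeze0 _ _ c) => [n|n|].
    + by rewrite le_min sf0 cge0.
    + by rewrite ge_min lexx orbT.
    + exact: cvg_harmonic.
move=> /(order_continuous_star Mf) /cvg_epsP /(_ e e0)[N HN].
exists (c N); first by rewrite invr_gt0 ltr0n.
move=> d /andP[d0 dc]; have Mc := mem_min sf0 (cge0 N) Msf.
apply: (@le_trans _ _ (nrm (fun s => Num.min (f s) (c N)))).
  apply: ler_nrm.
  + by apply: (@mem_measurable _ _ E); exact: mem_min.
  + exact: mem_min.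
  + move=> s _ _; rewrite !ger0_norm; first exact: le_min2.
    + by rewrite le_min f0 cge0.
    + by rewrite le_min f0 d0.
rewrite -(nrm_min_star halpha symE)//.
have := HN N (leqnn N); rewrite subr0; apply: le_trans.
apply: le_trans (ler_norm _); rewrite le_eqVlt; apply/orP; left; apply/eqP.
by congr nrm; apply/funext => s; rewrite opprB addrC subrK.
Qed.

Lemma small_excess f : (forall s, 0 <= f s) -> Emem f -> forall e, 0 < e ->
  exists2 C0 : R, 0 < C0 & forall C, C0 <= C ->
    nrm (fun s => f s - Num.min (f s) C) <= e.
Proof.
move=> f0 Mf e e0.
have Msf := mem_star halpha symE Mf.
have sf0 := star_ge0 alpha f.
pose c n : R := n%:R.
have cge0 n : 0 <= c n by rewrite ler0n.
have : increases_to (fun n s => Num.min (star f s) (c n)) (star f).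
  split=> [n|n s _ _|s m n _ _ mn|s _ _].
  - by apply: (@mem_measurable _ _ E); exact: mem_min.
  - by rewrite le_min sf0 cge0 ge_min lexx.
  - by rewrite le_min2// ler_nat.
  - apply/cvg_epsP => d d0; exists (Num.truncn (star f s)).+1 => n Hn.
    rewrite min_l ?subrr ?normr0; first exact: ltW.
    by apply: ltW; apply: lt_le_trans (truncnS_gt _) _; rewrite ler_nat.
move=> /(order_continuous_star Mf) /cvg_epsP /(_ e e0)[N HN].
exists N.+1%:R; first by rewrite ltr0n.
move=> C NC; have Mc := mem_min sf0 (cge0 N) Msf.
have C0 : 0 <= C by apply: le_trans NC; rewrite ler0n.
apply: (@le_trans _ _ (nrm (fun s => f s - Num.min (f s) (c N.+1)))).
  apply: ler_nrm.
  + by apply: (@mem_measurable _ _ E); apply: memB => //; exact: mem_min.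
  + by apply: memB => //; exact: mem_min.
  + move=> s _ _; rewrite !ger0_norm ?subr_ge0 ?ge_min ?lexx//.
    by rewrite lerD2l lerN2 le_min2.
rewrite -(nrm_excess_star halpha symE)//.
by have := HN N.+1 (leqnSn N); rewrite subr0; apply: le_trans; exact: ler_norm.
Qed.

End OrderContinuity.

(** * Indicators and the fundamental function of E near 0 *)

Section Indicators.
Local Open Scope classical_set_scope.
Local Open Scope ring_scope.
Variables (R : realType) (alpha : \bar R).
Hypothesis halpha : alpha = 1%E \/ alpha = +oo%E.
Variable E : BFS alpha.
Hypothesis symE : symmetric_space E.
Hypothesis fatouE : Fatou_property E.
Variable k : nat.
Notation mu := (@lebesgue_measure R).
Notation D := (dom alpha).
Notation Emem := (@Emem R alpha E).
Notation nrm := (@nrm R alpha E).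
Notation star := (@star R alpha).
Implicit Types f g : R -> R.
Hypothesis star_points : forall f, Emem f -> nrm f = 1 -> real_point E k (star f).
Hypothesis nontrivial : exists2 f, Emem f & nrm f = 1.

Local Notation ind A := (\1_A : R -> R).

Lemma dist_indic (A : set R) l : A `<=` D -> 0 <= l ->
  dist alpha (ind A) l = if l < 1 then mu A else 0%E.
Proof.
move=> AD l0; rewrite /dist; case: ltP => l1.
  congr (mu _); apply/seteqP; split=> s /=.
    move=> [Ds]; rewrite indicE; case: (boolP (s \in A)) => [/set_mem//|_].
    by rewrite normr0 ltNge l0.
  by move=> As; split; [exact: AD|rewrite indicE mem_set// normr1].
rewrite [X in mu X](_ : _ = set0) ?measure0//; apply/seteqP; split=> s //= [Ds].
rewrite indicE; case: (s \in A); rewrite ?normr1 ?normr0 ltNge ?l1//.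
by rewrite l0.
Qed.

Lemma equi_indic (A B : set R) : measurable A -> measurable B -> A `<=` D ->
  B `<=` D -> mu A = mu B -> Emem (ind B) -> Emem (ind A) /\ nrm (ind A) = nrm (ind B).
Proof.
move=> mA mB AD BD AB MB.
apply: (equimeasurable symE) => //.
by move=> l l0; rewrite !dist_indic// AB.
Qed.

(** Otherwise right continuity at 0 makes the whole distribution function vanish, and f would be
    equimeasurable with 0. *)
Lemma exists_level f : Emem f -> nrm f != 0 -> exists2 l, 0 < l & (0 < dist alpha f l)%E.
Proof.
move=> Mf; apply: contraNP => H.
have H0 l : 0 < l -> dist alpha f l = 0%E.
  move=> l0; apply/eqP; rewrite eq_le measure_ge0 andbT leNgt; apply/negP => dl.
  by apply: H; exists l.
have D0 : dist alpha f 0 = 0%E.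
  apply/eqP; rewrite eq_le measure_ge0 andbT leNgt; apply/negP.
  rewrite -distE; have Lf : L0 alpha (EFin \o f) := L0_EFin (mem_measurable Mf).
  move=> /(distrf_right halpha Lf)[l l0]; rewrite distE H0//.
  by rewrite ltxx.
have m0 := mem_measurable (mem0 E).
have [|_ <-] := equimeasurable symE m0 Mf.
  move=> l l0; have -> : dist alpha f l = 0%E.
    by move: l0; rewrite le_eqVlt => /orP[/eqP<-|/H0].
  rewrite /dist [X in mu X](_ : _ = set0) ?measure0//.
  by apply/seteqP; split=> s //= -[_]; rewrite normr0 ltNge l0.
exact/eqP/nrm0.
Qed.

Lemma initial_subE (r : R) : (r%:E <= alpha)%E -> `[0, r[%classic `<=` D.
Proof.
move=> ra s /=; rewrite in_itv/= => /andP[s0 sr]; split=> //.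
by apply: lt_le_trans ra; rewrite lte_fin.
Qed.

Lemma mu_initial_itv (r : R) : 0 <= r -> mu `[0, r[%classic = r%:E.
Proof.
move=> r0; rewrite lebesgue_measure_itv/= lte_fin; case: ltP => r0'.
  by rewrite sube0.
by congr EFin; apply/le_anti; rewrite r0 r0'.
Qed.

(** The fundamental function tends to 0 at 0: a nonzero f* stays above some l > 0 near 0, and order
    continuity makes the norm of f* restricted to a short initial interval as small as desired. *)
Lemma small_initial e : 0 < e -> exists2 d : R, 0 < d &
  [/\ (d%:E <= alpha)%E, Emem (ind `[0, d[%classic) & nrm (ind `[0, d[%classic) <= e].
Proof.
move=> e0; have [f Mf Nf] := nontrivial.
have [|l l0 dl] := exists_level Mf; first by rewrite Nf oner_eq0.
have Msf := mem_star halpha symE Mf.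
have [t1 t10 t1l] : exists2 t1 : R, 0 < t1 & (t1%:E < dist alpha f l)%E.
  move: dl; case: (dist alpha f l) => [r| |] //; last by exists 1; rewrite ?ltry.
  by rewrite lte_fin => r0; exists (r / 2); rewrite ?divr_gt0 ?lte_fin//; lra.
have t1a : (t1%:E < alpha)%E.
  apply: lt_le_trans t1l _; rewrite -distE; apply: distrf_le_alpha => //.
  exact: (L0_EFin (mem_measurable Mf)).
have Dt1 : D t1 by split=> //; exact: ltW.
have fl s : 0 < s -> s <= t1 -> l < star f s.
  move=> s0 st; apply/(lt_star halpha symE Mf (dom_lt (ltW s0) st Dt1) s0 (ltW l0)).
  by apply: le_lt_trans t1l; rewrite lee_fin.
pose c n : R := n.+1%:R^-1.
pose h n s := star f s * \1_(`]c n, +oo[%classic : set R) s.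
have : increases_to alpha h (star f).
  have h01 n s : h n s = if c n < s then star f s else 0.
    rewrite /h indicE; case: ltP => cs.
      by rewrite mem_set ?mulr1//= in_itv/= cs.
    by rewrite memNset ?mulr0//= in_itv/= andbT => sc; move: cs; rewrite leNgt sc.
  split=> [n|n s _ _|s m n _ _ mn|s _ s0].
  - apply: measurable_funM; first exact: mem_measurable Msf.
    by apply: measurable_indic; exact: measurable_itv.
  - by rewrite h01; case: ifP; rewrite ?star_ge0 ?lexx.
  - rewrite !h01; case: ltP => ms; last by case: ifP; rewrite ?star_ge0.
    suff -> : c n < s by [].
    by apply: le_lt_trans ms; rewrite /c lef_pV2 ?posrE ?ltr0n// ler_nat.
  - apply/cvg_epsP => d d0; exists (Num.truncn s^-1) => n Hn.
    rewrite h01 (_ : c n < s) ?subrr ?normr0; first exact: ltW.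
    rewrite /c invf_plt ?posrE ?ltr0n//.
    by apply: lt_le_trans (truncnS_gt _) _; rewrite ler_nat.
move=> /(order_continuous_star halpha symE fatouE star_points Mf) /cvg_epsP.
move=> /(_ (l * e) (mulr_gt0 l0 e0)) [N /(_ N (leqnn N))].
have Mh : Emem (h N).
  apply: (mem_le _ Msf).
    apply: measurable_funM; first exact: mem_measurable Msf.
    by apply: measurable_indic; exact: measurable_itv.
  move=> s _ _; rewrite normrM ler_piMr// indicE ger0_norm//.
  by case: (s \in _).
have Msh := memB Msf Mh.
rewrite subr0 ger0_norm ?nrm_ge0// => Nle.
(* On (0, d) the function [h N] vanishes and f* exceeds l, so the indicator is at most (f* -
   h_N)/l. *)
pose d := Num.min t1 (c N).
have c0 : 0 < c N by rewrite invr_gt0 ltr0n.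
have d0 : 0 < d by rewrite lt_min t10.
have mi : measurable_fun setT (ind `[0, d[%classic) by apply: measurable_indic; exact: measurable_itv.
have [M1 N1] : Emem (ind `[0, d[%classic) /\
    nrm (ind `[0, d[%classic) <= nrm (fun s => l^-1 * (star f s - h N s)).
  apply: nrm_le => //; first exact: memZ.
  move=> s Ds s0; rewrite indicE; case: (boolP (s \in _)); rewrite ?normr0//.
  rewrite inE/= in_itv/= => /andP[_]; rewrite lt_min => /andP[st sc].
  rewrite normr1 /h indicE memNset/= ?in_itv/= ?mulr0 ?subr0; last first.
    by rewrite andbT => /lt_trans /(_ sc); rewrite ltxx.
  rewrite ger0_norm ?mulr_ge0 ?invr_ge0 ?star_ge0// ?(ltW l0)//.
  by rewrite ler_pdivlMl// mulr1 ltW// fl// ltW.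
exists d => //; split=> //.
  by apply: le_trans (ltW t1a); rewrite lee_fin ge_min lexx.
apply: le_trans N1 _; rewrite nrmZ// ger0_norm ?invr_ge0 ?(ltW l0)//.
by rewrite ler_pdivrMl.
Qed.

(** By symmetry the norm of an indicator depends only on the measure of the set; this is what makes
    approximation in measure an approximation in norm. *)
Lemma small_indic e : 0 < e -> exists2 d : R, 0 < d &
  forall A, measurable A -> A `<=` D -> (mu A <= d%:E)%E ->
    Emem (ind A) /\ nrm (ind A) <= e.
Proof.
move=> e0; have [d d0 [da Md Nd]] := small_initial e0.
exists d => // A mA AD Ad.
have Afin : mu A \is a fin_num.
  by rewrite ge0_fin_numE ?measure_ge0//; apply: le_lt_trans Ad _; rewrite ltry.
have A0 : 0 <= fine (mu A) by rewrite fine_ge0 ?measure_ge0.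
have rd : fine (mu A) <= d by rewrite -lee_fin fineK.
have [M1 N1] : Emem (ind `[0, fine (mu A)[%classic) /\
    nrm (ind `[0, fine (mu A)[%classic) <= nrm (ind `[0, d[%classic).
  apply: nrm_le => //.
  move=> s Ds s0; rewrite !indicE; case: (boolP (s \in _)); rewrite ?normr0//.
  rewrite inE/= in_itv/= => /andP[s0' sA].
  by rewrite mem_set ?normr1//= in_itv/= s0' (lt_le_trans sA).
have sD : `[0, fine (mu A)[%classic `<=` D.
  by apply: initial_subE; rewrite (le_trans _ da)// lee_fin.
have eA : mu A = mu `[0, fine (mu A)[%classic by rewrite mu_initial_itv// fineK.
have [M2 N2] := equi_indic mA (measurable_itv _) AD sD eA M1.
by split=> //; rewrite N2; exact: le_trans N1 Nd.
Qed.

Lemma mem_indic_itv (r : R) : (r%:E <= alpha)%E -> Emem (ind `[0, r[%classic).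
Proof.
move=> ra; have [d d0 Hd] := small_indic ltr01.
(* Finitely many pieces of length at most d cover [0, r), and each has its indicator in E. *)
pose B j : set R := `[j%:R * d, j.+1%:R * d[%classic `&` `[0, r[%classic.
have mB j : measurable (B j) by apply: measurableI; exact: measurable_itv.
have MB j : Emem (ind (B j)).
  apply: (Hd _ (mB j) _ _).1.
    by move=> s [_ ]; exact: initial_subE.
  apply: (@le_trans _ _ (mu `[j%:R * d, j.+1%:R * d[%classic)).
    apply: le_measure; rewrite ?inE; [exact: mB|exact: measurable_itv|].
    by move=> s [].
  rewrite lebesgue_measure_itv/= lte_fin; case: ifP => _; rewrite lee_fin; last exact: ltW.
  by rewrite -mulrBl -natrB// subSnn mul1r.
pose N := (Num.truncn (r / d)).+1.
apply: (mem_le _ (mem_sum (index_enum 'I_N) (fun j => MB j))).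
  by apply: measurable_indic; exact: measurable_itv.
move=> s Ds s0; rewrite indicE; case: (boolP (s \in _)); rewrite ?normr0//.
rewrite inE/= => sr; rewrite normr1.
have sr' : s < r by move: sr; rewrite in_itv/= => /andP[].
have jN : (Num.truncn (s / d) < N)%N.
  by rewrite ltnS; apply: le_truncn; rewrite ler_pM2r ?invr_gt0// ltW.
rewrite (bigD1 (Ordinal jN))//= [X in X + _]indicE mem_set; last first.
  split=> //=; rewrite in_itv/= -ler_pdivlMr// -ltr_pdivrMr//.
  rewrite truncnS_gt andbT truncn_le.
  by rewrite divr_ge0// ltW.
rewrite ger0_norm ?lerDl; last by rewrite addr_ge0// sumr_ge0// => i _; rewrite indicE.
by rewrite sumr_ge0// => i _; rewrite indicE.
Qed.

Lemma mem_indic A : measurable A -> A `<=` D -> (mu A < +oo)%E ->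
  Emem (ind A) /\ nrm (ind A) = nrm (ind `[0, fine (mu A)[%classic).
Proof.
move=> mA AD Ay; have Afin : mu A \is a fin_num by rewrite ge0_fin_numE ?measure_ge0.
have Aa : (mu A <= alpha)%E.
  rewrite -(mu_dom halpha); apply: le_measure; rewrite ?inE//; exact: (measurable_dom halpha).
apply: equi_indic => //.
- by apply: initial_subE; rewrite fineK.
- by rewrite mu_initial_itv ?fineK// fine_ge0 ?measure_ge0.
- by apply: mem_indic_itv; rewrite fineK.
Qed.

Lemma indic_nrm_gt0 A : measurable A -> A `<=` D -> (0 < mu A < +oo)%E ->
  0 < nrm (ind A).
Proof.
move=> mA AD /andP[A0 Ay]; have [MA _] := mem_indic mA AD Ay.
rewrite lt_neqAle nrm_ge0// andbT eq_sym; apply/eqP => N0.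
have := bfs_norm_eq0 MA.2 N0; rewrite /ae_on => -[B [mB B0 HB]].
have : (mu A <= mu B)%E.
  apply: le_measure; rewrite ?inE// => s As; apply: HB => /= /(_ (AD _ As)).
  by rewrite indicE mem_set// => /eqP; rewrite eqe oner_eq0.
by rewrite B0 leNgt A0.
Qed.

End Indicators.

(** * Dyadic approximation of measurable sets *)

Section Dyadic.
Local Open Scope classical_set_scope.
Local Open Scope ring_scope.
Variable (R : realType).
Notation mu := (@lebesgue_measure R).

Definition cell (m j : nat) : set R := `[j%:R / 2 ^+ m, j.+1%:R / 2 ^+ m[%classic.

Definition cells m n (S : {set 'I_n}) : set R :=
  [set s | exists2 j : 'I_n, j \in S & cell m j s].

Lemma pow2_gt0 m : 0 < (2 : R) ^+ m. Proof. by rewrite exprn_gt0. Qed.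

Lemma mem_cell m j (s : R) : 0 <= s -> cell m j s <-> Num.truncn (s * 2 ^+ m) = j.
Proof.
move=> s0; rewrite /cell /= in_itv/= ler_pdivrMr ?pow2_gt0// ltr_pdivlMr ?pow2_gt0//.
have s20 : 0 <= s * 2 ^+ m by rewrite mulr_ge0// ltW// pow2_gt0.
split=> [|<-]; first by move=> /truncn_def.
exact: truncn_itv.
Qed.

Lemma cell_ge0 m j (s : R) : cell m j s -> 0 <= s.
Proof.
rewrite /cell /= in_itv/= => /andP[+ _]; apply: le_trans.
by rewrite divr_ge0// ltW// pow2_gt0.
Qed.

Lemma measurable_cell m j : measurable (cell m j).
Proof. exact: measurable_itv. Qed.

Lemma measurable_cells m n (S : {set 'I_n}) : measurable (cells m S).
Proof.
have -> : cells m S = \bigcup_(j in [set j : nat | exists2 i : 'I_n, i \in S & j = i]) cell m j.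
  apply/seteqP; split=> s.
    by case=> j jS cs; exists j => //; exists j.
  by case=> _ [i iS ->] cs; exists i.
by apply: bigcup_measurable => j _; exact: measurable_cell.
Qed.

Lemma mu_cell m j : mu (cell m j) = (2 ^- m)%:E.
Proof.
rewrite lebesgue_measure_itv/= lte_fin ltr_pM2r ?invr_gt0 ?pow2_gt0// ltr_nat ltnSn.
by rewrite -EFinB -mulrBl -natrB// subSnn mul1r.
Qed.

Lemma mu_cells m n (S : {set 'I_n}) : mu (cells m S) = (#|S|%:R / 2 ^+ m)%:E.
Proof.
have -> : cells m S = \big[setU/set0]_(j in S) cell m j.
  rewrite -bigcup_seq_cond.
  apply/seteqP; split=> s.
    by case=> j jS cs; exists j => //=; rewrite mem_index_enum.
  by case=> j /= /andP[_ jS] cs; exists j.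
transitivity (\sum_(j in S) mu (cell m j))%E.
  apply: measure_bigsetU_ord_cond; first by move=> j _; exact: measurable_cell.
  move=> i j iS jS [s [ci cj]]; apply: ord_inj.
  have s0 := cell_ge0 ci.
  by move: ci cj => /(mem_cell _ _ s0) <- /(mem_cell _ _ s0).
rewrite (eq_bigr (fun=> (2 ^- m : R)%:E)); last by move=> i _; exact: mu_cell.
by rewrite sumEFin sumr_const -[_ *+ #|S|]mulr_natl.
Qed.

Lemma compact_thickening (K U : set R) : compact K -> open U -> K `<=` U ->
  exists m0, forall m, (m0 <= m)%N -> forall x y : R, K x -> `|x - y| <= 2 ^- m -> U y.
Proof.
move=> cK oU KU; move/compact_near_coveringP : cK => cK.
have [m0 _ H] : \forall m \near \oo, K `<=` (fun x => forall y : R, `|x - y| <= 2 ^- m -> U y).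
  apply: (cK nat \oo (fun m x => forall y : R, `|x - y| <= 2 ^- m -> U y)) => x Kx.
  have /nbhs_ballP[r /= r0 rU] : nbhs x U by exact: open_nbhs_nbhs (conj oU (KU _ Kx)).
  have r20 : 0 < r / 2 by rewrite divr_gt0.
  have [N _ HN] := near_infty_natSinv_expn_lt (PosNum r20).
  exists (ball x (r / 2), [set m | (N <= m)%N]).
    by split; [exact: nbhsx_ballx|exists N].
  move=> [x' m] /= [xx' Nm] y x'y; apply: rU; rewrite /ball/=.
  rewrite (splitr r); apply: le_lt_trans (ler_distD x' _ _) _; apply: ltrD => //.
  apply: le_lt_trans x'y _; have := HN m Nm; rewrite /= div1r.
  exact.
by exists m0 => m mm x y Kx; exact: H.
Qed.

(** Holding for all m >= m0, it lets finitely many sets be approximated on one common grid. *)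
Lemma approx_by_cells (A : set R) (T : nat) (e : R) : measurable A ->
  A `<=` `[0, T%:R[%classic -> 0 < e ->
  exists m0, forall m, (m0 <= m)%N -> exists S : {set 'I_(T * 2 ^ m)},
    (mu (A `\` cells m S) <= e%:E)%E /\ (mu (cells m S `\` A) <= e%:E)%E.
Proof.
move=> mA AT e0.
have Ay : (mu A < +oo)%E.
  apply: (@le_lt_trans _ _ (mu `[0, T%:R[%classic)).
    by apply: le_measure; rewrite ?inE//; exact: measurable_itv.
  by rewrite lebesgue_measure_itv/=; case: ifP; rewrite ?ltry// ltey.
have [K [cK KA AK]] := lebesgue_regularity_inner mA Ay e0.
have [U [oU AU UA]] := lebesgue_regularity_outer mA Ay e0.
have [m0 Hm] := compact_thickening cK oU (subset_trans KA AU).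
have mK := compact_measurable cK; have mU := open_measurable oU.
exists m0 => m mm.
(* The cells meeting the compact K inside A cover K, and being of length 2^-m they stay inside the
   open U around A. *)
pose S := [set j : 'I_(T * 2 ^ m) | `[< exists2 x, K x & cell m j x >]]%SET.
exists S; have mS := measurable_cells m S.
split.
- apply: le_trans (ltW AK); apply: le_measure; rewrite ?inE; [exact: measurableD|exact: measurableD|].
  move=> s [As nS]; split=> // Ks; apply: nS.
  have := AT _ As; rewrite /= in_itv/= => /andP[s0 sT].
  have jT : (Num.truncn (s * 2 ^+ m) < T * 2 ^ m)%N.
    rewrite truncn_lt_nat; last by rewrite mulr_ge0// ltW// pow2_gt0.
    by rewrite natrM natrX ltr_pM2r ?pow2_gt0.
  have cs : cell m (Ordinal jT) s by apply/mem_cell.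
  by exists (Ordinal jT) => //; rewrite inE; apply/asboolP; exists s.
- apply: le_trans (ltW UA); apply: le_measure; rewrite ?inE; [exact: measurableD|exact: measurableD|].
  move=> s [[j jS cs] nA]; split=> //; move: jS; rewrite inE => /asboolP[x Kx cx].
  apply: (Hm m mm x s Kx); move: cs cx.
  rewrite /cell /= !in_itv/= => /andP[s1 s2] /andP[x1 x2].
  move: s2 x2; rewrite -natr1 mulrDl mul1r => s2 x2.
  by rewrite ler_distl; apply/andP; split; lra.
Qed.

End Dyadic.

(** * Sorting under a permutation-invariant seminorm *)

Section Sorting.
Local Open Scope ring_scope.
Variables (R : realFieldType) (n : nat).
Implicit Types (a b : 'I_n -> R).

Record symmetric_seminorm (p : ('I_n -> R) -> R) : Prop := {
  ssn_add : forall a b, p (fun j => a j + b j) <= p a + p b;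
  ssn_scale : forall (c : R) a, p (fun j => c * a j) = `|c| * p a;
  ssn_perm : forall (tau : 'I_n -> 'I_n) a, injective tau ->
    p (fun j => a (tau j)) = p a
}.

Variable p : ('I_n -> R) -> R.
Hypothesis hp : symmetric_seminorm p.

Lemma ssn_convex (t : R) a b : 0 <= t <= 1 ->
  p (fun j => t * a j + (1 - t) * b j) <= t * p a + (1 - t) * p b.
Proof.
move=> /andP[t0 t1]; apply: le_trans (ssn_add hp _ _) _.
by rewrite !(ssn_scale hp) !ger0_norm// subr_ge0.
Qed.

Lemma ssn_sum (I : Type) (r : seq I) (F : I -> 'I_n -> R) :
  p (fun j => \sum_(i <- r) F i j) <= \sum_(i <- r) p (F i).
Proof.
elim: r => [|i r IH].
  have -> : (fun j => \sum_(i <- [::]) F i j) = fun j => 0 * (fun=> 0) j.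
    by apply/funext => j; rewrite big_nil mul0r.
  by rewrite (ssn_scale hp) normr0 mul0r big_nil.
under eq_fun do rewrite big_cons; rewrite big_cons.
by apply: le_trans (ssn_add hp _ _) _; rewrite lerD2l.
Qed.

Variables (I : finType) (c : I -> R).
Hypothesis c0 : forall i, 0 <= c i.
Implicit Type S : I -> {set 'I_n}.

Definition weight S (j : 'I_n) : R := \sum_i c i * (j \in S i)%:R.

(** A comparator: membership at x becomes the disjunction and at y the conjunction of the two. The
    same pair is used for every set of a family at once. *)
Definition exchange (x y : 'I_n) (S : {set 'I_n}) : {set 'I_n} :=
  if (x \notin S) && (y \in S) then x |: (S :\ y) else S.

Lemma card_exchange x y (S : {set 'I_n}) : #|exchange x y S| = #|S|.
Proof.
rewrite /exchange; case: ifP => // /andP[xS yS].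
by rewrite cardsU1 !inE negb_and xS orbT (cardsD1 y S) yS.
Qed.

Lemma in_exchange x y j (S : {set 'I_n}) : x != y ->
  (j \in exchange x y S) =
  if j == x then (x \in S) || (y \in S) else
  if j == y then (x \in S) && (y \in S) else j \in S.
Proof.
move=> xy; rewrite /exchange; case: ifP => [/andP[xS yS]|H].
  rewrite !inE; case: (eqVneq j x) => [->|jx] /=; first by rewrite yS orbT.
  by case: (eqVneq j y) => [->|jy] //=; rewrite (negbTE xS).
case: (eqVneq j x) => [->|jx].
  by move: H; case: (x \in S); case: (y \in S).
case: (eqVneq j y) => [->|jy] //.
by move: H; case: (x \in S); case: (y \in S).
Qed.

(* The exchanged weights spread the values at x and y apart with the same sum,
   so the old weights are a convex combination of them and their transpose. *)
Lemma weight_exchange x y S : x != y ->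
  p (weight S) <= p (weight (fun i => exchange x y (S i))).
Proof.
move=> xy; set S' := fun i => _; set h := weight S; set h' := weight S'.
have hx : h x <= h' x.
  apply: ler_sum => i _; rewrite ler_wpM2l// in_exchange// eqxx ler_nat.
  by case: (x \in S i).
have hy : h y <= h' x.
  apply: ler_sum => i _; rewrite ler_wpM2l// in_exchange// eqxx ler_nat.
  by case: (y \in S i); rewrite ?orbT.
have hxy : h x + h y = h' x + h' y.
  rewrite -!big_split; apply: eq_bigr => i _ /=.
  rewrite -!mulrDr !in_exchange// !eqxx eq_sym (negbTE xy) -!natrD.
  by case: (x \in S i); case: (y \in S i).
have hj j : j != x -> j != y -> h j = h' j.
  by move=> jx jy; apply: eq_bigr => i _; rewrite in_exchange// (negbTE jx) (negbTE jy).
pose tau j := if j == x then y else if j == y then x else j.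
have tauK : involutive tau.
  move=> j; rewrite /tau; case: (eqVneq j x) => [->|jx].
    by rewrite eq_sym (negbTE xy) eqxx.
  by case: (eqVneq j y) => [->|jy]; rewrite ?eqxx// (negbTE jx) (negbTE jy).
have pt : p (fun j => h' (tau j)) = p h' by apply: (ssn_perm hp); exact: inv_inj.
have [e|ne] := eqVneq (h' x) (h' y).
  have -> : h = h' => //; apply/funext => j.
  have [->|jx] := eqVneq j x; first by lra.
  have [->|jy] := eqVneq j y; first by lra.
  exact: hj.
have d0 : 0 < h' x - h' y by move: ne => /eqP ne; rewrite lt_neqAle; apply/andP; split;
  [apply/eqP => H; apply: ne; lra|lra].
(* Chosen so that h(x) = t h'(x) + (1 - t) h'(y); equality of the sums then gives the matching
   identity at y. *)
pose t := (h x - h' y) / (h' x - h' y).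
have td : t * (h' x - h' y) = h x - h' y by rewrite /t divfK// gt_eqF.
have t01 : 0 <= t <= 1.
  rewrite /t divr_ge0 ?(ltW d0)//=; last by lra.
  by rewrite ler_pdivrMr// mul1r; lra.
have -> : h = fun j => t * h' j + (1 - t) * h' (tau j).
  apply/funext => j; rewrite /tau.
  have [->|jx] := eqVneq j x; first by lra.
  have [->|jy] := eqVneq j y; first by lra.
  by rewrite (hj j)//; lra.
by apply: le_trans (ssn_convex _ _ t01) _; rewrite pt; lra.
Qed.

Definition initial_segment (m : nat) : {set 'I_n} := [set j : 'I_n | (j < m)%N].

(** Closure under single steps down already identifies the sets on which no adjacent exchange acts,
    so adjacent exchanges suffice for sorting. *)
Lemma down_closed_initial (S : {set 'I_n}) :
  (forall x y : 'I_n, y = x.+1 :> nat -> y \in S -> x \in S) ->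
  S = initial_segment #|S|.
Proof.
move=> H.
have down d : forall x y : 'I_n, y = (x + d)%N :> nat -> y \in S -> x \in S.
  elim: d => [|d IH] x y yx yS.
    by rewrite (_ : x = y)//; apply: ord_inj; rewrite yx addn0.
  have x1n : (x.+1 < n)%N.
    by apply: leq_ltn_trans (ltn_ord y); rewrite yx addnS ltnS leq_addr.
  apply: (H _ (Ordinal x1n)) => //; apply: (IH _ y) => //.
  by rewrite yx /= addSnnS.
have seg (j : 'I_n) : #|initial_segment j| = j.
  rewrite /initial_segment -[RHS](card_ord j).
  pose f (i : 'I_j) := widen_ord (ltnW (ltn_ord j)) i.
  rewrite -[RHS](card_codom (f := f)); last first.
    by move=> i i' /(congr1 val) /= e; apply: ord_inj.
  apply: eq_card => i; rewrite inE; apply/idP/codomP => [ij|[i' ->]] /=.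
    by exists (Ordinal ij); apply: ord_inj.
  exact: ltn_ord.
apply/setP => j; rewrite inE; apply/idP/idP => [jS|]; last apply: contraTT => jS.
  have -> : (j < #|S|)%N = (#|j |: initial_segment j| <= #|S|)%N.
    by rewrite cardsU1 inE ltnn/= seg.
  apply: subset_leq_card; apply/fintype.subsetP => i; rewrite !inE => /orP[/eqP->//|ij].
  by apply: (down (j - i)%N i j) => //; rewrite subnKC// ltnW.
rewrite -leqNgt -[X in (_ <= X)%N](seg j); apply: subset_leq_card; apply/fintype.subsetP => i iS.
rewrite inE ltnNge; apply: contra jS => ji.
by apply: (down (i - j)%N j i) => //; rewrite subnKC.
Qed.

(** Bubble sort: while some set has an adjacent inversion, exchange that pair in all sets. The
    seminorm does not decrease and the total of all positions drops. *)
Theorem weight_sorted S :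
  p (weight S) <= p (weight (fun i => initial_segment #|S i|)).
Proof.
pose pot S := (\sum_i \sum_(j in S i) (j : nat))%N.
elim: {S}(pot S).+1 {-2}S (ltnSn (pot S)) => // m IH S potS.
have [H|] := boolP [forall i, forall x : 'I_n, forall y : 'I_n,
    (val y == x.+1) ==> (y \in S i) ==> (x \in S i)].
  suff <- : S = fun i => initial_segment #|S i| by [].
  apply/funext => i; apply: down_closed_initial => x y /eqP yx yS.
  by move/forallP/(_ i)/forallP/(_ x)/forallP/(_ y) : H; rewrite yx yS.
rewrite negb_forall => /existsP[i]; rewrite negb_forall => /existsP[x].
rewrite negb_forall => /existsP[y]; rewrite !negb_imply => /and3P[/eqP yx yS xS].
have xy : x != y by apply/eqP => e; move: yx; rewrite e => /eqP; rewrite -[X in X == _]addn0 -addn1 eqn_add2l.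
apply: le_trans (weight_exchange S xy) _.
(* Exchanges preserve cardinalities, so the sorted family is the same before and after. *)
under [X in _ <= p (weight X)]eq_fun do rewrite -(card_exchange x y).
apply: IH; move: potS; rewrite ltnS; apply: leq_trans.
(* Since y = x + 1, each effective move lowers the potential by exactly 1, and [S i] does move. *)
have ex j : (\sum_(z in exchange x y (S j)) (z : nat) +
    ((x \notin S j) && (y \in S j)) = \sum_(z in S j) (z : nat))%N.
  rewrite /exchange; case: ifP => [/andP[xSj ySj]|_]; last by rewrite addn0.
  rewrite big_setU1 ?inE ?negb_and ?xSj ?orbT//= (big_setD1 y ySj) /= yx.
  by rewrite addnAC addn1.
rewrite /pot -[X in (_ < X)%N](eq_bigr _ (fun j _ => ex j)) big_split/=.
by rewrite -addn1 leq_add2l (bigD1 i)//= xS yS.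
Qed.

End Sorting.

(** Addition in ['I_n.+1] is cyclic, so the constant mean vector is the average of the n + 1 shifts
    of a, all of the same seminorm. *)
Lemma ssn_mean (R : realFieldType) (n : nat) (p : ('I_n.+1 -> R) -> R)
    (a : 'I_n.+1 -> R) : symmetric_seminorm p ->
  (p (fun=> (\sum_j a j) / n.+1%:R) <= p a)%R.
Proof.
move=> hp; have n0 : (0 < n.+1%:R^-1 :> R)%R by rewrite invr_gt0 ltr0n.
have -> : (fun=> ((\sum_j a j) / n.+1%:R)%R) =
    (fun j : 'I_n.+1 => n.+1%:R^-1 * (\sum_i a (j + i)))%R.
  apply/funext => j; rewrite mulrC; congr (_ * _)%R.
  by rewrite (reindex_inj (addrI j)).
rewrite (ssn_scale hp) gtr0_norm// -ler_pdivlMl ?invrK//.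
apply: le_trans (ssn_sum hp _ _) _.
rewrite (eq_bigr (fun=> p a)); first by rewrite sumr_const card_ord mulr_natl.
by move=> i _; apply: (ssn_perm hp (tau := fun j => (j + i)%R)); exact: addIr.
Qed.

(** * Dyadic step functions and sums of indicators in E *)

Section Steps.
Local Open Scope classical_set_scope.
Local Open Scope ring_scope.
Variables (R : realType) (alpha : \bar R).
Hypothesis halpha : alpha = 1%E \/ alpha = +oo%E.
Variable E : BFS alpha.
Hypothesis symE : symmetric_space E.
Hypothesis fatouE : Fatou_property E.
Variable k : nat.
Notation mu := (@lebesgue_measure R).
Notation D := (dom alpha).
Notation Emem := (@Emem R alpha E).
Notation nrm := (@nrm R alpha E).
Notation star := (@star R alpha).
Implicit Types f g : R -> R.
Hypothesis star_points : forall f, Emem f -> nrm f = 1 -> real_point E k (star f).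
Hypothesis nontrivial : exists2 f, Emem f & nrm f = 1.

Local Notation ind A := (\1_A : R -> R).
Local Notation cell := (@cell R).
Local Notation cells m S := (@cells R m _ S).
Let memI := mem_indic halpha symE fatouE star_points nontrivial.
Let smallI := small_indic halpha symE fatouE star_points nontrivial.

Section StepSpace.
Variables (T m : nat).
Hypothesis Ta : (T%:R%:E <= alpha)%E.
Local Notation n := (T * 2 ^ m)%N.
Implicit Types a : 'I_n -> R.

Definition step a (s : R) : R := \sum_j a j * ind (cell m j) s.

Lemma cell_sub (j : 'I_n) : cell m j `<=` D.
Proof.
move=> s cs; have s0 := cell_ge0 cs; split=> //; apply: lt_le_trans Ta; rewrite lte_fin.
move: cs; rewrite /cell /= in_itv/= => /andP[_ /lt_le_trans]; apply.
rewrite ler_pdivrMr ?pow2_gt0// -natrX -natrM ler_nat; exact: ltn_ord.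
Qed.

Lemma step_cell a (j : 'I_n) s : cell m j s -> step a s = a j.
Proof.
move=> cs; rewrite /step (bigD1 j)//= indicE mem_set// mulr1 big1 ?addr0// => i ij.
rewrite indicE memNset ?mulr0// => ci; move/eqP: ij; apply; apply: ord_inj.
have s0 := cell_ge0 cs.
by move: ci cs => /(mem_cell _ _ s0) <- /(mem_cell _ _ s0).
Qed.

Lemma step_out a s : (forall j : 'I_n, ~ cell m j s) -> step a s = 0.
Proof. by move=> H; rewrite /step big1// => j _; rewrite indicE memNset ?mulr0. Qed.

Lemma cells_sub (S : {set 'I_n}) : cells m S `<=` D.
Proof. by move=> s [j _ /cell_sub]. Qed.

Lemma mem_step a : Emem (step a).
Proof.
apply: mem_sum => j; apply: memZ.
have cy : (mu (cell m j) < +oo)%E by rewrite mu_cell ltry.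
exact: (memI (measurable_cell m j) (@cell_sub j) cy).1.
Qed.

Lemma dist_step a l : 0 <= l ->
  dist alpha (step a) l = (#|[set j : 'I_n | (l < `|a j|)%R]%SET|%:R / 2 ^+ m)%:E.
Proof.
move=> l0; rewrite -mu_cells /dist; congr (mu _); apply/seteqP; split=> s.
  move=> [Ds]; have [[j cs]|H] := pselect (exists j : 'I_n, cell m j s).
    by rewrite (step_cell a cs) => lj; exists j => //; rewrite inE.
  rewrite step_out ?normr0 ?ltNge ?l0// => j cs; apply: H; by exists j.
move=> [j]; rewrite inE => lj cs; split; first exact: cell_sub cs.
by rewrite (step_cell a cs).
Qed.

(** Cells have equal measure, so permuting the values gives an equimeasurable function; here
    symmetry of E becomes permutation invariance. *)
Lemma step_seminorm : symmetric_seminorm (fun a => nrm (step a)).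
Proof.
split=> [a b|c a|tau a injt].
- have -> : step (fun j => a j + b j) = fun s => step a s + step b s.
    by apply/funext => s; rewrite /step -big_split; apply: eq_bigr => j _; rewrite mulrDl.
  by apply: nrmD; exact: mem_step.
- have -> : step (fun j => c * a j) = fun s => c * step a s.
    by apply/funext => s; rewrite /step mulr_sumr; apply: eq_bigr => j _; rewrite mulrA.
  by apply: nrmZ; exact: mem_step.
- have [|_ ->//] := equimeasurable symE (mem_measurable (mem_step (fun j => a (tau j))))
    (mem_step a).
  move=> l l0; rewrite !dist_step//; congr ((_%:R / _)%:E).
  rewrite -[RHS](on_card_preimset (f := tau)); last exact: onW_bij (injF_bij injt).
  by congr #|pred_of_set _|; apply/setP => j; rewrite !inE.
Qed.

Lemma indic_cells (S : {set 'I_n}) : ind (cells m S) = step (fun j => (j \in S)%:R).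
Proof.
apply/funext => s; have [[j cs]|H] := pselect (exists j : 'I_n, cell m j s).
  rewrite (step_cell _ cs) indicE; congr ((nat_of_bool _)%:R); apply/idP/idP.
    rewrite inE => -[i iS ci]; suff -> : j = i by [].
    apply: ord_inj; have s0 := cell_ge0 cs.
    by move: ci cs => /(mem_cell _ _ s0) <- /(mem_cell _ _ s0).
  by move=> jS; rewrite inE; exists j.
rewrite step_out; last by move=> j cs; apply: H; exists j.
by rewrite indicE memNset// => -[j _ cs]; apply: H; exists j.
Qed.

Lemma step_weight (I : finType) (c : I -> R) (S : I -> {set 'I_n}) :
  step (weight c S) = fun s => \sum_i c i * ind (cells m (S i)) s.
Proof.
apply/funext => s.
transitivity (\sum_j \sum_i c i * (j \in S i)%:R * ind (cell m j) s).
  by apply: eq_bigr => j _; rewrite /weight mulr_suml.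
rewrite exchange_big/=; apply: eq_bigr => i _.
rewrite indic_cells /step mulr_sumr.
by apply: eq_bigr => j _; rewrite mulrA.
Qed.

Lemma cells_initial (q : nat) : (q <= n)%N ->
  cells m (initial_segment n q) = `[0, q%:R / 2 ^+ m[%classic.
Proof.
move=> qn; apply/seteqP; split=> s.
  move=> [j]; rewrite inE => jq; rewrite /cell /= !in_itv/= => /andP[js sj].
  rewrite (le_trans _ js) ?divr_ge0 ?(ltW (pow2_gt0 _ _))//=.
  by apply: lt_le_trans sj _; rewrite ler_pM2r ?invr_gt0 ?pow2_gt0// ler_nat.
rewrite /= in_itv/= => /andP[s0 sq].
have jq : (Num.truncn (s * 2 ^+ m) < q)%N.
  rewrite truncn_lt_nat; last by rewrite mulr_ge0// ltW// pow2_gt0.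
  by rewrite -ltr_pdivlMr ?pow2_gt0.
exists (Ordinal (leq_trans jq qn)); first by rewrite inE.
exact/mem_cell.
Qed.

End StepSpace.

Lemma indic_close e d (A B : set R) :
  (forall C, measurable C -> C `<=` D -> (mu C <= d%:E)%E ->
    Emem (ind C) /\ nrm (ind C) <= e) ->
  measurable A -> measurable B -> A `<=` D -> B `<=` D ->
  (mu (A `\` B) <= d%:E)%E -> (mu (B `\` A) <= d%:E)%E ->
  Emem (ind A) -> Emem (ind B) ->
  nrm (fun s => ind A s - ind B s) <= 2 * e.
Proof.
move=> Hd mA mB AD BD AB BA MA MB.
have [M1 N1] := Hd _ (measurableD mA mB) (fun s H => AD s H.1) AB.
have [M2 N2] := Hd _ (measurableD mB mA) (fun s H => BD s H.1) BA.
rewrite mulr_natl mulr2n; apply: le_trans (lerD N1 N2).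
apply: le_trans (nrmD M1 M2); apply: ler_nrm.
- by apply: (@mem_measurable _ _ E); exact: memB.
- exact: memD.
- move=> s _ _; rewrite !indicE !in_setD.
  by case: (s \in A); case: (s \in B); rewrite /= ?subrr ?subr0 ?addr0 ?sub0r ?add0r ?normrN.
Qed.

Lemma indic_sum_close (I : finType) (c : I -> R) (A B : I -> set R) e :
  (forall i, 0 <= c i) -> (forall i, Emem (ind (A i))) -> (forall i, Emem (ind (B i))) ->
  (forall i, nrm (fun s => ind (A i) s - ind (B i) s) <= e) ->
  nrm (fun s => \sum_i c i * ind (A i) s) <=
  nrm (fun s => \sum_i c i * ind (B i) s) + (\sum_i c i) * e.
Proof.
move=> c0 MA MB H.
have M1 i := memZ (c i) (MA i); have M2 i := memZ (c i) (MB i).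
have M3 i : Emem (fun s => c i * (ind (A i) s - ind (B i) s)).
  by apply: memZ; exact: memB.
apply: le_trans (nrm_lerD (mem_sum (index_enum I) M1) (mem_sum (index_enum I) M2)) _.
rewrite lerD2l.
rewrite (_ : (fun s => _) = fun s => \sum_i c i * (ind (A i) s - ind (B i) s)); last first.
  by apply/funext => s; rewrite -sumrB; apply: eq_bigr => i _; rewrite mulrBr.
apply: le_trans (nrm_sum (index_enum I) M3) _; rewrite mulr_suml; apply: ler_sum => i _.
rewrite nrmZ; last exact: memB.
by rewrite ger0_norm// ler_wpM2l.
Qed.

Lemma initial_itv_diff (x y d : R) : 0 <= d -> y <= x + d ->
  (mu (`[0%R, y[%classic `\` `[0%R, x[%classic) <= d%:E)%E.
Proof.
move=> d0 yxd; apply: (@le_trans _ _ (mu `[x, y[%classic)).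
  apply: le_measure; rewrite ?inE//.
  - by apply: measurableD; exact: measurable_itv.
  - move=> s [/=]; rewrite !in_itv/= => /andP[s0 sy] /negP; rewrite s0/= -leNgt => ->.
    by [].
rewrite lebesgue_measure_itv/= lte_fin; case: ifP => _; rewrite ?lee_fin//.
by lra.
Qed.

Lemma mu_diff_bound (A B : set R) d : measurable A -> measurable B ->
  (mu A < +oo)%E -> (mu B < +oo)%E -> (mu (A `\` B) <= d%:E)%E ->
  fine (mu A) <= fine (mu B) + d.
Proof.
move=> mA mB Ay By AB.
have fA : mu A \is a fin_num by rewrite ge0_fin_numE ?measure_ge0.
have fB : mu B \is a fin_num by rewrite ge0_fin_numE ?measure_ge0.
rewrite -lee_fin EFinD !fineK//; apply: le_trans (leeD2l (mu B) AB).
have mAB := measurableD mA mB.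
apply: le_trans (measureU2 mu mB mAB); apply: le_measure; rewrite ?inE//.
  exact: measurableU.
by move=> s As; have [Bs|nBs] := pselect (B s); [left|right].
Qed.

(** Replace each set by a union of cells, sort the cells, and compare the resulting initial interval
    with the one of length mu(A_i), which differs in length by at most d. *)
Lemma sum_initial_bounded (I : finType) (c : I -> R) (A : I -> set R) (T : nat) :
  (T%:R%:E <= alpha)%E -> (forall i, 0 <= c i) -> (forall i, measurable (A i)) ->
  (forall i, A i `<=` `[0, T%:R[%classic) ->
  nrm (fun s => \sum_i c i * ind (A i) s) <=
  nrm (fun s => \sum_i c i * ind `[0, fine (mu (A i))[%classic s).
Proof.
move=> Ta c0 mA AT.
have AD i : A i `<=` D.
  by move=> s /AT; rewrite /= in_itv/= => /andP[s0 sT]; split=> //; apply: lt_le_trans Ta; rewrite lte_fin.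
have Ay i : (mu (A i) < +oo)%E.
  apply: (@le_lt_trans _ _ (mu `[0, T%:R[%classic)).
    by apply: le_measure; rewrite ?inE; [exact: mA|exact: measurable_itv|exact: AT].
  by rewrite mu_initial_itv ?ltry.
have Af i : mu (A i) \is a fin_num by rewrite ge0_fin_numE ?measure_ge0.
have MA i := (memI (mA i) (AD i) (Ay i)).1.
have Aa i : (mu (A i) <= alpha)%E.
  by rewrite -(mu_dom halpha); apply: le_measure; rewrite ?inE; [exact: mA|exact: (measurable_dom halpha)|exact: AD].
have ID i : `[0, fine (mu (A i))[%classic `<=` D by apply: initial_subE; rewrite fineK.
have MI i : Emem (ind `[0, fine (mu (A i))[%classic).
  by apply: (mem_indic_itv halpha symE fatouE star_points nontrivial); rewrite fineK.
apply/ler_addgt0Pr => e e0.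
pose C := \sum_i c i; have C0 : 0 <= C by apply: sumr_ge0.
(* There are two replacements, each costing at most C * 2e', one e' for each half of a symmetric
   difference; the summand 1 covers C = 0. *)
pose e' := e / (4 * (C + 1)); have e'0 : 0 < e' by rewrite divr_gt0// mulr_gt0// ltr_wpDl.
have [d d0 Hd] := smallI e'0.
have /choice[m0 Hm0] := fun i => approx_by_cells (mA i) (AT i) d0.
(* One grid for all sets, as sorting moves the cells of all of them together. *)
pose m := \max_i m0 i.
have /choice[S HS] : forall i, exists S : {set 'I_(T * 2 ^ m)},
    (mu (A i `\` cells m S) <= d%:E)%E /\ (mu (cells m S `\` A i) <= d%:E)%E.
  by move=> i; apply: Hm0; exact: leq_bigmax.
have mS i := @measurable_cells R m _ (S i).
have Sy i : (mu (cells m (S i)) < +oo)%E by rewrite mu_cells ltry.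
have SD i := @cells_sub T m Ta (S i).
have MS i := (memI (mS i) (SD i) (Sy i)).1.
pose q i := #|S i|.
have qn i : (q i <= T * 2 ^ m)%N by rewrite -[leqRHS]card_ord; exact: max_card.
have le1 : nrm (fun s => \sum_i c i * ind (A i) s) <=
    nrm (fun s => \sum_i c i * ind (cells m (S i)) s) + C * (2 * e').
  by apply: indic_sum_close => // i; have [H1 H2] := HS i; exact: (indic_close Hd).
have le2 : nrm (fun s => \sum_i c i * ind (cells m (S i)) s) <=
   nrm (fun s => \sum_i c i * ind `[0, (q i)%:R / 2 ^+ m[%classic s).
  rewrite -step_weight; apply: le_trans (weight_sorted (step_seminorm m Ta) c0 S) _.
  rewrite step_weight le_eqVlt; apply/orP; left; apply/eqP; congr nrm.
  by apply/funext => s; apply: eq_bigr => i _; rewrite (cells_initial (qn i)).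
have qE i : (q i)%:R / 2 ^+ m = fine (mu (cells m (S i))) by rewrite mu_cells.
have le3 : nrm (fun s => \sum_i c i * ind `[0, (q i)%:R / 2 ^+ m[%classic s) <=
    nrm (fun s => \sum_i c i * ind `[0, fine (mu (A i))[%classic s) + C * (2 * e').
  apply: indic_sum_close => // i.
    rewrite -(cells_initial (qn i)); apply: (memI (measurable_cells m _) _ _).1.
      exact: cells_sub.
    by rewrite mu_cells ltry.
  have [H1 H2] := HS i.
  apply: (indic_close Hd) => //.
  - by rewrite -(cells_initial (qn i)); exact: cells_sub.
  - by apply: initial_itv_diff (ltW d0) _; rewrite qE; exact: mu_diff_bound.
  - by apply: initial_itv_diff (ltW d0) _; rewrite qE; exact: mu_diff_bound.
  - rewrite -(cells_initial (qn i)); apply: (memI (measurable_cells m _) _ _).1.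
      exact: cells_sub.
    by rewrite mu_cells ltry.
apply: le_trans le1 _; apply: le_trans (lerD (le_trans le2 le3) (lexx _)) _.
rewrite -addrA lerD2l.
have -> : C * (2 * e') + C * (2 * e') = e * (C / (C + 1)) by rewrite /e'; field; rewrite lt0r_neq0// ltr_wpDl.
by rewrite ler_piMr ?(ltW e0)// ler_pdivrMr ?ltr_wpDl// mul1r lerDl.
Qed.

(** When alpha = oo, continuity from above makes the tail of a set of finite measure small; when
    alpha = 1 there is no tail. *)
Lemma exists_bound (I : finType) (A : I -> set R) d : 0 < d ->
  (forall i, measurable (A i)) -> (forall i, A i `<=` D) -> (forall i, (mu (A i) < +oo)%E) ->
  exists2 T : nat, (T%:R%:E <= alpha)%E &
    forall i, (mu (A i `\` `[0%R, T%:R[%classic) <= d%:E)%E.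
Proof.
move=> d0 mA AD Ay; case: halpha => ha.
  exists 1%N; first by rewrite ha.
  move=> i; rewrite (_ : _ `\` _ = set0) ?measure0 ?lee_fin ?ltW//.
  apply/seteqP; split=> s //= -[/AD[s0]]; rewrite ha lte_fin => s1.
  by case; rewrite in_itv/= s0.
have H i : exists T0 : nat, forall T, (T0 <= T)%N ->
    (mu (A i `\` `[0%R, T%:R[%classic) <= d%:E)%E.
  pose F n := A i `\` `[0%R, n%:R[%classic.
  have mF n : measurable (F n) by apply: measurableD => //; exact: measurable_itv.
  have F0 : \bigcap_n F n = set0.
    apply/seteqP; split=> s //= H.
    have [/AD[s0 _] _] := H 0%N Logic.I.
    have [_] := H (Num.truncn s).+1 Logic.I; apply; rewrite /= in_itv/= s0.
    exact: truncnS_gt.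
  have F0y : (mu (F 0%N) < +oo)%E.
    apply: le_lt_trans (Ay i); apply: le_measure; rewrite ?inE; [exact: mF|exact: mA|].
    by move=> s [].
  have mF0 : measurable (\bigcap_n F n) by rewrite F0.
  have dF : nonincreasing_seq F.
    move=> a b ab; apply/subsetPset => s [As nb]; split=> // sa; apply: nb.
    move: sa; rewrite /= !in_itv/= => /andP[-> /lt_le_trans]; apply.
    by rewrite ler_nat.
  have := nonincreasing_cvg_mu F0y mF mF0 dF.
  rewrite F0 measure0 => /fine_cvgP[].
  move=> Ff /cvg_epsP /(_ d d0)[N HN]; move: Ff => [N' _ HN'].
  exists (maxn N N') => T; rewrite geq_max => /andP[NT N'T].
  have := HN T NT; rewrite subr0 ger0_norm ?fine_ge0 ?measure_ge0//= => H.
  by have := HN' T N'T; rewrite /= => /fineK <-; rewrite lee_fin.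
have /choice[T0 HT0] := H.
exists (\max_i T0 i); first by rewrite ha leey.
by move=> i; apply: HT0; exact: leq_bigmax.
Qed.

Lemma sum_initial (I : finType) (c : I -> R) (A : I -> set R) :
  (forall i, 0 <= c i) -> (forall i, measurable (A i)) ->
  (forall i, A i `<=` D) -> (forall i, (mu (A i) < +oo)%E) ->
  nrm (fun s => \sum_i c i * ind (A i) s) <=
  nrm (fun s => \sum_i c i * ind `[0, fine (mu (A i))[%classic s).
Proof.
move=> c0 mA AD Ay.
have Af i : mu (A i) \is a fin_num by rewrite ge0_fin_numE ?measure_ge0.
have MA i := (memI (mA i) (AD i) (Ay i)).1.
have Aa i : (mu (A i) <= alpha)%E.
  by rewrite -(mu_dom halpha); apply: le_measure; rewrite ?inE; [exact: mA|exact: (measurable_dom halpha)|exact: AD].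
have MI i : Emem (ind `[0, fine (mu (A i))[%classic).
  by apply: (mem_indic_itv halpha symE fatouE star_points nontrivial); rewrite fineK.
apply/ler_addgt0Pr => e e0.
pose C := \sum_i c i; have C0 : 0 <= C by apply: sumr_ge0.
pose e' := e / (2 * (C + 1)); have e'0 : 0 < e' by rewrite divr_gt0// mulr_gt0// ltr_wpDl.
have [d d0 Hd] := smallI e'0.
have [T Ta HT] := exists_bound d0 mA AD Ay.
pose B i := A i `&` `[0%R, T%:R[%classic.
have mB i : measurable (B i) by apply: measurableI => //; exact: measurable_itv.
have BA i : B i `<=` A i by move=> s [].
have BD i := subset_trans (BA i) (AD i).
have muBA i : (mu (B i) <= mu (A i))%E.
  by apply: le_measure; rewrite ?inE; [exact: mB|exact: mA|exact: BA].
have By i := le_lt_trans (muBA i) (Ay i).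
have Bf i : mu (B i) \is a fin_num by rewrite ge0_fin_numE ?measure_ge0.
have MB i := (memI (mB i) (BD i) (By i)).1.
have le1 : nrm (fun s => \sum_i c i * ind (A i) s) <=
    nrm (fun s => \sum_i c i * ind (B i) s) + C * (2 * e').
  apply: indic_sum_close => // i; apply: (indic_close Hd) => //.
    by rewrite /B setDIr setDv set0U.
  rewrite (_ : _ `\` _ = set0) ?measure0 ?lee_fin ?ltW//.
  by apply/seteqP; split=> s //= -[[]].
apply: le_trans le1 _; apply: lerD; last first.
  have -> : C * (2 * e') = e * (C / (C + 1)) by rewrite /e'; field; rewrite lt0r_neq0// ltr_wpDl.
  by rewrite ler_piMr ?(ltW e0)// ler_pdivrMr ?ltr_wpDl// mul1r lerDl.
have BT i : B i `<=` `[0, T%:R[%classic by move=> s [].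
apply: le_trans (sum_initial_bounded Ta c0 mB BT) _.
have MZ i := memZ (c i) (MI i).
apply: ler_nrm.
- apply: measurable_sum => i; apply: measurable_funM => //.
- exact: (mem_sum (index_enum I) MZ).
- move=> s _ _; rewrite !ger0_norm; try by apply: sumr_ge0 => i _; rewrite mulr_ge0// indicE.
  apply: ler_sum => i _; apply: ler_wpM2l => //; rewrite !indicE ler_nat.
  case: (boolP (s \in `[0, fine (mu (B i))[%classic)) => // /set_mem/=.
  rewrite in_itv/= => /andP[s0 sB]; rewrite mem_set//= in_itv/= s0 (lt_le_trans sB)//.
  by rewrite fine_le.
Qed.

End Steps.

(** * The rearrangement inequality for sums *)

Section Majorization.
Local Open Scope classical_set_scope.
Local Open Scope ring_scope.
Variables (R : realType) (alpha : \bar R).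
Hypothesis halpha : alpha = 1%E \/ alpha = +oo%E.
Variable E : BFS alpha.
Hypothesis symE : symmetric_space E.
Hypothesis fatouE : Fatou_property E.
Variable k : nat.
Notation mu := (@lebesgue_measure R).
Notation D := (dom alpha).
Notation Emem := (@Emem R alpha E).
Notation nrm := (@nrm R alpha E).
Notation star := (@star R alpha).
Implicit Types f g : R -> R.
Hypothesis star_points : forall f, Emem f -> nrm f = 1 -> real_point E k (star f).

Local Notation ind A := (\1_A : R -> R).

(** If d_f(l) were infinite, then alpha = oo and f* > l on all of (0, oo). The indicators of (r, oo)
    would lie in E with one common positive norm, whereas order continuity makes f* restricted to
    (n, oo) tend to 0. *)
Lemma dist_fin f l : Emem f -> 0 < l -> (dist alpha f l < +oo)%E.
Proof.
move=> Mf l0; rewrite ltey; apply/eqP => dy.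
have ay : alpha = +oo%E.
  apply/eqP; rewrite -leye_eq -dy -distE; apply: distrf_le_alpha => //.
  exact: (L0_EFin (mem_measurable Mf)).
have Dpos s : 0 <= s -> D s by move=> s0; split; rewrite ?ay ?ltry.
have lf t : 0 < t -> l < star f t.
  move=> t0; apply/(lt_star halpha symE Mf (Dpos _ (ltW t0)) t0 (ltW l0)).
  by rewrite dy ltry.
have Msf := mem_star halpha symE Mf.
pose A (r : R) : set R := `]r, +oo[%classic.
have mA r : measurable (A r) by exact: measurable_itv.
have mI r : measurable_fun setT (ind (A r)) by exact: measurable_indic.
have MA (r : R) : 0 <= r -> Emem (ind (A r)).
  move=> r0; apply: (mem_le _ (memZ l^-1 Msf)) => // s Ds s0.
  rewrite [leRHS]ger0_norm ?mulr_ge0 ?invr_ge0 ?star_ge0 ?(ltW l0)//.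
  rewrite indicE; case: (_ \in _); last by rewrite normr0 mulr_ge0 ?invr_ge0 ?star_ge0 ?(ltW l0).
  by rewrite normr1 ler_pdivlMl// mulr1 ltW// lf.
have AD (r : R) : 0 <= r -> A r `<=` D.
  by move=> r0 s; rewrite /A /= in_itv/= andbT => rs; apply: Dpos; rewrite ltW// (le_lt_trans r0).
have muA r : mu (A r) = +oo%E by rewrite lebesgue_measure_itv/= ltry.
have NA (r : R) : 0 <= r -> nrm (ind (A r)) = nrm (ind (A 0)).
  move=> r0; have eA : mu (A r) = mu (A 0) by rewrite !muA.
  exact: (equi_indic symE (mA r) (mA 0) (AD _ r0) (AD _ (lexx 0)) eA (MA _ (lexx 0))).2.
have : increases_to alpha (fun n s => star f s * (1 - ind (A n%:R) s)) (star f).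
  have E1 n s : star f s * (1 - ind (A n%:R) s) = if n%:R < s then 0 else star f s.
    rewrite indicE; case: ltP => ns.
      by rewrite mem_set ?subrr ?mulr0// /A/= in_itv/= ns.
    by rewrite memNset ?subr0 ?mulr1// /A/= in_itv/= andbT => sn; move: ns; rewrite leNgt sn.
  split=> [n|n s _ _|s m n _ _ mn|s _ s0].
  - apply: measurable_funM; first exact: mem_measurable Msf.
    by apply: measurable_funB.
  - by rewrite E1; case: ifP; rewrite ?star_ge0 ?lexx.
  - rewrite !E1; case: (ltP m%:R s) => ms; first by case: ifP; rewrite ?star_ge0.
    by rewrite ltNge (le_trans ms) ?ler_nat.
  - apply/cvg_epsP => d d0; exists (Num.truncn s).+1 => n Hn.
    rewrite E1 ltNge (_ : s <= n%:R) ?subrr ?normr0; first exact: ltW.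
    by apply: ltW; apply: lt_le_trans (truncnS_gt _) _; rewrite ler_nat.
move=> /(order_continuous_star halpha symE fatouE star_points Mf) /cvg_epsP H.
have N0 : 0 < nrm (ind (A 0)).
  rewrite lt_neqAle (nrm_ge0 (MA 0 (lexx 0))) andbT eq_sym; apply/eqP => N0.
  have := bfs_norm_eq0 (proj2 (MA 0 (lexx 0))) N0; rewrite /ae_on => -[B [mB B0 HB]].
  have : (mu (A 0%R) <= mu B)%E.
    apply: le_measure; rewrite ?inE; [exact: mA|exact: mB|].
    move=> s As; apply: HB => /= /(_ (AD _ (lexx 0) _ As)).
    by rewrite indicE mem_set// => /eqP; rewrite eqe oner_eq0.
  by rewrite B0 muA.
have e0 : 0 < l * nrm (ind (A 0)) / 2 by rewrite divr_gt0// mulr_gt0.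
have [N /(_ N (leqnn N))] := H _ e0.
have M1 : Emem (fun s => star f s - star f s * (1 - ind (A N%:R) s)).
  apply: (mem_le _ Msf) => [|s _ _].
    apply: measurable_funB; first exact: mem_measurable Msf.
    by apply: measurable_funM; [exact: mem_measurable Msf|apply: measurable_funB].
  rewrite mulrBr mulr1 opprB addrC subrK normrM ler_piMr// indicE ger0_norm//.
  by case: (_ \in _).
rewrite subr0 ger0_norm ?nrm_ge0// leNgt => /negP; apply.
apply: (@lt_le_trans _ _ (l * nrm (ind (A N%:R)))).
  by rewrite NA//; lra.
rewrite -{1}(gtr0_norm l0) -nrmZ; last exact: MA.
apply: ler_nrm => //; first exact: measurable_funM.
move=> s Ds s0; rewrite mulrBr mulr1 opprB addrC subrK !normrM (gtr0_norm l0).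
rewrite ler_wpM2r// (ger0_norm (star_ge0 _ _ _)) ltW// lf//.
Qed.

(** A staircase below r with M steps of height eta. Composed with f it is a combination of
    indicators of level sets of f. *)
Definition layers (eta : R) (M : nat) (r : R) : R :=
  \sum_(l < M) eta * ((l.+1%:R * eta < r)%R)%:R.

Lemma layers_ub eta M r : 0 < eta -> 0 <= r -> layers eta M r <= Num.min r (M%:R * eta).
Proof.
move=> eta0 r0; elim: M => [|M IH].
  by rewrite /layers big_ord0 mul0r le_min r0 lexx.
rewrite /layers big_ord_recr/= -/(layers eta M r).
move: IH; rewrite !le_min => /andP[H1 H2]; case: ltP => Mr.
  by rewrite mulr1 -natr1 mulrDl mul1r lerD2r H2 andbT; move: Mr;
    rewrite -natr1 mulrDl mul1r; lra.
by rewrite mulr0 addr0 H1/= -natr1 mulrDl mul1r; lra.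
Qed.

Lemma layers_full eta M r : 0 < eta -> M%:R * eta < r -> layers eta M r = M%:R * eta.
Proof.
move=> eta0 Mr; rewrite /layers (eq_bigr (fun=> eta)).
  by rewrite sumr_const card_ord mulr_natl.
move=> l _; suff -> : l.+1%:R * eta < r by rewrite mulr1.
by apply: le_lt_trans Mr; rewrite ler_pM2r// ler_nat.
Qed.

(** The error is min(r, eta) rather than eta, so that [small_min] bounds its norm even on [0,
    oo). *)
Lemma layers_lb eta M r : 0 < eta -> 0 <= r ->
  Num.min r (M%:R * eta) - Num.min r eta <= layers eta M r.
Proof.
move=> eta0 r0; elim: M => [|M IH].
  rewrite /layers big_ord0 mul0r subr_le0 min_r//.
  by rewrite le_min r0 ltW.
rewrite /layers big_ord_recr/= -/(layers eta M r) -natr1 mulrDl mul1r.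
have M0 : 0 <= M%:R * eta by rewrite mulr_ge0// ltW.
case: (ltP (M%:R * eta) r) => Mr.
  rewrite (layers_full eta0 Mr).
  case: (leP r eta) => re; case: (leP r (M%:R * eta + eta)) => rM;
    rewrite /= ?mulr1 ?mulr0 ?addr0; lra.
move: IH; rewrite (min_l Mr) => IH.
rewrite min_l; last by lra.
apply: le_trans IH _; rewrite lerDl.
by case: ltP; rewrite ?mulr1 ?mulr0// ltW.
Qed.

Hypothesis nontrivial : exists2 f, Emem f & nrm f = 1.

Let memI := mem_indic halpha symE fatouE star_points nontrivial.

Definition level f (l : R) : set R := [set s | D s /\ l < f s].

Lemma measurable_level f l : measurable_fun [set: R] f -> measurable (level f l).
Proof.
move=> mf; apply: measurableI; first exact: (measurable_dom halpha).
have := mf measurableT _ (measurable_itv `]l, +oo[); rewrite setTI.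
by congr measurable; apply/seteqP; split=> s /=; rewrite in_itv/= andbT.
Qed.

Lemma mu_level f l : (forall s, 0 <= f s) -> mu (level f l) = dist alpha f l.
Proof.
by move=> f0; congr (mu _); apply/seteqP; split=> s /= [Ds]; rewrite ger0_norm.
Qed.

(** The staircases of the f_i are positive combinations of indicators of level sets. Passing to
    initial intervals of the same measures turns them into the staircases of the f_i*, because the
    level sets of f_i* are these intervals, up to the point 0. *)
Theorem nrm_sum_star (I : finType) (f : I -> R -> R) :
  (forall i, Emem (f i)) -> (forall i s, 0 <= f i s) ->
  nrm (fun s => \sum_i f i s) <= nrm (fun s => \sum_i star (f i) s).
Proof.
move=> Mf f0; apply/ler_addgt0Pr => e e0.
have mf i := mem_measurable (Mf i).
have MS i := mem_star halpha symE (Mf i).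
(* Each function contributes two errors, its part below eta_i and its part above M eta_i. *)
pose e' := e / (2 * (#|I|%:R + 1)).
have e'0 : 0 < e' by rewrite divr_gt0// mulr_gt0// ltr_wpDl.
have /choice[eta Heta] : forall i, exists c, 0 < c /\ nrm (fun s => Num.min (f i s) c) <= e'.
  move=> i; have [c c0 Hc] := small_min halpha symE fatouE star_points (f0 i) (Mf i) e'0.
  by exists c; split=> //; apply: Hc; rewrite ltW/=.
have eta0 i : 0 < eta i by have [] := Heta i.
have /choice[C HC] : forall i, exists C0, 0 < C0 /\ forall C, C0 <= C ->
    nrm (fun s => f i s - Num.min (f i s) C) <= e'.
  move=> i; have [c c0 Hc] := small_excess halpha symE fatouE star_points (f0 i) (Mf i) e'0.
  by exists c.
(* A common number of steps makes the layers a family indexed by a product, while the heights eta_i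
   may differ. *)
pose M := \max_i (Num.truncn (C i / eta i)).+1.
have HM i : C i <= M%:R * eta i.
  rewrite -ler_pdivrMr//; apply: ltW; apply: lt_le_trans (truncnS_gt _) _.
  by rewrite ler_nat; exact: leq_bigmax.
have Meta i : 0 <= M%:R * eta i by rewrite mulr_ge0// ltW.
pose L i s := layers (eta i) M (f i s).
pose c (p : I * 'I_M) := eta p.1.
pose A (p : I * 'I_M) := level (f p.1) (p.2.+1%:R * eta p.1).
have lev0 (p : I * 'I_M) : 0 < p.2.+1%:R * eta p.1 by rewrite mulr_gt0// ltr0n.
have mA p : measurable (A p) by exact: measurable_level.
have AD p : A p `<=` D by move=> s [].
have muA p : mu (A p) = dist alpha (f p.1) (p.2.+1%:R * eta p.1) by exact: mu_level.
have Ay p : (mu (A p) < +oo)%E by rewrite muA; exact: dist_fin.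
have c0 p : 0 <= c p by rewrite ltW// /c.
have MA p := (memI (mA p) (AD p) (Ay p)).1.
have LE s : D s -> \sum_i L i s = \sum_p c p * ind (A p) s.
  move=> Ds; rewrite /L /layers pair_bigA/=; apply: eq_bigr => -[i l] _ /=.
  rewrite /c /= indicE; congr (_ * (nat_of_bool _)%:R).
  by apply/idP/idP => [H|]; [rewrite inE; split|rewrite inE => -[]].
have MI p : Emem (ind `[0, fine (mu (A p))[%classic).
  apply: (mem_indic_itv halpha symE fatouE star_points nontrivial).
  rewrite fineK ?ge0_fin_numE ?measure_ge0// muA -distE; apply: distrf_le_alpha => //.
  exact: (L0_EFin (mf p.1)).
have SE s : D s -> 0 < s -> \sum_i layers (eta i) M (star (f i) s) =
    \sum_p c p * ind `[0, fine (mu (A p))[%classic s.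
  move=> Ds s0; rewrite /layers pair_bigA/=; apply: eq_bigr => -[i l] _ /=.
  rewrite /c /= indicE; congr (_ * (nat_of_bool _)%:R).
  have lv := lt_star halpha symE (Mf i) Ds s0 (ltW (lev0 (i, l))).
  have fA : mu (A (i, l)) \is a fin_num by rewrite ge0_fin_numE ?measure_ge0.
  apply/idP/idP => [/lv|]; rewrite inE/= in_itv/= (ltW s0)/=.
    by rewrite -(muA (i, l)) -{1}(fineK fA) lte_fin.
  by move=> H; apply/lv; rewrite -(muA (i, l)) -(fineK fA) lte_fin.
have MLc := mem_sum (index_enum (I * 'I_M)%type) (fun p => memZ (c p) (MA p)).
have MSc := mem_sum (index_enum (I * 'I_M)%type) (fun p => memZ (c p) (MI p)).
have Mf' := mem_sum (index_enum I) Mf.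
have MS' := mem_sum (index_enum I) MS.
have step1 : nrm (fun s => \sum_p c p * ind `[0, fine (mu (A p))[%classic s) <=
    nrm (fun s => \sum_i star (f i) s).
  apply: ler_nrm => //; first exact: mem_measurable MSc.
  move=> s Ds s0; rewrite -SE// !ger0_norm.
  - apply: ler_sum => i _.
    have := layers_ub M (eta0 i) (star_ge0 alpha (f i) s).
    by rewrite le_min => /andP[].
  - by apply: sumr_ge0 => i _; exact: star_ge0.
  - apply: sumr_ge0 => i _; apply: sumr_ge0 => l _.
    by rewrite mulr_ge0// ltW.
have step2 := le_trans (sum_initial halpha symE fatouE star_points nontrivial c0 mA AD Ay) step1.
apply: le_trans (nrm_lerD Mf' MLc) _; apply: lerD => //.
have Mmin i := mem_min (f0 i) (ltW (eta0 i)) (Mf i).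
have Mmin2 i := mem_min (f0 i) (Meta i) (Mf i).
have Mex i := memB (Mf i) (Mmin2 i).
have Mtot i := memD (Mmin i) (Mex i).
apply: (@le_trans _ _ (nrm (fun s => \sum_i (Num.min (f i s) (eta i) +
    (f i s - Num.min (f i s) (M%:R * eta i)))))).
  apply: ler_nrm.
  - by apply: (@mem_measurable _ _ E); exact: memB.
  - exact: (mem_sum (index_enum I) Mtot).
  - move=> s Ds s0; rewrite -LE// -sumrB; apply: le_trans (ler_norm_sum _ _ _) _.
    apply: le_trans (ler_norm _); apply: ler_sum => i _.
    have := layers_ub M (eta0 i) (f0 i s); have := layers_lb M (eta0 i) (f0 i s).
    rewrite /L le_min => lb /andP[ub _]; rewrite ger0_norm ?subr_ge0//.
    by move: lb; lra.
apply: le_trans (nrm_sum (index_enum I) Mtot) _.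
apply: (@le_trans _ _ (\sum_(i : I) (e' + e'))).
  apply: ler_sum => i _; apply: le_trans (nrmD (Mmin i) (Mex i)) _.
  by apply: lerD; [exact: (Heta i).2|apply: (HC i).2].
rewrite sumr_const -[_ *+ #|I|]mulr_natl.
have -> : #|I|%:R * (e' + e') = e * (#|I|%:R / (#|I|%:R + 1)).
  by rewrite /e'; field; rewrite lt0r_neq0// ltr_wpDl.
by rewrite ler_piMr ?(ltW e0)// ler_pdivrMr ?ltr_wpDl// mul1r lerDl.
Qed.

End Majorization.

(** * The layer-cake formula *)

Section LayerCake.
Local Open Scope classical_set_scope.
Local Open Scope ring_scope.
Variables (R : realType).
Notation mu := (@lebesgue_measure R).

(** Tonelli for the indicator of the region 0 <= l < F(s). *)
Lemma layer_cake (F : R -> R) : measurable_fun [set: R] F -> (forall s, 0 <= F s) ->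
  (\int[mu]_s (F s)%:E = \int[mu]_l (if (0 <= l)%R then mu [set s | (l < F s)%R] else 0))%E.
Proof.
move=> mF F0.
pose A : set (R * R) := [set p | 0 <= p.2 /\ p.2 < F p.1].
have mA : measurable (A : set (measurableTypeR R * measurableTypeR R)).
  rewrite (_ : A = (fun p : measurableTypeR R * measurableTypeR R => 0 <= p.2) @^-1` [set true] `&`
    (fun p : measurableTypeR R * measurableTypeR R => p.2 < F p.1) @^-1` [set true]); last first.
    by apply/seteqP; split=> p.
  apply: measurableI.
  - rewrite -[X in measurable X]setTI; apply: measurable_fun_ler => //.
  - rewrite -[X in measurable X]setTI; apply: measurable_fun_ltr => //.
    by apply: measurableT_comp.
have h1 s : (\int[mu]_l (\1_A (s, l))%:E = (F s)%:E)%E.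
  transitivity (\int[mu]_l (\1_(`[0, F s[%classic : set R) l)%:E)%E.
    apply: eq_integral => l _; congr ((nat_of_bool _)%:R%:E).
    by apply/idP/idP; rewrite !inE/= in_itv/= => /andP.
  rewrite integral_indic// setIT; exact: mu_initial_itv.
have h2 l : (\int[mu]_s (\1_A (s, l))%:E =
    if (0 <= l)%R then mu [set s | (l < F s)%R] else 0)%E.
  have mFl : measurable [set s | l < F s].
    have := mF measurableT _ (measurable_itv `]l, +oo[); rewrite setTI.
    by congr measurable; apply/seteqP; split=> s /=; rewrite in_itv/= andbT.
  case: (leP 0 l) => l0.
    transitivity (\int[mu]_s (\1_[set s | l < F s] s)%:E)%E.
      apply: eq_integral => s _; congr ((nat_of_bool _)%:R%:E).
      by apply/idP/idP; rewrite !inE/= ?l0; [case|].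
    by rewrite integral_indic// setIT.
  rewrite integral0_eq// => s _; rewrite indicE memNset//= => -[/= l0' _].
  by move: l0; rewrite ltNge l0'.
transitivity (\int[mu]_s \int[mu]_l (\1_A (s, l))%:E)%E.
  by apply: eq_integral => s _; rewrite h1.
transitivity (\int[mu]_l \int[mu]_s (\1_A (s, l))%:E)%E; last first.
  by apply: eq_integral => l _; rewrite h2.
apply: (@fubini_tonelli _ _ (measurableTypeR R) (measurableTypeR R) R mu mu (fun p => (\1_A p)%:E)).
- by apply/measurable_EFinP; exact: measurable_indic.
- by move=> p; rewrite lee_fin indicE.
Qed.

End LayerCake.

(** * Norm control of integrals over bounded intervals *)

Section LocalIntegral.
Local Open Scope classical_set_scope.
Local Open Scope ring_scope.
Variables (R : realType) (alpha : \bar R).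
Hypothesis halpha : alpha = 1%E \/ alpha = +oo%E.
Variable E : BFS alpha.
Hypothesis symE : symmetric_space E.
Hypothesis fatouE : Fatou_property E.
Variable k : nat.
Notation mu := (@lebesgue_measure R).
Notation D := (dom alpha).
Notation Emem := (@Emem R alpha E).
Notation nrm := (@nrm R alpha E).
Notation star := (@star R alpha).
Implicit Types f g : R -> R.
Hypothesis star_points : forall f, Emem f -> nrm f = 1 -> real_point E k (star f).
Hypothesis nontrivial : exists2 f, Emem f & nrm f = 1.
Local Notation ind A := (\1_A : R -> R).
Local Notation cells m S := (@cells R m _ S).
Let memI := mem_indic halpha symE fatouE star_points nontrivial.
Let smallI := small_indic halpha symE fatouE star_points nontrivial.

Lemma ssn_mean_pos (n : nat) (p : ('I_n -> R) -> R) (a : 'I_n -> R) :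
  symmetric_seminorm p -> (0 < n)%N -> p (fun=> (\sum_j a j) / n%:R) <= p a.
Proof. by case: n p a => // n p a hp _; exact: ssn_mean. Qed.

Section Mean.
Variable T : nat.
Hypotheses (T0 : (0 < T)%N) (Ta : (T%:R%:E <= alpha)%E).
Let I0T : set R := `[0, T%:R[%classic.

Lemma I0T_sub : I0T `<=` D. Proof. exact: initial_subE. Qed.

Lemma mem_I0T : Emem (ind I0T).
Proof. exact: (mem_indic_itv halpha symE fatouE star_points nontrivial Ta). Qed.

(** On a grid, the constant mean value on [0, T) has norm at most that of the step function, by
    averaging over shifts of the cells; approximation removes the grid. *)
Lemma mean_indic (I : finType) (c : I -> R) (A : I -> set R) :
  (forall i, 0 <= c i) -> (forall i, measurable (A i)) -> (forall i, A i `<=` I0T) ->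
  (\sum_i c i * fine (mu (A i))) * nrm (ind I0T) <=
  T%:R * nrm (fun s => \sum_i c i * ind (A i) s).
Proof.
move=> c0 mA AT.
have AD i : A i `<=` D := subset_trans (AT i) I0T_sub.
have mT : measurable I0T by exact: measurable_itv.
have Ay i : (mu (A i) < +oo)%E.
  apply: (@le_lt_trans _ _ (mu I0T)).
    by apply: le_measure; rewrite ?inE; [exact: mA|exact: mT|exact: AT].
  by rewrite mu_initial_itv ?ltry.
have MA i := (memI (mA i) (AD i) (Ay i)).1.
have w0 : 0 <= nrm (ind I0T) by apply: nrm_ge0; exact: mem_I0T.
set w := nrm (ind I0T) in w0 *.
apply/ler_addgt0Pr => e e0.
pose C := \sum_i c i; have C0 : 0 <= C by apply: sumr_ge0.
have TC0 : 0 <= T%:R * C by rewrite mulr_ge0.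
have Cw0 : 0 <= C * w by rewrite mulr_ge0.
pose e' := e / (4 * (T%:R * C + 1)).
have e'0 : 0 < e' by rewrite divr_gt0// mulr_gt0// ltr_wpDl.
have [d0 d00 Hd0] := smallI e'0.
(* The first bound controls the change of the norm, the second the change C * d of the integral,
   multiplied by w. *)
pose d := Num.min d0 (e / (2 * (C * w + 1))).
have dpos : 0 < d by rewrite lt_min d00 divr_gt0// mulr_gt0// ltr_wpDl.
have Hd B : measurable B -> B `<=` D -> (mu B <= d%:E)%E ->
    Emem (ind B) /\ nrm (ind B) <= e'.
  move=> mB BD Bd; apply: Hd0 => //; apply: le_trans Bd _.
  by rewrite lee_fin ge_min lexx.
have /choice[m0 Hm0] := fun i => approx_by_cells (mA i) (AT i) dpos.
pose m := \max_i m0 i.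
have /choice[S HS] : forall i, exists S : {set 'I_(T * 2 ^ m)},
    (mu (A i `\` cells m S) <= d%:E)%E /\ (mu (cells m S `\` A i) <= d%:E)%E.
  by move=> i; apply: Hm0; exact: leq_bigmax.
have mS i := @measurable_cells R m _ (S i).
have Sy i : (mu (cells m (S i)) < +oo)%E by rewrite mu_cells ltry.
have SD i := cells_sub Ta (S := S i).
have MS i := (memI (mS i) (SD i) (Sy i)).1.
have n0 : (0 < T * 2 ^ m)%N by rewrite muln_gt0 T0 expn_gt0.
have hp := step_seminorm halpha symE fatouE star_points nontrivial m Ta.
have le1 : nrm (fun s => \sum_i c i * ind (cells m (S i)) s) <=
    nrm (fun s => \sum_i c i * ind (A i) s) + C * (2 * e').
  by apply: indic_sum_close => // i; have [H1 H2] := HS i; exact: (indic_close Hd).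
pose r := (\sum_j weight c S j) / (T * 2 ^ m)%:R.
have le2 : r * w <= nrm (fun s => \sum_i c i * ind (cells m (S i)) s).
  rewrite -step_weight; apply: le_trans (ssn_mean_pos (weight c S) hp n0).
  rewrite [X in nrm X](_ : _ = fun s => r * ind I0T s).
    by rewrite (nrmZ r mem_I0T) -/w ler_wpM2r// ler_norm.
  apply/funext => s.
  have -> : I0T = cells m [set: 'I_(T * 2 ^ m)]%SET.
    have -> : [set: 'I_(T * 2 ^ m)]%SET = initial_segment (T * 2 ^ m) (T * 2 ^ m).
      by apply/setP => j; rewrite !inE ltn_ord.
    by rewrite cells_initial// natrM natrX -mulrA divff ?mulr1.
  rewrite indic_cells /step mulr_sumr; apply: eq_bigr => j _.
  by rewrite finset.in_setT mul1r.
have rT : T%:R * r = \sum_i c i * (#|S i|%:R / 2 ^+ m).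
  rewrite /r /weight exchange_big/= natrM natrX.
  under eq_bigr => i _ do rewrite -mulr_sumr -natr_sum.
  rewrite mulr_suml mulr_sumr; apply: eq_bigr => i _.
  have -> : (\sum_(j < T * 2 ^ m) (j \in S i))%N = #|S i|.
    by rewrite -sum1_card [RHS]big_mkcond; apply: eq_bigr => j _; case: (j \in S i).
  field; rewrite pnatr_eq0 -lt0n T0/= lt0r_neq0// pow2_gt0//.
have rlow : \sum_i c i * fine (mu (A i)) - C * d <= T%:R * r.
  rewrite rT /C mulr_suml -sumrB; apply: ler_sum => i _; rewrite -mulrBr ler_wpM2l//.
  have [H1 _] := HS i; have := mu_diff_bound (mA i) (mS i) (Ay i) (Sy i) H1.
  by rewrite mu_cells/=; lra.
have k1 : (\sum_i c i * fine (mu (A i)) - C * d) * w <=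
    T%:R * (nrm (fun s => \sum_i c i * ind (A i) s) + C * (2 * e')).
  apply: le_trans (ler_wpM2r w0 rlow) _; rewrite -mulrA ler_wpM2l ?ler0n//.
  exact: le_trans le2 le1.
have k2 : C * d * w <= e / 2.
  apply: (@le_trans _ _ (C * w * (e / (2 * (C * w + 1))))).
    by rewrite mulrAC ler_wpM2l// ge_min lexx orbT.
  have -> : C * w * (e / (2 * (C * w + 1))) = e / 2 * (C * w / (C * w + 1)).
    by field; rewrite lt0r_neq0// ltr_wpDl.
  by rewrite ler_piMr ?divr_ge0 ?(ltW e0)// ler_pdivrMr ?ltr_wpDl// mul1r lerDl.
have k3 : T%:R * (C * (2 * e')) <= e / 2.
  have -> : T%:R * (C * (2 * e')) = e / 2 * (T%:R * C / (T%:R * C + 1)).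
    by rewrite /e'; field; rewrite lt0r_neq0// ltr_wpDl.
  by rewrite ler_piMr ?divr_ge0 ?(ltW e0)// ler_pdivrMr ?ltr_wpDl// mul1r lerDl.
move: k1; rewrite mulrBl mulrDr; lra.
Qed.

Import HBNNSimple.

(** The integral is a supremum over simple functions below h, to each of which [mean_indic] applies.
    This embeds E in L^1 of [0, T). *)
Lemma integral_le_nrm h : Emem h -> (forall s, 0 <= h s) ->
  (\int[mu]_(s in I0T) (h s)%:E <= (T%:R / nrm (ind I0T) * nrm h)%:E)%E.
Proof.
move=> Mh h0; have mT : measurable I0T by exact: measurable_itv.
have w0 : 0 < nrm (ind I0T).
  apply: (indic_nrm_gt0 halpha symE fatouE star_points nontrivial) => //; first exact: I0T_sub.
  by rewrite mu_initial_itv// ltry lte_fin ltr0n T0.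
rewrite ge0_integralE; last by move=> s _; rewrite lee_fin.
apply: ge_ereal_sup => _ /= [g gh <-].
have gle s : g s <= h s /\ (0 < g s -> I0T s).
  have := gh s; rewrite patchE; case: (boolP (s \in I0T)) => [/set_mem sT|_].
    by rewrite lee_fin => ->.
  by rewrite lee_fin => gs; split; [exact: le_trans gs (h0 s)|rewrite ltNge gs].
rewrite sintegralE fsbig_finite; last exact: fimfunP.
set F := fset_set (range g).
rewrite big_seq_fsetE/=.
pose c (x : F) := fsval x.
pose A (x : F) := (g @^-1` [set fsval x]) `&` I0T.
have c0 x : 0 <= c x.
  have : fsval x \in F by exact: fsvalP.
  by rewrite /F in_fset_set; [|exact: fimfunP]; rewrite inE => -[s _ e]; rewrite /c -e.
have mg (x : F) : measurable (g @^-1` [set fsval x]) by exact: measurable_funPTI.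
have mA x : measurable (A x) by exact: measurableI.
have AT x : A x `<=` I0T by move=> s [].
have Afin x : mu (A x) \is a fin_num.
  rewrite ge0_fin_numE//; apply: (@le_lt_trans _ _ (mu I0T)).
    by apply: le_measure; rewrite ?inE; [exact: mA|exact: mT|exact: AT].
  by rewrite mu_initial_itv ?ltry.
rewrite (eq_bigr (fun x : F => (c x * fine (mu (A x)))%:E)); last first.
  (* The value 0 has a preimage of infinite measure, but its term vanishes; the preimages of the
     other values lie in [0, T). *)
  move=> x _; rewrite EFinM fineK//; have [x0|x0] := eqVneq (c x) 0.
    by rewrite x0 (_ : fsval x = 0)// !mul0e.
  congr (_ * mu _)%E; apply/seteqP; split=> s; last by case.
  move=> /= gs; split=> //; apply: (gle s).2.
  by rewrite gs lt_neqAle eq_sym x0 c0.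
rewrite sumEFin lee_fin mulrAC ler_pdivlMr//.
apply: le_trans (mean_indic c0 mA AT) _; rewrite ler_wpM2l ?ler0n//.
have AD x : A x `<=` D := subset_trans (AT x) I0T_sub.
have MA x := (memI (mA x) (AD x) _).1.
apply: ler_nrm => //.
  apply: measurable_sum => x; apply: measurable_funM => //.
  by apply: measurable_indic; exact: mA.
move=> s Ds s0; rewrite (ger0_norm (h0 s)) ger0_norm; last first.
  by apply: sumr_ge0 => x _; rewrite mulr_ge0// indicE.
apply: le_trans (gle s).1.
have gF : g s \in F by rewrite /F in_fset_set; [rewrite inE; exists s|exact: fimfunP].
rewrite (bigD1 [` gF]%fset)//= big1 ?addr0 => [|x xg].
  by rewrite /c /= ler_piMr ?fun_ge0// indicE; case: (_ \in _).
rewrite indicE memNset ?mulr0// => -[/= gx _]; move/eqP: xg; apply.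
by apply: val_inj.
Qed.

End Mean.

End LocalIntegral.

(** * Convergence in measure from convergence of rearrangements *)

Section KadecKlee.
Local Open Scope classical_set_scope.
Local Open Scope ring_scope.
Variables (R : realType) (alpha : \bar R).
Hypothesis halpha : alpha = 1%E \/ alpha = +oo%E.
Variable E : BFS alpha.
Hypothesis symE : symmetric_space E.
Hypothesis fatouE : Fatou_property E.
Variable k : nat.
Notation mu := (@lebesgue_measure R).
Notation D := (dom alpha).
Notation Emem := (@Emem R alpha E).
Notation nrm := (@nrm R alpha E).
Notation star := (@star R alpha).
Implicit Types f g h : R -> R.
Hypothesis star_points : forall f, Emem f -> nrm f = 1 -> real_point E k (star f).
Hypothesis nontrivial : exists2 f, Emem f & nrm f = 1.
Local Notation ind A := (\1_A : R -> R).

Definition exc (c r : R) : R := r - Num.min r c.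

Lemma exc_ge0 c r : 0 <= exc c r.
Proof. by rewrite /exc subr_ge0 ge_min lexx. Qed.

Lemma excE c r : exc c r = Num.max (r - c) 0.
Proof. by rewrite /exc; case: (leP r c) => rc; case: (leP (r - c) 0); lra. Qed.

Lemma exc_lip c r r' : exc c r <= exc c r' + `|r - r'|.
Proof.
rewrite !excE; have := ler_norm (r - r'); have := normr_ge0 (r - r').
by case: (leP (r - c) 0); case: (leP (r' - c) 0); lra.
Qed.

(** At the center c of [a, b] the larger value contributes r - c and the smaller one 0; whichever
    side of c the midpoint falls on, the gap is c minus the smaller value or the larger value minus
    c, each at least (b - a)/2. *)
Lemma exc_gap a b r r' : a <= b -> (b <= r /\ r' <= a) \/ (b <= r' /\ r <= a) ->
  2 * exc ((a + b) / 2) (2^-1 * (r + r')) + (b - a) / 2 <=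
  exc ((a + b) / 2) r + exc ((a + b) / 2) r'.
Proof.
move=> ab H; rewrite !excE.
case: (leP (2^-1 * (r + r') - (a + b) / 2) 0); case: (leP (r - (a + b) / 2) 0);
  case: (leP (r' - (a + b) / 2) 0); case: H => -[]; lra.
Qed.

Lemma exc_convex c r r' : 2 * exc c (2^-1 * (r + r')) <= exc c r + exc c r'.
Proof.
rewrite !excE.
by case: (leP (2^-1 * (r + r') - c) 0); case: (leP (r - c) 0); case: (leP (r' - c) 0); lra.
Qed.

(** The indicator turns the integral over the domain into one over the line, where [layer_cake]
    applies. *)
Definition excD c h (s : R) : R := exc c (h s) * ind D s.

Definition J c h : \bar R := (\int[mu]_s (excD c h s)%:E)%E.

Lemma measurable_excD c h : measurable_fun [set: R] h -> measurable_fun [set: R] (excD c h).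
Proof.
move=> mh; apply: measurable_funM; last by apply: measurable_indic; exact: measurable_dom.
by apply: measurable_funB => //; exact: measurable_minr.
Qed.

Lemma excD_ge0 c h s : 0 <= excD c h s.
Proof. by rewrite mulr_ge0 ?exc_ge0. Qed.

Lemma J_dist c h : 0 <= c -> measurable_fun [set: R] h -> (forall s, 0 <= h s) ->
  J c h = (\int[mu]_l (if (0 <= l)%R then dist alpha h (l + c) else 0))%E.
Proof.
move=> c0 mh h0; rewrite /J layer_cake; [|exact: measurable_excD|exact: excD_ge0].
apply: eq_integral => l _; case: leP => // l0; congr (mu _).
apply/seteqP; split=> s; rewrite /excD /= indicE.
  case: (boolP (s \in D)) => [/set_mem Ds|_]; last by rewrite mulr0 ltNge l0.
  by rewrite mulr1 (ger0_norm (h0 s)) /exc; case: (leP (h s) c) => hc; split=> //; lra.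
move=> [Ds]; rewrite (ger0_norm (h0 s)) mem_set// mulr1 /exc.
by case: (leP (h s) c); lra.
Qed.

Lemma J_star c h : 0 <= c -> Emem h -> (forall s, 0 <= h s) -> J c (star h) = J c h.
Proof.
move=> c0 Mh h0; rewrite !J_dist//.
- apply: eq_integral => l _; case: leP => // l0.
  by rewrite (dist_star halpha symE)// addr_ge0.
- exact: (mem_measurable Mh).
- exact: (mem_measurable (mem_star halpha symE Mh)).
- exact: star_ge0.
Qed.

Section ExcessLimit.
Variables (f : R -> R) (h : nat -> R -> R).
Hypotheses (Mf : Emem f) (f0 : forall s, 0 <= f s).
Hypotheses (Mh : forall n, Emem (h n)) (h0 : forall n s, 0 <= h n s).
Hypothesis hf : (fun n => nrm (fun s => star (h n) s - star f s)) @ \oo --> (0 : R).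

(** One T serves all large n, although the h_n are controlled only in norm and only after
    rearrangement: monotonicity of h_n* turns a large value at a late point into a large value on a
    whole unit interval. *)
Lemma tail_bound c : 0 < c -> exists2 T : nat, (0 < T)%N /\ (T%:R%:E <= alpha)%E &
  (forall t, D t -> T%:R <= t -> star f t <= c) /\
  (exists N, forall n, (N <= n)%N -> forall t, D t -> T%:R <= t -> star (h n) t <= c).
Proof.
move=> c0; case: halpha => ha.
  exists 1%N; first by rewrite ha.
  have H t : D t -> 1 <= t -> False by move=> [_]; rewrite ha lte_fin ltNge => /negP.
  by split; [move=> t /H{}H /H|exists 0%N => n _ t /H{}H /H].
have Dpos s : 0 <= s -> D s by move=> s0; split; rewrite ?ha ?ltry.
have c20 : 0 < c / 2 by rewrite divr_gt0.
have dfin := dist_fin halpha symE fatouE star_points Mf c20.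
have dfin' : dist alpha f (c / 2) \is a fin_num by rewrite ge0_fin_numE ?measure_ge0.
pose T0 := (Num.truncn (fine (dist alpha f (c / 2)))).+1.
have T00 : (0 : R) < T0%:R by rewrite ltr0n.
have fT t : T0%:R <= t -> star f t <= c / 2.
  move=> Tt; have t0 := lt_le_trans T00 Tt; rewrite leNgt; apply/negP.
  move=> /(lt_star halpha symE Mf (Dpos _ (ltW t0)) t0 (ltW c20)).
  rewrite -(fineK dfin') lte_fin ltNge => /negP; apply; apply: le_trans Tt.
  exact/ltW/truncnS_gt.
exists T0.+1; first by rewrite ha leey.
split=> [t Dt Tt|].
  apply: le_trans (fT t _) _; last by lra.
  by apply: le_trans Tt; rewrite ler_nat.
(* On this interval f* <= c/2, while h_n*(t) > c for some t >= T0 + 1 would force h_n* > c; their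
   distance would then be at least c/2 times the norm of the indicator. *)
pose A : set R := `[T0%:R, T0.+1%:R[%classic.
have mA : measurable A by exact: measurable_itv.
have AD : A `<=` D.
  by move=> s; rewrite /A /= in_itv/= => /andP[Ts _]; apply: Dpos; exact: le_trans (ltW T00) Ts.
have muA : mu A = 1%E.
  by rewrite lebesgue_measure_itv/= lte_fin ltr_nat ltnSn -EFinB -natrB// subSnn.
have [MA _] : Emem (ind A) /\ _ := mem_indic halpha symE fatouE star_points nontrivial mA AD
  (eq_ind_r (fun x => (x < +oo)%E) (ltry _) muA).
have nA : 0 < nrm (ind A).
  apply: (indic_nrm_gt0 halpha symE fatouE star_points nontrivial) => //.
  by rewrite muA lte_fin ltr01 ltry.
have e0 : 0 < c / 2 * nrm (ind A) / 2 by rewrite divr_gt0// mulr_gt0.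
move/cvg_epsP : hf => /(_ _ e0)[N HN]; exists N => n /HN.
have Md : Emem (fun s => star (h n) s - star f s).
  by apply: memB; exact: mem_star.
rewrite subr0 ger0_norm ?nrm_ge0// => Hn t Dt Tt; rewrite leNgt; apply/negP => ct.
have t0 : 0 < t by apply: lt_le_trans Tt; rewrite ltr0n.
move: Hn; rewrite leNgt => /negP; apply.
apply: (@lt_le_trans _ _ (c / 2 * nrm (ind A))).
  by have := mulr_gt0 c20 nA; lra.
rewrite -[X in X * _](gtr0_norm c20) -nrmZ//; apply: ler_nrm => //.
  by apply: (@mem_measurable _ _ E); exact: memZ.
move=> s Ds s0; rewrite indicE; case: (boolP (s \in A)); last by rewrite mulr0 normr0.
rewrite inE /A /= in_itv/= mulr1 (gtr0_norm c20) => /andP[Ts sT].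
have fs := fT s Ts.
have hs : c < star (h n) s.
  apply/(lt_star halpha symE (Mh n) Ds s0 (ltW c0)).
  apply: (@lt_trans _ _ t%:E); first by rewrite lte_fin; exact: lt_le_trans Tt.
  exact/(lt_star halpha symE (Mh n) Dt t0 (ltW c0)).
by apply: le_trans (ler_norm _); lra.
Qed.

(** J sees only the distribution function, so h_n and f may be replaced by their rearrangements.
    Beyond T these are at most c, and on [0, T) the integral is Lipschitz with respect to the
    norm. *)
Lemma excess_limit c : 0 < c -> (J c f < +oo)%E /\ forall e, 0 < e ->
  exists N, forall n, (N <= n)%N ->
    (J c (h n) <= J c f + e%:E)%E /\ (J c f <= J c (h n) + e%:E)%E.
Proof.
move=> c0; have [T [T0 Ta] [fT [N1 hT]]] := tail_bound c0.
pose I0T : set R := `[0, T%:R[%classic.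
have mI : measurable I0T by exact: measurable_itv.
have ID : I0T `<=` D by exact: initial_subE.
pose C := T%:R / nrm (ind I0T).
have intC g : Emem g -> (forall s, 0 <= g s) ->
    (\int[mu]_(s in I0T) (g s)%:E <= (C * nrm g)%:E)%E.
  exact: (integral_le_nrm halpha symE fatouE star_points nontrivial T0 Ta).
have loc g : (forall t, D t -> T%:R <= t -> g t <= c) -> measurable_fun [set: R] g ->
    J c g = (\int[mu]_(s in I0T) (exc c (g s))%:E)%E.
  move=> gT mg; rewrite /J [RHS]integral_mkcond; apply: eq_integral => s _.
  rewrite /excD patchE indicE; case: (boolP (s \in I0T)) => sI.
    by rewrite (mem_set (ID _ (set_mem sI))) mulr1.
  case: (boolP (s \in D)) => [/set_mem Ds|_]; last by rewrite mulr0.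
  rewrite mulr1 /exc min_l ?subrr// gT// leNgt; apply: contra sI => sT.
  by rewrite inE /I0T /= in_itv/= sT andbT; case: Ds.
have Msf := mem_star halpha symE Mf.
have Msh n := mem_star halpha symE (Mh n).
have mexc g : measurable_fun [set: R] g -> measurable_fun I0T (fun s => (exc c (g s))%:E).
  move=> mg; apply/measurable_EFinP; apply: (@measurable_funS _ _ _ _ setT) => //.
  by apply: measurable_funB => //; exact: measurable_minr.
have lip g g' : Emem g -> Emem g' ->
    (\int[mu]_(s in I0T) (exc c (g s))%:E <=
     \int[mu]_(s in I0T) (exc c (g' s))%:E + (C * nrm (fun s => (g s - g' s)%R))%:E)%E.
  move=> Mg Mg'; have Mgg := memB Mg Mg'.
  rewrite -(nrm_norm Mgg); apply: le_trans (leeD2l _ (intC _ (mem_norm Mgg) _)); last by [].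
  rewrite -ge0_integralD//.
  - apply: ge0_le_integral => //.
    + by move=> s _; rewrite lee_fin exc_ge0.
    + exact: mexc (mem_measurable Mg).
    + apply: emeasurable_funD; first exact: mexc (mem_measurable Mg').
      apply/measurable_EFinP; apply: (@measurable_funS _ _ _ _ setT) => //.
      exact: mem_measurable (mem_norm Mgg).
    + by move=> s _; rewrite -EFinD lee_fin exc_lip.
  - by move=> s _; rewrite lee_fin exc_ge0.
  - exact: mexc (mem_measurable Mg').
  - apply/measurable_EFinP; apply: (@measurable_funS _ _ _ _ setT) => //.
    exact: mem_measurable (mem_norm Mgg).
have Jf : J c f = (\int[mu]_(s in I0T) (exc c (star f s))%:E)%E.
  exact: etrans (esym (J_star (ltW c0) Mf f0)) (loc _ fT (mem_measurable Msf)).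
split.
  rewrite Jf; apply: (@le_lt_trans _ _ (C * nrm (star f))%:E); last by rewrite ltry.
  apply: le_trans (intC _ Msf (star_ge0 _ _)); apply: ge0_le_integral => //.
  - by move=> s _; rewrite lee_fin exc_ge0.
  - exact: mexc (mem_measurable Msf).
  - apply/measurable_EFinP; apply: (@measurable_funS _ _ _ _ setT) => //.
    exact: mem_measurable Msf.
  - move=> s _; rewrite lee_fin /exc gerBl le_min star_ge0 ltW//.
have C0 : 0 <= C.
  rewrite divr_ge0//; apply: nrm_ge0.
  exact: (mem_I0T halpha symE fatouE star_points nontrivial Ta).
move=> e e0; have e'0 : 0 < e / (C + 1) by rewrite divr_gt0// ltr_wpDl.
move/cvg_epsP : hf => /(_ _ e'0)[N2 HN2].
exists (maxn N1 N2) => n; rewrite geq_max => /andP[/hT{}hT /HN2].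
have Md := memB (Msh n) Msf.
rewrite subr0 ger0_norm ?nrm_ge0// => Hn.
have Jh : J c (h n) = (\int[mu]_(s in I0T) (exc c (star (h n) s))%:E)%E.
  exact: etrans (esym (J_star (ltW c0) (Mh n) (h0 n)))
    (loc _ hT (mem_measurable (Msh n))).
have Ce : ((C * nrm (fun s => (star (h n) s - star f s)%R))%:E <= e%:E)%E.
  rewrite lee_fin; apply: le_trans (ler_wpM2l C0 Hn) _.
  by rewrite mulrCA ler_piMr ?(ltW e0)// ler_pdivrMr ?ltr_wpDl// mul1r lerDl.
split.
  by rewrite Jf Jh; apply: le_trans (lip _ _ (Msh n) Msf) _; exact: leeD2l.
rewrite Jf Jh; apply: le_trans (lip _ _ Msf (Msh n)) _; apply: leeD2l.
by rewrite nrm_distC.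
Qed.

End ExcessLimit.

Definition crossing f g (a b : R) : set R :=
  [set s | D s /\ ((b <= f s /\ g s <= a) \/ (b <= g s /\ f s <= a))].

Lemma measurable_crossing f g a b : measurable_fun [set: R] f ->
  measurable_fun [set: R] g -> measurable (crossing f g a b).
Proof.
move=> mf mg; apply: measurableI; first exact: (measurable_dom halpha).
have up h r : measurable_fun [set: R] h -> measurable [set s | r <= h s].
  move=> mh; have := mh measurableT _ (measurable_itv `[r, +oo[); rewrite setTI.
  by congr measurable; apply/seteqP; split=> s /=; rewrite in_itv/= andbT.
have dn h r : measurable_fun [set: R] h -> measurable [set s | h s <= r].
  move=> mh; have := mh measurableT _ (measurable_itv `]-oo, r]); rewrite setTI.
  by congr measurable; apply/seteqP; split=> s /=; rewrite in_itv/=.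
by apply: measurableU; apply: measurableI; [exact: up|exact: dn|exact: up|exact: dn].
Qed.

(** Integrating the convexity gap gives (b - a)/2 * mu(crossing) <= J(f) + J(g_n) - 2 J(w_n), where
    w_n is the midpoint; all three quantities have the same limit J(f). *)
Lemma crossing_small f (g : nat -> R -> R) : Emem f -> (forall s, 0 <= f s) ->
  (forall n, Emem (g n)) -> (forall n s, 0 <= g n s) ->
  (fun n => nrm (fun s => star (g n) s - star f s)) @ \oo --> (0 : R) ->
  (fun n => nrm (fun s => star (half_sum f g n) s - star f s)) @ \oo --> (0 : R) ->
  forall a b d, 0 <= a -> a < b -> 0 < d ->
  exists N, forall n, (N <= n)%N -> (mu (crossing f (g n) a b) <= d%:E)%E.
Proof.
move=> Mf f0 Mg g0 gf wf a b d a0 ab d0.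
pose c := (a + b) / 2; have c0 : 0 < c by rewrite /c; lra.
pose w := half_sum f g.
have Mw n : Emem (w n) by exact: mem_half_sum.
have w0 n s : 0 <= w n s by rewrite /w /half_sum mulr_ge0 ?invr_ge0 ?addr_ge0 ?f0 ?g0.
(* Divided by 3 because the limit of J is used once for g_n and twice for the midpoint. *)
pose e := d * ((b - a) / 2) / 3.
have ba0 : 0 < (b - a) / 2 by lra.
have e0 : 0 < e by rewrite divr_gt0// mulr_gt0.
have [Jy Hg] := excess_limit Mf f0 Mg g0 gf c0.
have [_ Hw] := excess_limit Mf f0 Mw w0 wf c0.
have [N1 {}Hg] := Hg _ e0; have [N2 {}Hw] := Hw _ e0.
exists (maxn N1 N2) => n; rewrite geq_max => /andP[/Hg[Jg _] /Hw[_ Jw]].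
have mf := mem_measurable Mf; have mg := mem_measurable (Mg n).
have mB := measurable_crossing a b mf mg.
set B := crossing _ _ _ _ in mB *.
have mJ h : Emem h -> measurable_fun setT (fun s => (excD c h s)%:E).
  by move=> /mem_measurable mh; apply/measurable_EFinP; exact: measurable_excD.
have ge0J h : forall s, setT s -> (0 <= (excD c h s)%:E)%E.
  by move=> s _; rewrite lee_fin excD_ge0.
have key : (J c (w n) + J c (w n) + ((b - a) / 2)%:E * mu B <= J c f + J c (g n))%E.
  have -> : (((b - a) / 2)%:E * mu B = \int[mu]_s ((b - a) / 2 * ind B s)%:E)%E.
    under eq_integral do rewrite EFinM.
    rewrite ge0_integralZl//; last 2 first.
    - by apply/measurable_EFinP; exact: measurable_indic.
    - by rewrite lee_fin ltW.
    by rewrite integral_indic// setIT.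
  have mBI : measurable_fun setT (fun s => ((b - a) / 2 * ind B s)%:E).
    by apply/measurable_EFinP; apply: measurable_funM => //; exact: measurable_indic.
  have B0 : forall s, setT s -> (0 <= ((b - a) / 2 * ind B s)%:E)%E.
    by move=> s _; rewrite lee_fin mulr_ge0// ltW.
  rewrite /J -!ge0_integralD//; try exact: mJ; try exact: ge0J.
  - apply: ge0_le_integral => //.
    + by move=> s sT; apply: adde_ge0; [apply: adde_ge0; exact: ge0J|exact: B0].
    + by apply: emeasurable_funD => //; apply: emeasurable_funD; exact: mJ.
    + by apply: emeasurable_funD => //; exact: mJ.
    + move=> s _; rewrite -!EFinD lee_fin /excD !indicE.
      case: (boolP (s \in D)) => Ds; rewrite ?mulr1 ?mulr0; last first.
        rewrite memNset ?mulr0 ?addr0// => -[Ds' _]; by rewrite (mem_set Ds') in Ds.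
      case: (boolP (s \in B)) => sB; rewrite ?mulr1 ?mulr0 ?addr0.
        have [_ /(exc_gap (ltW ab))] := set_mem sB.
        by rewrite /w /half_sum -/c; lra.
      by have := exc_convex c (f s) (g n s); rewrite /w /half_sum; lra.
  - by move=> s _; rewrite adde_ge0// lee_fin excD_ge0.
  - by apply: emeasurable_funD; exact: mJ.
move: key Jg Jw Jy.
have J0 h : (0 <= J c h)%E by apply: integral_ge0 => s _; rewrite lee_fin excD_ge0.
have fin (x : \bar R) : (0 <= x)%E -> (x < +oo)%E -> x \is a fin_num by move=> ? ?; rewrite ge0_fin_numE.
move=> key Jg Jw Jy.
have Ff : J c f \is a fin_num by exact: fin.
have Fg : J c (g n) \is a fin_num.
  by apply: fin => //; apply: le_lt_trans Jg _; rewrite -(fineK Ff) -EFinD ltry.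
have fgy : (J c f + J c (g n) < +oo)%E by rewrite -(fineK Ff) -(fineK Fg) -EFinD ltry.
have B0 : (0 <= ((b - a) / 2)%:E * mu B)%E by rewrite mule_ge0// lee_fin ltW.
have Fw : J c (w n) \is a fin_num.
  apply: fin => //; apply: le_lt_trans fgy; apply: le_trans key.
  by rewrite -addeA leeDl// adde_ge0.
have FB : mu B \is a fin_num.
  apply: fin => //; rewrite ltey; apply/eqP => By; move: key; rewrite By.
  rewrite gt0_muley ?lte_fin// addey ?leye_eq; last by rewrite -(fineK Fw) -EFinD.
  by move=> /eqP ey; move: fgy; rewrite ey ltxx.
move: key Jg Jw.
rewrite -(fineK Ff) -(fineK Fg) -(fineK Fw) -(fineK FB) -EFinM -!EFinD !lee_fin => key Jg Jw.
have : (b - a) / 2 * fine (mu B) <= (b - a) / 2 * d.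
  have : (b - a) / 2 * fine (mu B) <= 3 * e by lra.
  by rewrite /e; lra.
by rewrite ler_pM2l.
Qed.

End KadecKlee.

(** * From convergence in measure to norm convergence, and the equivalences *)

Section Final.
Local Open Scope classical_set_scope.
Local Open Scope ring_scope.
Variables (R : realType) (alpha : \bar R).
Hypothesis halpha : alpha = 1%E \/ alpha = +oo%E.
Variable E : BFS alpha.
Hypothesis symE : symmetric_space E.
Hypothesis fatouE : Fatou_property E.
Variable k : nat.
Hypothesis k0 : (0 < k)%N.
Notation mu := (@lebesgue_measure R).
Notation D := (dom alpha).
Notation Emem := (@Emem R alpha E).
Notation nrm := (@nrm R alpha E).
Notation star := (@star R alpha).
Implicit Types f : R -> R.
Local Notation ind A := (\1_A : R -> R).

Section StarPoints.
Hypothesis star_points : forall f, Emem f -> nrm f = 1 -> real_point E k (star f).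

Lemma star_cvg f g : Emem f -> (forall s, 0 <= f s) -> nrm f = 1 ->
  (forall n, Emem (g n)) -> (forall n s, 0 <= g n s) ->
  (fun n => nrm (g n)) @ \oo --> (1 : R) -> lower_sums E k f g ->
  (fun n => nrm (fun s => star (g n) s - star f s)) @ \oo --> (0 : R).
Proof.
move=> Mf f0 Nf Mg g0 Ng Sg.
have nontriv : exists2 f, Emem f & nrm f = 1 by exists f.
have Msg n := mem_star halpha symE (Mg n).
apply: (real_point_ext (star_points Mf Nf) (g := fun n => star (g n))) => //.
  by under eq_fun do rewrite (nrm_star halpha symE (Mg _)).
move=> phi hphi; have [a ak ale] := Sg phi hphi; exists a => // n.
apply: le_trans (ale n) _.
(* Index 0 carries f and the others the k subsequence terms, so that [nrm_sum_star] handles all k +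
   1 functions together. *)
pose F (i : 'I_k.+1) := if unlift ord0 i is Some j then g (phi j n) else f.
have MF i : Emem (F i) by rewrite /F; case: unlift.
have F0 i s : 0 <= F i s by rewrite /F; case: unlift => [j|].
have := nrm_sum_star halpha symE fatouE star_points nontriv MF F0.
rewrite (_ : (fun s => \sum_i F i s) = fun s => f s + \sum_(i < k) g (phi i n) s).
  rewrite (_ : (fun s => \sum_i star (F i) s) =
    fun s => star f s + \sum_(i < k) star (g (phi i n)) s)//.
  apply/funext => s; rewrite big_ord_recl /F unlift_none; congr (_ + _).
  by apply: eq_bigr => i _; rewrite liftK.
apply/funext => s; rewrite big_ord_recl /F unlift_none; congr (_ + _).
by apply: eq_bigr => i _; rewrite liftK.
Qed.

(** The part of r between the heights e and C, so that r = min(r, e) + window + (r - min(r, C)). *)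
Definition window (e C r : R) : R := Num.min r C - Num.min r e.

(** Either the windows differ by at most 2 eta, and by 0 unless r or r' exceeds e, or some grid
    interval of length eta separates r from r', in which case C is a crude bound. *)
Lemma window_dist (e C eta r r' : R) : 0 < e -> e <= C -> 0 < eta ->
  0 <= r -> 0 <= r' ->
  `|window e C r - window e C r'| <=
  2 * eta * ((e < r)%R%:R + (e < r')%R%:R) +
  C * \sum_(j < (Num.truncn (C / eta)).+1)
    `[< (e + j.+1%:R * eta <= r /\ r' <= e + j%:R * eta) \/
        (e + j.+1%:R * eta <= r' /\ r <= e + j%:R * eta) >]%:R.
Proof.
move=> e0 eC eta0; wlog rr : r r' / r' <= r.
  move=> H r0 r'0; have [rr|/ltW rr] := leP r' r; first exact: H.
  rewrite distrC; apply: le_trans (H _ _ rr r'0 r0) _.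
  rewrite [X in 2 * eta * X]addrC lerD2l; apply: ler_wpM2l; first by lra.
  apply: ler_sum => j _; rewrite le_eqVlt; apply/orP; left; apply/eqP.
  congr ((nat_of_bool _)%:R); apply: asbool_equiv_eq.
  by split=> -[]; [right|left|right|left].
move=> r0 r'0.
have C0 : 0 <= C by lra.
have S0 : 0 <= C * \sum_(j < (Num.truncn (C / eta)).+1)
    `[< (e + j.+1%:R * eta <= r /\ r' <= e + j%:R * eta) \/
        (e + j.+1%:R * eta <= r' /\ r <= e + j%:R * eta) >]%:R.
  by rewrite mulr_ge0// sumr_ge0// => j _; rewrite ler0n.
have w0 : 0 <= window e C r' by rewrite /window; case: (leP r' C); case: (leP r' e); lra.
have wC : window e C r <= C - e by rewrite /window; case: (leP r C); case: (leP r e); lra.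
have ww : window e C r' <= window e C r.
  by rewrite /window; case: (leP r C); case: (leP r e); case: (leP r' C); case: (leP r' e); lra.
rewrite ger0_norm ?subr_ge0//.
have [re|re] := leP r e.
  have -> : window e C r = 0 by rewrite /window !min_l ?subrr//; lra.
  have : window e C r' = 0 by rewrite /window !min_l ?subrr//; lra.
  move=> ->; rewrite subrr addr_ge0// mulr_ge0 ?addr_ge0//; lra.
have [d|d] := leP (window e C r - window e C r') (2 * eta).
  apply: le_trans d _; apply: (@le_trans _ _ (2 * eta * 1)); first by lra.
  apply: ler_wpDr => //; rewrite ler_wpM2l ?mulr_ge0 ?(ltW eta0)//.
  by rewrite lerDl.
pose q := window e C r'.
(* The first grid point above q. As the windows differ by more than 2 eta, the next grid point is
   still below the larger window. *)
pose j := (Num.truncn (q / eta)).+1.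
have qj : q < j%:R * eta by rewrite -ltr_pdivrMr// truncnS_gt.
have jq : j%:R * eta <= q + eta.
  rewrite /j -natr1 mulrDl mul1r lerD2r -ler_pdivlMr//.
  by rewrite truncn_le divr_ge0// ltW.
have r'e : r' <= e + q.
  rewrite leNgt; apply/negP => lt.
  have : C - e <= q by move: lt; rewrite /q /window; case: (leP r' C); case: (leP r' e); lra.
  by move: d wC; rewrite -/q; lra.
have er : e + window e C r <= r.
  by rewrite /window; case: (leP r C); case: (leP r e); lra.
have jM : (j < (Num.truncn (C / eta)).+1)%N.
  rewrite ltnS truncn_ge_nat; last by rewrite divr_ge0// ltW.
  by rewrite ler_pdivlMr//; move: wC d; rewrite -/q; lra.
apply: ler_wpDl; first by rewrite mulr_ge0 ?addr_ge0//; lra.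
rewrite (bigD1 (Ordinal jM))//= asboolT; last first.
  left; split; last by lra.
  rewrite -natr1 mulrDl mul1r; move: d; rewrite -/q; lra.
rewrite mulrDr mulr1; apply: ler_wpDr.
  by rewrite mulr_ge0// sumr_ge0// => i _; rewrite ler0n.
by lra.
Qed.

(** Low and high parts are small for f by order continuity and for g_n because g_n* is close to f*.
    Between c and C, convergence in measure is enough: the crossing sets become small and hence have
    indicators of small norm. *)
Lemma star_points_pos f : Emem f -> (forall s, 0 <= f s) -> nrm f = 1 -> pos_point E k f.
Proof.
move=> Mf f0 Nf; split=> // g Mg g0 Ng Sg.
have nontriv : exists2 f, Emem f & nrm f = 1 by exists f.
have gf := star_cvg Mf f0 Nf Mg g0 Ng Sg.
have Mw n := mem_half_sum n Mf Mg.
have w0 n s : 0 <= half_sum f g n s by rewrite /half_sum mulr_ge0 ?invr_ge0 ?addr_ge0 ?f0 ?g0.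
have wf := star_cvg Mf f0 Nf Mw w0 (half_sum_nrm Mf Nf Mg Ng Sg k0)
  (half_sum_lower Mf Nf Mg Ng Sg).
have cross := crossing_small halpha symE fatouE star_points nontriv Mf f0 Mg g0 gf wf.
apply/cvg_epsP => e e0.
pose e1 := e / 8; have e10 : 0 < e1 by rewrite divr_gt0.
(* The eight units e1 are spent as 1 + 2 on the low parts of f and g_n, 1 + 2 on the high parts, and
   2 on the windows. *)
have [c c0 Hc] := small_min halpha symE fatouE star_points f0 Mf e10.
have [C1 C10 HC] := small_excess halpha symE fatouE star_points f0 Mf e10.
pose C := Num.max C1 c.
have cC : c <= C by rewrite le_max lexx orbT.
have C0 : 0 <= C by apply: le_trans cC; exact: ltW.
have Hmin : nrm (fun s => Num.min (f s) c) <= e1 by apply: Hc; rewrite ltW/=.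
have Hexc : nrm (fun s => f s - Num.min (f s) C) <= e1 by apply: HC; rewrite le_max lexx.
have Msf := mem_star halpha symE Mf; have sf0 := star_ge0 alpha f.
(* The indicators of {f > c} and {g_n > c} have norms at most 1/c and 2/c, so the 2 eta term costs
   at most 2 eta * 3/c = e1. *)
pose eta := e1 * c / 6; have eta0 : 0 < eta by rewrite divr_gt0// mulr_gt0.
pose M := (Num.truncn (C / eta)).+1.
have M0 : 0 < M%:R :> R by rewrite ltr0n.
(* There are M crossing sets, each weighted by C, so together they cost at most e1. *)
pose e2 := e1 / (C * M%:R).
have CM0 : 0 < C * M%:R by rewrite mulr_gt0//; exact: lt_le_trans cC.
have e20 : 0 < e2 by rewrite divr_gt0.
have [d d0 Hd] := small_indic halpha symE fatouE star_points nontriv e20.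
pose a (j : nat) := c + j%:R * eta.
have a0 j : 0 <= a j by rewrite addr_ge0 ?(ltW c0)// mulr_ge0// ltW.
have ab j : a j < a j.+1 by rewrite /a -natr1 mulrDl mul1r; lra.
have /choice[Nj HNj] : forall j : nat, exists N, forall n, (N <= n)%N ->
    (mu (crossing alpha f (g n) (a j) (a j.+1)) <= d%:E)%E.
  by move=> j; exact: cross.
pose N1 := \max_(j < M) Nj j.
move/cvg_epsP : gf => /(_ _ e10)[N2 HN2].
move/cvg_epsP : Ng => /(_ _ ltr01)[N3 HN3].
exists (maxn N1 (maxn N2 N3)) => n; rewrite !geq_max => /and3P[nN1 /HN2 gf /HN3 Ng'].
have Msg := mem_star halpha symE (Mg n); have sg0 := star_ge0 alpha (g n).
have Mgf := memB Msg Msf.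
move: gf; rewrite subr0 ger0_norm ?nrm_ge0// => gf.
have Ng2 : nrm (g n) <= 2 by move: Ng'; rewrite ler_norml; lra.
have c0' := ltW c0.
have Mmin h : (forall s, 0 <= h s) -> Emem h -> Emem (fun s => Num.min (h s) c).
  by move=> h0 Mh; exact: mem_min.
have MminC h : (forall s, 0 <= h s) -> Emem h -> Emem (fun s => Num.min (h s) C).
  by move=> h0 Mh; exact: mem_min.
(* The low part of g_n is measured on g_n*, then compared with that of f* using that truncation is
   1-Lipschitz. *)
have Gmin : nrm (fun s => Num.min (g n s) c) <= 2 * e1.
  rewrite -(nrm_min_star halpha symE (g0 n) c0' (Mg n)).
  rewrite -(nrm_min_star halpha symE f0 c0' Mf) in Hmin.
  have Mm := memB (Mmin _ sg0 Msg) (Mmin _ sf0 Msf).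
  apply: le_trans (nrm_lerD (Mmin _ sg0 Msg) (Mmin _ sf0 Msf)) _.
  rewrite mulr_natl mulr2n; apply: lerD => //; apply: le_trans gf; apply: ler_nrm => //.
    exact: mem_measurable Mm.
  move=> s _ _; case: (leP (star (g n) s) c) => ?; case: (leP (star f s) c) => ? //.
  - rewrite ler0_norm ?ler0_norm; lra.
  - rewrite ger0_norm ?ger0_norm; lra.
  - by rewrite subrr normr0.
have Gexc : nrm (fun s => g n s - Num.min (g n s) C) <= 2 * e1.
  rewrite -(nrm_excess_star halpha symE (g0 n) C0 (Mg n)).
  rewrite -(nrm_excess_star halpha symE f0 C0 Mf) in Hexc.
  have M1 := memB Msg (MminC _ sg0 Msg); have M2 := memB Msf (MminC _ sf0 Msf).
  have Mm := memB M1 M2.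
  apply: le_trans (nrm_lerD M1 M2) _.
  rewrite mulr_natl mulr2n; apply: lerD => //; apply: le_trans gf; apply: ler_nrm => //.
    exact: mem_measurable Mm.
  move=> s _ _; case: (leP (star (g n) s) C) => ?; case: (leP (star f s) C) => ?.
  - by rewrite !subrr normr0.
  - rewrite ler0_norm ?ler0_norm; lra.
  - rewrite ger0_norm ?ger0_norm; lra.
  - by rewrite !opprB le_eqVlt; apply/orP; left; apply/eqP; congr (`|_|); lra.
have mlev h : Emem h -> measurable (level alpha h c).
  by move=> Mh; apply: measurable_level => //; exact: mem_measurable Mh.
have MI h : Emem h -> (forall s, 0 <= h s) -> Emem (ind (level alpha h c)) /\
    nrm (ind (level alpha h c)) <= c^-1 * nrm h.
  move=> Mh h0; rewrite -(gtr0_norm (_ : 0 < c^-1)) ?invr_gt0// -nrmZ//.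
  apply: nrm_le; [by apply: measurable_indic; exact: mlev|exact: memZ|].
  move=> s Ds s0; rewrite indicE; case: (boolP (s \in _)) => [/set_mem[_ cs]|_]; last by rewrite normr0.
  by rewrite normr1 ger0_norm ?mulr_ge0 ?invr_ge0// ler_pdivlMl// mulr1 ltW.
pose B (j : 'I_M) := crossing alpha f (g n) (a j) (a j.+1).
have mB j : measurable (B j).
  exact: measurable_crossing (mem_measurable Mf) (mem_measurable (Mg n)).
have MB j : Emem (ind (B j)) /\ nrm (ind (B j)) <= e2.
  apply: Hd => //; first by move=> s [].
  by apply: HNj; apply: leq_trans nN1; exact: (leq_bigmax j).
have Mwin h : (forall s, 0 <= h s) -> Emem h -> Emem (fun s => window c C (h s)).
  by move=> h0 Mh; apply: memB; [exact: MminC|exact: Mmin].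
have [MIf NIf] := MI f Mf f0; have [MIg NIg] := MI (g n) (Mg n) (g0 n).
have MIfg := memZ (2 * eta) (memD MIg MIf).
have MBs := memZ C (mem_sum (index_enum 'I_M) (fun j => (MB j).1)).
have Mww := memB (Mwin _ (g0 n) (Mg n)) (Mwin _ f0 Mf).
have Gwin : nrm (fun s => window c C (g n s) - window c C (f s)) <= 2 * e1.
  apply: (@le_trans _ _ (nrm (fun s => 2 * eta * (ind (level alpha (g n) c) s +
      ind (level alpha f c) s) + C * \sum_(j < M) ind (B j) s))).
    apply: ler_nrm; [exact: mem_measurable Mww|exact: memD|].
    move=> s Ds s0.
    have H := @window_dist c C eta (g n s) (f s) c0 cC eta0 (g0 n s) (f0 s).
    apply: le_trans H _; apply: le_trans (ler_norm _).
    rewrite le_eqVlt; apply/orP; left; apply/eqP; rewrite !indicE.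
    congr (_ * (_ + _) + _ * _).
    - congr ((nat_of_bool _)%:R); apply/idP/idP => [H'|]; first by rewrite inE.
      by rewrite inE => -[].
    - congr ((nat_of_bool _)%:R); apply/idP/idP => [H'|]; first by rewrite inE.
      by rewrite inE => -[].
    - apply: eq_bigr => j _; rewrite indicE; congr ((nat_of_bool _)%:R).
      apply/idP/idP => [/asboolP P|].
        by rewrite inE; split=> //; case: P; [right|left].
      by rewrite inE => -[_ P]; apply/asboolP; case: P; [right|left].
  apply: le_trans (nrmD MIfg MBs) _; rewrite [leRHS]mulr_natl mulr2n; apply: lerD.
    rewrite nrmZ; last exact: memD.
    rewrite gtr0_norm ?mulr_gt0//.
    apply: (@le_trans _ _ (2 * eta * (c^-1 * 3))).
      apply: ler_wpM2l; first by rewrite mulr_ge0// ltW.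
      apply: le_trans (nrmD MIg MIf) _; apply: le_trans (lerD NIg NIf) _.
      by rewrite -mulrDr ler_wpM2l ?invr_ge0// Nf; lra.
    by rewrite /eta le_eqVlt; apply/orP; left; apply/eqP; field; rewrite lt0r_neq0.
  rewrite nrmZ; last by apply: mem_sum => j; have [] := MB j.
  rewrite ger0_norm//; apply: (@le_trans _ _ (C * (M%:R * e2))).
    rewrite ler_wpM2l//; apply: le_trans (nrm_sum (index_enum 'I_M) (fun j => (MB j).1)) _.
    rewrite mulr_natl -[M in _ *+ M]card_ord -sumr_const; apply: ler_sum => j _.
    by have [] := MB j.
  by rewrite mulrA /e2 mulrC divfK// lt0r_neq0.
have Md := memB (Mg n) Mf.
rewrite subr0 ger0_norm ?nrm_ge0//.
have Mming := Mmin _ (g0 n) (Mg n); have Mminf := Mmin _ f0 Mf.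
have Mexg := memB (Mg n) (MminC _ (g0 n) (Mg n)); have Mexf := memB Mf (MminC _ f0 Mf).
have -> : (fun s => g n s - f s) = (fun s => (window c C (g n s) - window c C (f s)) +
   ((Num.min (g n s) c - Num.min (f s) c) +
    ((g n s - Num.min (g n s) C) - (f s - Num.min (f s) C)))).
  by apply/funext => s; rewrite /window; lra.
have T1 := memB Mming Mminf; have T2 := memB Mexg Mexf.
apply: le_trans (nrmD Mww (memD T1 T2)) _.
have := nrmD T1 T2; have := nrm_sub Mming Mminf; have := nrm_sub Mexg Mexf.
by rewrite /e1 in Hmin Hexc Gmin Gexc Gwin *; lra.
Qed.

End StarPoints.

Lemma real_point_eq f f' : Emem f -> Emem f' -> (forall s, D s -> 0 < s -> f s = f' s) ->
  real_point E k f -> real_point E k f'.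
Proof.
move=> Mf Mf' ff [_ Nf H]; split=> //.
  by rewrite -Nf; apply: eq_nrm => // s Ds s0; rewrite ff.
move=> g Mg Ng Sg.
have -> : (fun n => nrm (fun s => g n s - f' s)) = fun n => nrm (fun s => g n s - f s).
  by apply/funext => n; apply: eq_nrm; [exact: memB|exact: memB|move=> s Ds s0; rewrite ff].
apply: H => // phi hphi.
rewrite [X in X @ _ --> _](_ : _ =
  fun n => nrm (fun s => f' s + \sum_(i < k) g (phi i n) s)); first exact: Sg.
apply/funext => n; apply: eq_nrm.
- exact: (sum_max_mem phi n Mf Mg).
- exact: (sum_max_mem phi n Mf' Mg).
- by move=> s Ds s0; rewrite ff.
Qed.

Lemma LFkR_plus_real : LFkR_plus k E -> LFkR k E.
Proof.
move=> H x [Ex Nx]; apply/LFkR_pointP => //.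
have Mr := mem_real_rep halpha Ex.
apply: real_point_of_abs => //; apply: real_point_pos.
have Ea : bfs_mem E (fun s => `|x s|%E) by have [[]] := H x (conj Ex Nx).
have := (LFkR_pointP halpha k Ea).1 (H x (conj Ex Nx)).
apply: real_point_eq; [exact: mem_real_rep|exact: mem_norm|].
by move=> s Ds _; rewrite !real_repE//; case: (x s) => [r| |]; rewrite /= ?normr0.
Qed.

Lemma LFkR_star_real : LFkR_star k E -> LFkR k E.
Proof.
move=> H x [Ex Nx]; apply/LFkR_pointP => //.
have star_points f : Emem f -> nrm f = 1 -> real_point E k (star f).
  move=> Mf Nf; have [Er _] := mem_rearr halpha symE Mf.2.
  exact: (LFkR_pointP halpha k Er).1 (H _ (conj Mf.2 Nf)).
have Mr := mem_real_rep halpha Ex.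
apply: real_point_of_abs => //; apply: star_points_pos => //; first exact: mem_norm.
by rewrite nrm_norm// nrm_real_rep.
Qed.

Lemma LFkR_plusW : LFkR k E -> LFkR_plus k E.
Proof.
move=> H x [Ex Nx]; apply: H.
have La : L0 alpha (fun s => `|x s|%E).
  exact: (measurableT_comp (@abse_measurable R setT)) (bfs_L0 Ex).
have [|Ea le1] := bfs_ideal La Ex; first by apply: ae_on_pos => s _ _; rewrite abse_id.
split=> //; apply/le_anti; rewrite -Nx le1/=.
by have [|//] := bfs_ideal (bfs_L0 Ex) Ea; apply: ae_on_pos => s _ _; rewrite abse_id.
Qed.

Lemma LFkR_starW : LFkR k E -> LFkR_star k E.
Proof.
by move=> H x [Ex Nx]; apply: H; have [Er Nr] := mem_rearr halpha symE Ex; split; rewrite ?Nr.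
Qed.

End Final.

Theorem theorem4p6 (R : realType) (alpha : \bar R)
    (halpha : alpha = 1%E \/ alpha = +oo%E)
    (k : nat) (hk : (2 <= k)%N)
    (E : BFS alpha) (symE : symmetric_space E) (fatouE : Fatou_property E) :
  (LFkR k E <-> LFkR_plus k E) /\ (LFkR_plus k E <-> LFkR_star k E).
Proof.
have k0 : (0 < k)%N by exact: ltnW.
have plus := LFkR_plus_real halpha k0 (E := E).
have star := LFkR_star_real halpha symE fatouE k0.
split; split; first exact: LFkR_plusW.
- exact: plus.
- by move=> /plus; exact: LFkR_starW.
- by move=> /star; exact: LFkR_plusW.
Qed.
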